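(* Let $\alpha\in[0,1]$ and let $u_0\in L^\infty(\mathbb{R}^2)$ be a divergence-free vector field with vorticity $\omega_0\in{\rm L^\alpha bmo}(\mathbb{R}^2)$. Assume that $u$ is a smooth solution of the two-dimensional Euler system with initial velocity $u_0$, and let $\omega$ be its vorticity. Then, for all $t\ge0$, $$\|u(t)\|_{L^\infty(\mathbb{R}^2)}+\|\omega(t)\|_{{\rm L^{\alpha-1}bmo}(\mathbb{R}^2)}\le C(t)\big(1+\|\omega_0\|_{{\rm L^\alpha bmo}(\mathbb{R}^2)}\big)\quad\text{if }\alpha\in[0,1[,$$ and $$\|u(t)\|_{L^\infty(\mathbb{R}^2)}+\|\omega(t)\|_{{\rm L_{\log}bmo}(\mathbb{R}^2)}\le C(t)\big(1+\|\omega_0\|_{{\rm Lbmo}(\mathbb{R}^2)}\big)\quad\text{if }\alpha=1.$$ Here $C(t)$ is a positive function depending on the initial data.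
   Context: The two-dimensional incompressible Euler system is $\partial_tu+(u\cdot\nabla)u+\nabla\Pi=0$, $\operatorname{div}u=0$ on $[0,\infty[\times\mathbb{R}^2$, $u|_{t=0}=u_0$. The vorticity of $u=(u_1,u_2)$ is $\omega=\partial_1u_2-\partial_2u_1$ (the overall sign plays no role), and $\omega_0$ is the vorticity of $u_0$. The pressure is the one recovered from $u$ by $\Pi=\sum_{i,j=1}^2\frac{\partial_i\partial_j}{-\Delta}(u_iu_j)$, i.e. $\nabla\Pi=\sum_{i,j}\nabla\partial_i\partial_j(-\Delta)^{-1}(u_iu_j)$ (a Fourier multiplier of order one, well defined on bounded functions because its low-frequency part is convolution with an integrable kernel). Let $\operatorname{Avg}_\Omega(f)=\frac1{m(\Omega)}\int_\Omega f\,dy$ and let $B_r(x)$ be the open ball. For $\alpha\in[-1,\infty[$, $$\|f\|_{{\rm L^\alpha bmo}}:=\sup_{x,\,r}(-\log r)^\alpha\frac1{m(B_r(x))}\int_{B_r(x)}|f(y)-\operatorname{Avg}_{B_r(x)}(f)|\,dy+\sup_{x}\int_{B_1(x)}|f(y)|\,dy,$$ with $r$ ranging over $]0,1[$ if $\alpha\ge0$ and over $]0,1/2[$ if $\alpha<0$; ${\rm L^\alpha bmo}$ is the set of locally integrable $f$ with finite norm, and ${\rm Lbmo}={\rm L^1bmo}$. Moreover $$\|f\|_{{\rm L_{\log}bmo}}:=\sup_{x,\,r\in]0,1/2[}\frac{1}{\log(1-\log r)}\frac1{m(B_r(x))}\int_{B_r(x)}|f(y)-\operatorname{Avg}_{B_r(x)}(f)|\,dy+\sup_{x}\int_{B_1(x)}|f(y)|\,dy.$$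 *)

(* Defs.v *)
From HB Require Import structures.
From mathcomp Require Import all_boot all_order all_algebra.
From mathcomp Require Import all_classical all_reals all_analysis.
From mathcomp Require Export complex.

Set Implicit Arguments.
Unset Strict Implicit.
Unset Printing Implicit Defensive.

Import Order.TTheory GRing.Theory Num.Theory.
Import numFieldNormedType.Exports.

Local Open Scope classical_set_scope.
Local Open Scope ring_scope.

Section Plane.
Variable R : realType.

Definition coor (i : 'I_2) (x : R * R) : R := if i == ord0 then x.1 else x.2.

Definition basis (i : 'I_2) : R * R := if i == ord0 then (1, 0) else (0, 1).

Definition dot (x y : R * R) : R := x.1 * y.1 + x.2 * y.2.

(* The library norm on R * R is the max norm, so the Euclidean one is defined
   here. *)
Definition enorm (x : R * R) : R := Num.sqrt (dot x x).

Definition eball (x : R * R) (r : R) : set (R * R) :=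
  [set y | enorm (y - x) < r].

Definition leb2 :
    {measure set (measurableTypeR R * measurableTypeR R) -> \bar R} :=
  (@lebesgue_measure R \x @lebesgue_measure R)%E.

(* f is C^n iff it is continuous and all its directional derivatives exist and
   are C^(n-1). *)
Fixpoint Cn (V W : normedModType R) (n : nat) (f : V -> W) : Prop :=
  if n is m.+1 then
    continuous f /\ forall v, (forall x, derivable f x v) /\ Cn m ('D_v f)
  else continuous f.

Definition smooth (V W : normedModType R) (f : V -> W) : Prop :=
  forall n, Cn n f.

Definition pd (i : 'I_2) (f : R * R -> R) : R * R -> R :=
  fun x => 'D_(basis i) f x.

Definition divergence (u : R * R -> R * R) : R * R -> R :=
  fun x => \sum_(i < 2) pd i (coor i \o u) x.

Definition vorticity (u : R * R -> R * R) : R * R -> R :=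
  fun x => pd ord0 (coor ord_max \o u) x - pd ord_max (coor ord0 \o u) x.

Definition Linfty_norm (u : R * R -> R * R) : \bar R :=
  'N[leb2]_(+oo%E)[EFin \o (enorm \o u)].

Definition in_Linfty (u : R * R -> R * R) : Prop :=
  [/\ measurable_fun setT (fst \o u : measurableTypeR R * measurableTypeR R -> R),
      measurable_fun setT (snd \o u : measurableTypeR R * measurableTypeR R -> R)
    & (Linfty_norm u < +oo)%E].

Definition area (A : set (R * R)) : R := fine (leb2 A).

Definition Avg (A : set (R * R)) (f : R * R -> R) : R :=
  (area A)^-1 * \int[leb2]_(y in A) f y.

Definition osc (x : R * R) (r : R) (f : R * R -> R) : \bar R :=
  ((area (eball x r))^-1%:E *
   \int[leb2]_(y in eball x r) `|f y - Avg (eball x r) f|%:E)%E.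

Definition L1uloc_norm (f : R * R -> R) : \bar R :=
  ereal_sup [set (\int[leb2]_(y in eball x 1) `|f y|%:E)%E | x in setT].

Definition Labmo_norm (alpha : R) (f : R * R -> R) : \bar R :=
  (ereal_sup [set ((- ln p.2) `^ alpha)%:E * osc p.1 p.2 f
     | p in [set p : (R * R) * R |
               (0 < p.2 < if 0 <= alpha then 1 else 2^-1)%R]]
   + L1uloc_norm f)%E.

Definition Llogbmo_norm (f : R * R -> R) : \bar R :=
  (ereal_sup [set (ln (1 - ln p.2))^-1%:E * osc p.1 p.2 f
     | p in [set p : (R * R) * R | (0 < p.2 < 2^-1)%R]]
   + L1uloc_norm f)%E.

Definition loc_integrable (f : R * R -> R) : Prop :=
  forall x r, leb2.-integrable (eball x r) (EFin \o f).

Definition in_Labmo (alpha : R) (f : R * R -> R) : Prop :=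
  loc_integrable f /\ (Labmo_norm alpha f < +oo)%E.

Definition cint (f : R * R -> R[i]) : R[i] :=
  Complex (\int[leb2]_(x in setT) complex.Re (f x))
          (\int[leb2]_(x in setT) complex.Im (f x)).

Definition cis (t : R) : R[i] := Complex (cos t) (sin t).

Definition fourier (phi : R * R -> R) (xi : R * R) : R[i] :=
  cint (fun y => Complex (phi y) 0 * cis (- dot y xi)).

Definition fmult (m : R * R -> R[i]) (phi : R * R -> R) (x : R * R) : R[i] :=
  Complex ((2 * pi) ^- 2) 0 *
  cint (fun xi => cis (dot x xi) * (m xi * fourier phi xi)).

Definition test_function (phi : R * R -> R) : Prop :=
  smooth phi /\ exists M : R, forall x, M < enorm x -> phi x = 0.

(* The distribution m(D) f evaluated at the test function phi, that is
   <f, m(-D) phi>. *)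
Definition fmult_pairing (m : R * R -> R[i]) (f phi : R * R -> R) : R[i] :=
  cint (fun x => Complex (f x) 0 * fmult (fun xi => m (- xi)) phi x).

(* The symbol (i xi_k)(i xi_i)(i xi_j) / |xi|^2 of d_k d_i d_j (-Delta)^-1. *)
Definition pressure_symbol (k i j : 'I_2) (xi : R * R) : R[i] :=
  Complex 0 (- (coor k xi * coor i xi * coor j xi / dot xi xi)).

(* grad P = sum_(i, j) grad d_i d_j (-Delta)^-1 (u_i u_j), as distributions. *)
Definition recovered_pressure (u : R * R -> R * R) (P : R * R -> R) : Prop :=
  forall (k : 'I_2) (phi : R * R -> R), test_function phi ->
    Complex (\int[leb2]_(x in setT) (pd k P x * phi x)) 0 =
    \sum_(i < 2) \sum_(j < 2)
      fmult_pairing (pressure_symbol k i j)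
        (fun x => coor i (u x) * coor j (u x)) phi.

(* A field smooth on [0, +oo[ x R^2 (up to t = 0) is the restriction of a smooth
   field on R x R^2; values at t < 0 are irrelevant.  Boundedness of the velocity,
   locally in time, is what gives a meaning to the pressure. *)
Record euler_solution (u0 : R * R -> R * R) (u : R -> R * R -> R * R) : Prop := {
  euler_smooth : exists2 v : R * (R * R) -> R * R,
    smooth v & forall (t : R) x, 0 <= t -> u t x = v (t, x) ;
  euler_bounded : forall T : R, 0 <= T ->
    exists M : R, forall (t : R) x, 0 <= t <= T -> enorm (u t x) <= M ;
  euler_div : forall (t : R) x, 0 <= t -> divergence (u t) x = 0 ;
  euler_momentum : exists P : R -> R * R -> R, forall t : R, 0 < t ->
    [/\ smooth (P t), recovered_pressure (u t) (P t)
      & forall (k : 'I_2) x,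
        'D_1 (fun s => coor k (u s x)) t
        + \sum_(i < 2) coor i (u t x) * pd i (coor k \o u t) x
        + pd k (P t) x = 0] ;
  euler_init : forall x, u 0 x = u0 x }.

End Plane.

(* Main.v *)
Require Import Defs.
From HB Require Import structures.
From mathcomp Require Import all_boot all_order all_algebra.
From mathcomp Require Import all_classical all_reals all_analysis.
From mathcomp Require Import measurable_realfun.
From mathcomp Require Import ring lra.

Set Implicit Arguments.
Unset Strict Implicit.
Unset Printing Implicit Defensive.

Import Order.TTheory GRing.Theory Num.Theory.
Import numFieldNormedType.Exports.

Local Open Scope classical_set_scope.
Local Open Scope ring_scope.

(* If no solution starts from u0 there is nothing to prove; otherwise u0 is the
   restriction of a smooth bounded field, and every constant below depends only
   on u0 and alpha.
   By the John-Nirenberg inequality on dyadic squares, omega_0 has exponential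
   moments: at scale 2^-k the oscillation is at most C k^-alpha, the means are at
   most Phi_k = C sum_(j < k) j^-alpha, and exp(sigma_k |omega_0|) with sigma_k of
   order k^alpha has integral at most C exp(sigma_k Phi_k) over unit squares.
   The vorticity is transported, so these moments, and the fourth moment, propagate
   on balls larger than the distance travelled by the fluid.
   Velocity: compare u(t, x) with its average at scale R.  The difference is
   controlled by the fourth moment of the vorticity, hence is at most C R, and the
   time derivative of the average is at most C |u|^2 / R, because both the
   advection and the pressure are one derivative of a quadratic expression.  With
   R of order 1 + W exp(B t) and W = sup |u| exp(- B t) this gives W <= C + W / 2.
   Vorticity: for 2^-(k+1) <= r <= 2^-k, convexity of exp(sigma_k .)
   bounds the mean of |omega(t)| over a ball of radius r by
   Phi_k + C k^(1-alpha), that is by C k^(1-alpha), or C (1 + log k) if alpha = 1. *)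

(** * Integration over the plane *)

(** The function C has to be chosen before the solution, so no constant may use the size of u at
    positive times; the local bound on u there only makes W finite, which is what allows W / 2 to be
    absorbed. No flow map and no Biot-Savart integral is built. A moment is propagated by
    integrating F(omega) against a cutoff whose support shrinks at the speed b >= |u|; this costs
    only a bound on |u|, and the distance travelled, the integral of W exp(B s), is at most W exp(B
    t) / B, hence below the averaging scale R. The two unknown sizes thus close on each other. The
    fourth moment is a convenient power: at scale r it loses sqrt(R / r), which is integrable down
    to r = 0. Mean oscillation is not preserved by an area-preserving rearrangement, whereas
    exponential moments of |omega| are. The price appears on a ball of area about 4^-k: the global
    moment says nothing there before |omega| exceeds the means by k ln 4 / sigma_k, which is of
    order k k^-alpha. This is the lost power of the logarithm; for alpha = 1 that term stays bounded
    and the sum of 1 / j in Phi_k leaves log k. *)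

Section Integration.
Variable R : realType.
Notation mT := (measurableTypeR R).

(** The sigma-algebra on the plane is the product one, so continuity yields measurability through
    second countability: the preimage of an open ray is the union of the rational boxes that it
    contains. *)
Lemma continuous_measurable2 (f : R * R -> R) : continuous f ->
  measurable_fun setT (f : mT * mT -> R).
Proof.
move=> cf; apply: (measurability _ (measurable_realfun.RGenOInfty.measurableE R)).
move=> _ [_ [a ->] <-]; rewrite setTI.
pose box (q : rat * rat * rat * rat) : set (R * R) :=
  `]ratr q.1.1.1, ratr q.1.1.2[ `*` `]ratr q.1.2, ratr q.2[.
pose G q := if `[< box q `<=` f @^-1` `]a, +oo[ >] then box q else set0.
suff -> : f @^-1` `]a, +oo[ = \bigcup_q G q.
  apply: countable_bigcupT_measurable => [|q]; first exact: countableP.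
  rewrite /G; case: ifP => _; last exact: measurable0.
  by apply: measurableX; exact: measurable_itv.
apply/seteqP; split => [[x y] /= fa|[x y] [q _]]; last first.
  by rewrite /G; case: ifPn => [/asboolP + /= b|//]; exact.
have : nbhs (x, y) (f @^-1` `]a, +oo[).
  apply: cf; apply: open_nbhs_nbhs; split => //.
move=> [[A B]] /= [[e e0 Ae] [d d0 Bd]] AB.
have exq (z r : R) : 0 < r -> exists p : rat * rat,
    `]ratr p.1, ratr p.2[%classic z /\ `]ratr p.1, ratr p.2[ `<=` ball z r.
  move=> r0.
  have [p1] : exists q : rat, ratr q \in `]z - r, z[ by apply: rat_in_itvoo; lra.
  have [p2] : exists q : rat, ratr q \in `]z, z + r[ by apply: rat_in_itvoo; lra.
  rewrite !in_itv /= => h1 h2; exists (p1, p2); split => /=.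
    by rewrite in_itv /=; lra.
  move=> t /=; rewrite in_itv /= /ball /= => t1.
  by rewrite distrC ltr_distl; lra.
have [p [px pe]] := exq x e e0; have [p' [p'y p'd]] := exq y d d0.
exists (p.1, p.2, p'.1, p'.2) => //.
rewrite /G; case: ifPn => [_|/asboolP h]; first by split.
exfalso; apply: h => -[s t] [/= hs ht].
by apply: (AB (s, t)); split => /=; [exact/Ae/pe|exact/Bd/p'd].
Qed.

Definition aff1 (a r : R) (x : mT) : mT := a + r * x.

Lemma measurable_aff1 a r : measurable_fun setT (aff1 a r).
Proof. by apply: measurable_funD => //; apply: measurable_funM. Qed.

(** By uniqueness of the measure, it suffices to compare [r] times the image measure with Lebesgue
    measure on half-open intervals. [leb2_aff] repeats the argument with measurable rectangles. *)
Lemma lebesgue_measure_aff1 (a r : R) (A : set mT) : 0 < r -> measurable A ->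
  (r%:E * lebesgue_measure (aff1 a r @^-1` A) = lebesgue_measure A)%E.
Proof.
move=> r0 mA.
pose m0 : {measure set mT -> \bar R} := pushforward lebesgue_measure (aff1 a r).
pose m : {measure set mT -> \bar R} := mscale (NngNum (ltW r0)) (m0 (measurable_aff1 a r)).
suff : lebesgue_measure A = m A by move->.
apply: lebesgue_measure_unique => // _ [[u v]] _ <-.
rewrite (_ : m _ = (r%:E * lebesgue_measure (aff1 a r @^-1` `]u, v]))%E) //.
have -> : aff1 a r @^-1` `]u, v] = `](u - a) / r, (v - a) / r]%classic.
  apply/seteqP; split => x /=; rewrite /aff1 !in_itv /= ltr_pdivrMr // ler_pdivlMr //; lra.
rewrite !lebesgue_measure_itv /= !lte_fin ltr_pM2r ?invr_gt0 // ltrD2r.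
case: ifP => _; last by rewrite mule0.
by rewrite -!EFinB -EFinM; congr EFin; field; lra.
Qed.

Lemma leb2X (A B : set mT) : measurable A -> measurable B ->
  leb2 R (A `*` B) = (lebesgue_measure A * lebesgue_measure B)%E.
Proof. by move=> mA mB; rewrite -product_measure1E. Qed.

Definition aff (a : R * R) (r : R) (y : R * R) : R * R := (a.1 + r * y.1, a.2 + r * y.2).

Lemma measurable_aff a r : measurable_fun setT (aff a r : mT * mT -> mT * mT).
Proof.
apply: measurable_fun_pair.
  by apply: measurable_funD => //; apply: measurable_funM => //; exact: measurable_fst.
by apply: measurable_funD => //; apply: measurable_funM => //; exact: measurable_snd.
Qed.

Lemma leb2_aff a r (A : set (mT * mT)) : 0 < r -> measurable A ->
  ((r ^+ 2)%:E * leb2 R (aff a r @^-1` A) = leb2 R A)%E.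
Proof.
move=> r0 mA.
have r20 : 0 <= r ^+ 2 by rewrite exprn_ge0 // ltW.
pose m0 : {measure set (mT * mT) -> \bar R} := pushforward (leb2 R) (aff a r : mT * mT -> mT * mT).
pose m : {measure set (mT * mT) -> \bar R} := mscale (NngNum r20) (m0 (measurable_aff a r)).
suff : leb2 R A = m A by move->.
apply: product_measure_unique => // B C mB mC.
rewrite (_ : m _ = ((r ^+ 2)%:E * leb2 R (aff a r @^-1` (B `*` C)))%E) //.
have -> : aff a r @^-1` (B `*` C) = (aff1 a.1 r @^-1` B) `*` (aff1 a.2 r @^-1` C).
  by [].
have mphi b D : measurable D -> measurable (aff1 b r @^-1` D).
  by move=> mD; rewrite -[X in measurable X]setTI; exact: measurable_aff1.
rewrite leb2X; [|exact: mphi|exact: mphi].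
transitivity (lebesgue_measure B * lebesgue_measure C)%E; last by [].
rewrite -(@lebesgue_measure_aff1 a.1 r B) // -(@lebesgue_measure_aff1 a.2 r C) //.
by rewrite expr2 EFinM muleACA.
Qed.

Lemma ge0_integral_aff a r (f : mT * mT -> \bar R) (D : set (mT * mT)) : 0 < r ->
  measurable D -> measurable_fun D f -> (forall x, 0 <= f x)%E ->
  ((r ^+ 2)%:E * \int[leb2 R]_(y in aff a r @^-1` D) f (aff a r y) = \int[leb2 R]_(x in D) f x)%E.
Proof.
move=> r0 mD mf f0.
have r20 : 0 <= r ^+ 2 by rewrite exprn_ge0 // ltW.
pose m0 : {measure set (mT * mT) -> \bar R} := pushforward (leb2 R) (aff a r : mT * mT -> mT * mT).
rewrite -[X in (_ * X)%E](@ge0_integral_pushforward _ _ _ _ _ _ (@measurable_aff a r) (leb2 R) D f) //.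
transitivity (\int[mscale (NngNum r20) (m0 (measurable_aff a r))]_(y in D) f y)%E.
  by rewrite ge0_integral_mscale.
by apply: eq_measure_integral => A mA AD; exact: leb2_aff.
Qed.

Lemma is_derive_inv (V : normedModType R) (f : V -> R) (x v : V) (df : R) : f x != 0 ->
  is_derive x v f df -> is_derive x v (fun y => (f y)^-1) (- (f x) ^- 2 * df).
Proof.
move=> f0 [fd <-]; apply: DeriveDef; first exact: derivableV.
by rewrite deriveV.
Qed.

(* Every integral below is dominated by a multiple of the single weight wt, so
   that adm replaces integrability and supplies all the dominations needed to
   differentiate under the integral. *)
Definition q (s : R) : R := ((1 + `|s|) * Num.sqrt (1 + `|s|))^-1.
Definition wt (x : R * R) : R := q x.1 * q x.2.

Lemma q_gt0 s : 0 < q s.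
Proof. by rewrite invr_gt0 mulr_gt0 ?sqrtr_gt0 //; have := normr_ge0 s; lra. Qed.

Lemma wt_gt0 x : 0 < wt x.
Proof. by rewrite mulr_gt0 ?q_gt0. Qed.

Lemma continuous_q : continuous q.
Proof.
move=> s; apply: cvgV.
  by rewrite gt_eqF // mulr_gt0 ?sqrtr_gt0 //; have := normr_ge0 s; lra.
have c1 : (fun s : R => 1 + `|s|) x @[x --> s] --> 1 + `|s|.
  by apply: cvgD; [exact: cvg_cst|exact: norm_continuous].
by apply: cvgM => //; apply: continuous_comp; [exact: c1|exact: sqrt_continuous].
Qed.

(** The exponent 3/2 in [q] is a compromise: larger than 1 for integrability, yet small enough for
    [wt] to dominate |x|^-3 at infinity, which is the decay of the pressure kernel. *)
Lemma integrable_q : lebesgue_measure.-integrable setT (EFin \o (q : mT -> R)).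
Proof.
apply/integrableP; split.
  by apply/measurable_EFinP; apply: continuous_measurable_fun; exact: continuous_q.
rewrite (@eq_integral _ _ _ lebesgue_measure setT (fun x => (q x)%:E)); last first.
  by move=> x _ /=; rewrite ger0_norm // ltW // q_gt0.
rewrite ge0_symfun_integralT; last 3 first.
- by move=> x; exact/ltW/q_gt0.
- exact: continuous_q.
- by move=> x /=; rewrite /q normrN.
have -> : [set x : R | 0 <= x] = `[0, +oo[%classic.
  by apply/seteqP; split => x /=; rewrite in_itv /= ?andbT.
pose F (x : R) := - 2 / Num.sqrt (1 + x).
have dF (x : R) : 0 <= x -> is_derive x 1 F (q x).
  move=> x0; have x1 : 0 < 1 + x by lra.
  have s0 : 0 < Num.sqrt (1 + x) by rewrite sqrtr_gt0.
  have d1 : is_derive x 1 (fun x : R => 1 + x) 1.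
    have := is_deriveD (is_derive_cst (1:R) x 1) (is_derive_id x 1).
    by rewrite add0r.
  have d2 : is_derive x 1 (fun x : R => Num.sqrt (1 + x)) ((2 * Num.sqrt (1 + x))^-1).
    have := @is_derive1_comp R Num.sqrt (fun x : R => 1 + x) x _ _ (is_derive1_sqrt x1) d1.
    by rewrite mulr1.
  have d3 := is_deriveZ (- 2) (@is_derive_inv _ (fun x : R => Num.sqrt (1 + x)) x 1 _ (lt0r_neq0 s0) d2).
  apply: is_derive_eq d3 _; rewrite /q ger0_norm // /GRing.scale /=.
  have e : Num.sqrt (1 + x) ^+ 2 = 1 + x by rewrite sqr_sqrtr // ltW.
  move: e s0; set t := Num.sqrt _ => e s0.
  by rewrite -e; field; rewrite lt0r_neq0.
have E : (\int[lebesgue_measure]_(x in `[0%R, +oo[) (q x)%:E = 0%:E - (F 0)%:E)%E.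
  apply: ge0_continuous_FTC2y.
  - by move=> x _; exact/ltW/q_gt0.
  - by apply: continuous_subspaceT; exact: continuous_q.
  - rewrite -(mulr0 (- 2)); apply: cvgM; first exact: cvg_cst.
    apply/gtr0_cvgV0.
      near=> x; rewrite sqrtr_gt0.
      suff : 0 < x by lra.
      by near: x; exact: nbhs_pinfty_gt.
    apply/cvgryPge => A; near=> x.
    rewrite (le_trans (ler_norm A)) // -sqrtr_sqr ler_wsqrtr //.
    suff : A ^+ 2 < x by lra.
    by near: x; apply: nbhs_pinfty_gt; rewrite num_real.
  - by move=> x x0; have [] := dF _ (ltW x0).
  - apply: cvg_at_right_filter; apply: differentiable_continuous.
    by apply/derivable1_diffP; have [] := dF _ (lexx 0).
  - move=> x; rewrite in_itv /= andbT => x0; rewrite derive1E.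
    by apply: derive_val; exact/dF/ltW.
by rewrite E -EFinB -EFinM ltry.
Unshelve. all: by end_near. Qed.


Local Open Scope ereal_scope.
Lemma integrable_wt : (leb2 R).-integrable setT (EFin \o (wt : mT * mT -> R)).
Proof.
have mwt : measurable_fun setT (EFin \o (wt : mT * mT -> R)).
  apply/measurable_EFinP; apply: measurable_funM.
    apply: measurableT_comp; last exact: measurable_fst.
    by apply: continuous_measurable_fun; exact: continuous_q.
  apply: measurableT_comp; last exact: measurable_snd.
  by apply: continuous_measurable_fun; exact: continuous_q.
apply: (proj2 (integrable12ltyP lebesgue_measure lebesgue_measure mwt)) => /=.
have iq := integrable_q.
pose c := \int[@lebesgue_measure R]_x (q x)%:E.
have cfin : c \is a fin_num by exact: integrable_fin_num.
have c0 : 0 <= c by apply: integral_ge0 => x _; rewrite lee_fin ltW // q_gt0.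
rewrite (@eq_integral _ _ _ lebesgue_measure setT (fun x => c * (q x)%:E)); last first.
  move=> x _.
  rewrite (@eq_integral _ _ _ lebesgue_measure setT (fun y => (q x)%:E * (q y)%:E)); last first.
    by move=> y _; rewrite -EFinM ger0_norm // ltW // wt_gt0.
  by rewrite integralZl // muleC.
by rewrite -(fineK cfin) integralZl // -/c -(fineK cfin) -EFinM ltry.
Qed.
Local Close Scope ereal_scope.

(** The weight varies slowly, so translations and dilations cost only a constant and preserve [adm].
    The natural factor c^(3/2) is rounded up to c^2. *)
Lemma q_le s z c : 1 <= c -> 1 + `|s| <= c * (1 + `|z|) -> q z <= c ^+ 2 * q s.
Proof.
move=> c1 h.
have s1 : 0 < 1 + `|s| by have := normr_ge0 s; lra.
have z1 : 0 < 1 + `|z| by have := normr_ge0 z; lra.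
have c0 : 0 < c by lra.
rewrite /q ler_pdivlMr ?mulr_gt0 ?sqrtr_gt0 // mulrC ler_pdivrMr ?mulr_gt0 ?sqrtr_gt0 //.
have h2 : Num.sqrt (1 + `|s|) <= c * Num.sqrt (1 + `|z|).
  apply: (@le_trans _ _ (Num.sqrt (c ^+ 2 * (1 + `|z|)))); last first.
    by rewrite sqrtrM ?sqr_ge0 // sqrtr_sqr ger0_norm // ltW.
  by apply: ler_wsqrtr; rewrite (le_trans h) // ler_wpM2r ?(ltW z1) // expr2 ler_peMl // ltW.
rewrite expr2 mulrACA; apply: ler_pM => //.
Qed.

Lemma invsq_le_q z : (1 + z ^+ 2)^-1 <= 2 * q z.
Proof.
have z1 : 0 < 1 + `|z| by have := normr_ge0 z; lra.
have s1 : Num.sqrt (1 + `|z|) <= 1 + `|z|.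
  apply: (@le_trans _ _ (Num.sqrt ((1 + `|z|) ^+ 2))); last by rewrite sqrtr_sqr ger0_norm // ltW.
  by apply: ler_wsqrtr; have := normr_ge0 z; nra.
rewrite /q -[leLHS]mul1r ler_pdivrMr; last by rewrite -real_normK ?num_real //; nra.
rewrite mulrAC ler_pdivlMr ?mulr_gt0 ?sqrtr_gt0 // mul1r.
apply: (@le_trans _ _ ((1 + `|z|) * (1 + `|z|))); first by rewrite ler_pM2l.
rewrite -(@real_normK _ z) ?num_real //; have := sqr_ge0 (1 - `|z|); nra.
Qed.

Definition adm (f : R * R -> R) :=
  measurable_fun setT (f : mT * mT -> R) /\ exists K, forall x, `|f x| <= K * wt x.

Definition int2 (f : R * R -> R) : R := \int[leb2 R]_(x in setT) f x.

Lemma adm_int f : adm f -> (leb2 R).-integrable setT (EFin \o f).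
Proof.
move=> [mf [K fK]].
have mT2 : measurable [set: mT * mT] by exact: measurableT.
apply: (@le_integrable _ _ _ (leb2 R) _ mT2 (EFin \o f) (fun x => K%:E * (wt x)%:E)%E).
- exact/measurable_EFinP.
- by move=> x _ /=; rewrite lee_fin (le_trans (fK x)) // ler_norm.
- by apply: integrableZl => //; exact: integrable_wt.
Qed.

Lemma adm_le f g C : measurable_fun setT (f : mT * mT -> R) -> adm g ->
  (forall x, `|f x| <= C * `|g x|) -> adm f.
Proof.
move=> mf [mg [K gK]] fg; split=> //; exists (`|C| * K) => x.
rewrite (le_trans (fg x)) // -mulrA.
apply: (@le_trans _ _ (`|C| * `|g x|)).
  by rewrite ler_wpM2r // ler_norm.
by rewrite ler_wpM2l.
Qed.

Lemma admD f g : adm f -> adm g -> adm (fun x => f x + g x).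
Proof.
move=> [mf [K fK]] [mg [L gL]]; split; first exact: measurable_funD.
by exists (K + L) => x; rewrite mulrDl (le_trans (ler_normD _ _)) // lerD.
Qed.

Lemma admM f g C : measurable_fun setT (f : mT * mT -> R) -> (forall x, `|f x| <= C) ->
  adm g -> adm (fun x => f x * g x).
Proof.
move=> mf fC ag; apply: (@adm_le _ g C) => //.
  by apply: measurable_funM => //; case: ag.
by move=> x; rewrite normrM ler_wpM2r.
Qed.

Lemma admZ k f : adm f -> adm (fun x => k * f x).
Proof. by move=> af; apply: (@admM (fun=> k) f `|k|). Qed.

Lemma admN f : adm f -> adm (fun x => - f x).
Proof. by move=> /(admZ (- 1)); under eq_fun do rewrite mulN1r. Qed.

Lemma admB f g : adm f -> adm g -> adm (fun x => f x - g x).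
Proof. by move=> af /admN ag; exact: admD. Qed.

Lemma adm_norm f : adm f -> adm (fun x => `|f x|).
Proof.
move=> af; apply: (@adm_le _ f 1) => //; last by move=> x; rewrite normr_id mul1r.
by apply: measurableT_comp => //; case: af.
Qed.

Lemma int2D f g : adm f -> adm g -> int2 (fun x => f x + g x) = int2 f + int2 g.
Proof. by move=> af ag; rewrite /int2 RintegralD //; exact: adm_int. Qed.

Lemma int2B f g : adm f -> adm g -> int2 (fun x => f x - g x) = int2 f - int2 g.
Proof. by move=> af ag; rewrite /int2 RintegralB //; exact: adm_int. Qed.

Lemma int2Z k f : adm f -> int2 (fun x => k * f x) = k * int2 f.
Proof. by move=> af; rewrite /int2 RintegralZl //; exact: adm_int. Qed.

Lemma int2_le f g : adm f -> adm g -> (forall x, f x <= g x) -> int2 f <= int2 g.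
Proof. by move=> af ag fg; apply: le_Rintegral => //; exact: adm_int. Qed.

Lemma int2_norm f : adm f -> `|int2 f| <= int2 (fun x => `|f x|).
Proof. by move=> af; apply: le_normr_Rintegral => //; exact: adm_int. Qed.

Lemma int2_ge0 f : (forall x, 0 <= f x) -> 0 <= int2 f.
Proof. by move=> f0; apply: Rintegral_ge0. Qed.

Lemma eq_int2 f g : f =1 g -> int2 f = int2 g.
Proof. by move=> fg; congr int2; apply/funext. Qed.

Lemma adm_aff f a r : 0 < r -> adm f -> adm (f \o aff a r).
Proof.
move=> r0 [mf [K fK]]; split.
  by apply: measurableT_comp => //; exact: measurable_aff.
have ge1 (t : R) : 1 <= 1 + (1 + `|t|) / r.
  by rewrite lerDl divr_ge0 ?ltW //; have := normr_ge0 t; lra.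
pose c (t : R) := 1 + (1 + `|t|) / r.
have key (t s : R) : q (t + r * s) <= c t ^+ 2 * q s.
  apply: q_le; first exact: ge1.
  set z := t + r * s.
  have -> : s = (z - t) / r by rewrite /z; field; rewrite gt_eqF.
  rewrite normrM normfV (gtr0_norm r0) /c.
  have h : `|z - t| <= `|z| + `|t| by exact: ler_normB.
  have zz := normr_ge0 z; have tt := normr_ge0 t.
  rewrite mulrDl mul1r lerD ?lerDl // mulrAC ler_pM2r ?invr_gt0 //.
  by nra.
exists (`|K| * (c a.1 ^+ 2 * c a.2 ^+ 2)) => y /=.
rewrite (le_trans (fK _)) //.
apply: (@le_trans _ _ (`|K| * wt (aff a r y))).
  by rewrite ler_wpM2r ?ler_norm // ltW // wt_gt0.
rewrite -mulrA ler_wpM2l // /wt /aff /= mulrACA.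
by apply: ler_pM => //; exact/ltW/q_gt0.
Qed.

Lemma int2_aff f a r : 0 < r -> adm f -> r ^+ 2 * int2 (f \o aff a r) = int2 f.
Proof.
move=> r0 af.
have ge0 g : adm g -> (forall x, 0 <= g x) -> r ^+ 2 * int2 (g \o aff a r) = int2 g.
  move=> ag g0; rewrite /int2 /Rintegral -(@ge0_integral_aff a r (EFin \o g) setT) //.
  - have ig := adm_int (adm_aff a r0 ag).
    by rewrite fineM // (integrable_fin_num _ ig).
  - by apply/measurable_EFinP; case: ag.
have an := adm_norm af.
have ap : adm (fun x => f x + `|f x|) by exact: admD.
(* A signed function is a difference of two nonnegative admissible ones, to which the change of
   variables for nonnegative functions applies. *)
have E g : int2 g = int2 (fun x => (g x + `|g x|) - `|g x|).
  by apply: eq_int2 => x; rewrite addrK.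
rewrite E [RHS]E /= int2B; [|exact: (adm_aff _ r0 ap)|exact: (adm_aff _ r0 an)].
rewrite int2B // mulrBr; congr (_ - _); apply: ge0 => // x.
by have := ler_norm (- f x); rewrite normrN; lra.
Qed.

Lemma adm_sq f K : measurable_fun setT (f : mT * mT -> R) ->
  (forall x, `|f x| <= K / ((1 + x.1 ^+ 2) * (1 + x.2 ^+ 2))) -> adm f.
Proof.
move=> mf fK; split=> //; exists (`|K| * 4) => x; rewrite (le_trans (fK x)) //.
rewrite (le_trans (ler_norm _)) // normrM -mulrA ler_wpM2l // invfM.
rewrite ger0_norm; last by rewrite mulr_ge0 // invr_ge0 addr_ge0 // sqr_ge0.
rewrite /wt (_ : 4 = 2 * 2); last by lra.
rewrite mulrACA; by apply: ler_pM; rewrite ?invsq_le_q // invr_ge0 addr_ge0 // sqr_ge0.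
Qed.

Lemma continuous_bounded_on_compact (T : topologicalType) (f : T -> R) (K : set T) :
  compact K -> continuous f -> exists B, forall x, K x -> `|f x| <= B.
Proof.
move=> cK cf.
have /compact_bounded[B [_ hB]] : compact (f @` K).
  by apply: continuous_compact => //; exact: continuous_subspaceT.
exists (B + 1) => x Kx; apply: (hB (B + 1)); first by rewrite ltrDl.
by exists x.
Qed.

Lemma compact_box M : compact [set x : R * R | `|x| <= M].
Proof.
have -> : [set x : R * R | `|x| <= M] = `[- M, M]%classic `*` `[- M, M]%classic.
  apply/seteqP; split => -[x y] /=.
    by rewrite prod_normE ge_max /= !in_itv /= !ler_norml => /andP[].
  by rewrite prod_normE ge_max /= !in_itv /= !ler_norml => -[-> ->].
by apply: compact_setX; exact: segment_compact.
Qed.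

Lemma adm_compact f M : measurable_fun setT (f : mT * mT -> R) ->
  (exists B, forall x, `|f x| <= B) -> (forall x, M < `|x| -> f x = 0) -> adm f.
Proof.
move=> mf [B fB] f0; split=> //.
exists (`|B| / (q M * q M)) => x.
have [Mx|xM] := ltP M `|x|.
  rewrite f0 // normr0; apply: mulr_ge0; last exact/ltW/wt_gt0.
  by rewrite divr_ge0 // ltW // mulr_gt0 ?q_gt0.
rewrite (le_trans (fB _)) // (le_trans (ler_norm _)) //.
rewrite mulrAC ler_pdivlMr ?mulr_gt0 ?q_gt0 // ler_wpM2l //.
move: xM; rewrite prod_normE ge_max /= => /andP[x1 x2].
have qM (s : R) : `|s| <= M -> q M <= q s.
  move=> sM; have := @q_le s M 1 (lexx _); rewrite expr1n !mul1r; apply.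
  by rewrite lerD2l (le_trans sM) // ler_norm.
by apply: ler_pM; rewrite ?qM // ltW // q_gt0.
Qed.

Lemma adm_compactC f M : continuous f -> (forall x, M < `|x| -> f x = 0) -> adm f.
Proof.
move=> cf f0; apply: (@adm_compact _ M) => //; first exact: continuous_measurable2.
have [B hB] := continuous_bounded_on_compact (@compact_box M) cf.
exists `|B| => x; have [Mx|xM] := ltP M `|x|; first by rewrite f0 // normr0.
by rewrite (le_trans (hB _ xM)) // ler_norm.
Qed.

Lemma diff_int2 (f f' : R -> R * R -> R) (a d K : R) : 0 < d ->
  (forall t, `|t - a| < d -> adm (f t)) ->
  (forall t x, `|t - a| < d -> is_derive t 1 (f ^~ x) (f' t x)) ->
  (forall t x, `|t - a| < d -> `|f' t x| <= K * wt x) ->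
  is_derive a 1 (fun t => int2 (f t)) (int2 (f' a)).
Proof.
move=> d0 af df bf.
have Iin t : (`]a - d, a + d[%classic : set R) t -> `|t - a| < d.
  by rewrite /= in_itv /= ltr_distl.
have Ia : (`]a - d, a + d[%classic : set R) a by rewrite /= in_itv /=; lra.
have K0 : 0 <= K.
  have := bf a (0, 0); rewrite subrr normr0 => /(_ d0) h.
  by move: (le_trans (normr_ge0 _) h); rewrite pmulr_lge0 // wt_gt0.
have e1 t x : `|t - a| < d -> partial1of2 f t x = f' t x.
  by move=> h; rewrite partial1of2E; apply: derive_val; exact: df.
have iG : (leb2 R).-integrable setT (EFin \o (fun x : mT * mT => K * wt x)).
  under [X in integrable _ _ X]eq_fun do rewrite /= EFinM.
  by apply: integrableZl => //; exact: integrable_wt.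
have G0 (y : mT * mT) : 0 <= K * wt y by rewrite mulr_ge0 // ltW // wt_gt0.
have der (t : R) (x : mT * mT) : (`]a - d, a + d[%classic : set R) t -> setT x -> derivable (f ^~ x) t 1.
  by move=> /Iin h _; have [] := df t x h.
have ub (t : R) (x : mT * mT) : (`]a - d, a + d[%classic : set R) t -> setT x ->
   `|partial1of2 f t x| <= K * wt x.
  by move=> /Iin h _; rewrite e1 // bf.
have If (t : R) : (`]a - d, a + d[%classic : set R) t ->
    (leb2 R).-integrable setT (EFin \o (f t : mT * mT -> R)).
  by move=> /Iin h; apply: adm_int; exact: af.
apply: DeriveDef.
  exact: (@derivable_under_integral R _ (mT * mT)%type (leb2 R) f setT measurableT a _ _ Ia If der _ G0 iG ub).
rewrite -derive1E (@differentiation_under_integral R _ (mT * mT)%type (leb2 R) f setT measurableT a _ _ Ia If der _ G0 iG ub).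
by apply: eq_int2 => x; rewrite e1 // subrr normr0.
Qed.

End Integration.

(** * Derivatives *)

Section DirectionalDerivatives.
Variable R : realType.
Notation mT := (measurableTypeR R).

Section line.
Variable V : normedModType R.
Implicit Types (f g : V -> R) (x v : V).

Lemma growth_line f x v (t : R) :
  (fun h : R => h^-1 *: ((fun s : R => f (x + s *: v)) (h *: (1 : R) + t) - f (x + t *: v))) =
  (fun h : R => h^-1 *: (f (h *: v + (x + t *: v)) - f (x + t *: v))).
Proof.
apply/funext => h; congr (_ *: (f _ - _)).
by rewrite [h *: _]mulr1 scalerDl addrCA.
Qed.

(** A directional derivative is an ordinary derivative along a line. The one-variable chain rule and
    mean value theorem thus become available in any normed space, without total
    differentiability. *)
Lemma is_derive_line f x v (t d : R) :
  is_derive t (1 : R) (fun s : R => f (x + s *: v)) d <-> is_derive (x + t *: v) v f d.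
Proof.
split=> -[h1 h2]; apply: DeriveDef.
- by move: h1; rewrite /derivable growth_line.
- by move: h2; rewrite /derive growth_line.
- by move: h1; rewrite /derivable growth_line.
- by move: h2; rewrite /derive growth_line.
Qed.

Lemma is_derive_affine (U : normedModType R) (A : U -> V) (y v : U) w f d :
  (forall h : R, A (h *: v + y) = h *: w + A y) ->
  is_derive (A y) w f d -> is_derive y v (f \o A) d.
Proof.
move=> hA; have e : (fun h : R => h^-1 *: ((f \o A) (h *: v + y) - f (A y))) =
   (fun h : R => h^-1 *: (f (h *: w + A y) - f (A y))).
  by apply/funext => h; rewrite /= hA.
by move=> [h1 h2]; apply: DeriveDef; rewrite /derivable /derive /= e.
Qed.

Lemma is_derive_comp f x v (d c : R) (F : R -> R) :
  is_derive x v f d -> is_derive (f x) (1 : R) F c -> is_derive x v (F \o f) (c * d).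
Proof.
have E : x = x + 0 *: v by rewrite scale0r addr0.
rewrite {1 3}E => /is_derive_line hf hF; apply/is_derive_line.
apply: (@is_derive1_comp R F (fun s => f (x + s *: v)) 0) => //.
by rewrite scale0r addr0.
Qed.

Lemma is_derive_uniq f x v (d c : R) : is_derive x v f d -> is_derive x v f c -> d = c.
Proof. by move=> [_ <-] [_ <-]. Qed.

End line.

(** The integral of the translate of [F] by t v does not depend on t; its derivative at t = 0 is the
    integral of [F']. For |t| < 1 and |v| <= 1 each factor [q] changes by at most 2^2, whence the 16
    in the domination. *)
Lemma int2_derive0 (F F' : R * R -> R) (v : R * R) K : `|v| <= 1 -> adm F ->
  (forall x, is_derive x v F (F' x)) -> (forall x, `|F' x| <= K * wt x) -> int2 F' = 0.
Proof.
move=> v1 aF dF bF.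
have K0 : 0 <= K by have := le_trans (normr_ge0 _) (bF 0); rewrite pmulr_lge0 // wt_gt0.
have e (t : R) : (fun x => F (x + t *: v)) = F \o aff (t *: v) 1.
  by apply/funext => x /=; congr F; rewrite /aff !mul1r [x + _]addrC.
have v12 : `|v.1| <= 1 /\ `|v.2| <= 1 by move: v1; rewrite prod_normE ge_max => /andP.
have qb (s t u : R) : `|t| < 1 -> `|u| <= 1 -> q (s + t * u) <= 2 ^+ 2 * q s.
  move=> t1 u1; apply: q_le; first by lra.
  have : `|t * u| <= 1 by rewrite normrM mulr_ile1 // ltW.
  have := ler_normB (s + t * u) (t * u); rewrite addrK.
  have := normr_ge0 (s + t * u); lra.
have d0 : is_derive (0 : R) (1 : R) (fun t : R => int2 (fun x => F (x + t *: v))) (int2 (fun x => F' (x + 0 *: v))).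
  apply: (@diff_int2 _ (fun (t : R) x => F (x + t *: v)) (fun t x => F' (x + t *: v)) 0 1 (K * 16)) => //.
  - by move=> t _; rewrite e; exact: adm_aff.
  - by move=> t x _; apply/is_derive_line.
  - move=> t x; rewrite subr0 => t1; rewrite (le_trans (bF _)) // -mulrA ler_wpM2l //.
    rewrite /wt (_ : 16 = 2 ^+ 2 * 2 ^+ 2); last by lra.
    rewrite mulrACA; apply: ler_pM; rewrite ?(ltW (q_gt0 _)) //; apply: qb => //; lra.
have d1 : is_derive (0 : R) (1 : R) (fun t : R => int2 (fun x => F (x + t *: v))) 0.
  have -> : (fun t : R => int2 (fun x => F (x + t *: v))) = cst (int2 F).
    apply/funext => t; rewrite e /=.
    by have := @int2_aff _ F (t *: v) 1 ltr01 aF; rewrite expr1n mul1r.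
  exact: is_derive_cst.
have := is_derive_uniq d0 d1 => <-; apply: eq_int2 => x.
by rewrite scale0r addr0.
Qed.

End DirectionalDerivatives.

(** * Functions of class C^n and the symmetry of second derivatives *)

Section SmoothFunctions.
Variable R : realType.

Section Cn.
Variables (V : normedModType R).
Implicit Types (f g : V -> R) (x v w : V) (n : nat).

Lemma Cn_cont W n (f : V -> W : normedModType R) : Cn n f -> continuous f.
Proof. by case: n => [//|n []]. Qed.

Lemma CnW W n (f : V -> W : normedModType R) : Cn n.+1 f -> Cn n f.
Proof.
elim: n f => [|n IH] f; first by case.
by move=> [cf df]; split => // v; have [d c] := df v; split => //; exact: IH.
Qed.

Lemma Cn_is_derive n f x v : Cn n.+1 f -> is_derive x v f ('D_v f x).
Proof. by move=> [_ /(_ v)[/(_ x) d _]]; exact: DeriveDef. Qed.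

Lemma Cn_derive n f v : Cn n.+1 f -> Cn n ('D_v f).
Proof. by move=> [_ /(_ v)[]]. Qed.

Lemma Cn_intro n f (df : V -> V -> R) : continuous f ->
  (forall v, Cn n (df v)) -> (forall v x, is_derive x v f (df v x)) -> Cn n.+1 f.
Proof.
move=> cf hn hd; split=> // v; split=> [x|]; first by have [] := hd v x.
suff -> : 'D_v f = df v by [].
by apply/funext => x; apply: derive_val.
Qed.

Lemma Cn_cst n (k : R) : Cn n (fun _ : V => k).
Proof.
elim: n k => [|n IH] k; first by move=> x; exact: cvg_cst.
apply: (@Cn_intro n _ (fun _ _ => 0)) => [x|v]; [exact: cvg_cst|exact: IH].
Qed.

Lemma CnD n f g : Cn n f -> Cn n g -> Cn n (fun x => f x + g x).
Proof.
elim: n f g => [|n IH] f g cf cg; first by move=> x; apply: cvgD; [exact: cf|exact: cg].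
apply: (@Cn_intro n _ (fun v x => 'D_v f x + 'D_v g x)) => [x|v|v x].
- by apply: cvgD; [exact: (Cn_cont cf)|exact: (Cn_cont cg)].
- by apply: IH; exact: Cn_derive.
- exact: (is_deriveD (Cn_is_derive x v cf) (Cn_is_derive x v cg)).
Qed.

Lemma CnM n f g : Cn n f -> Cn n g -> Cn n (fun x => f x * g x).
Proof.
elim: n f g => [|n IH] f g cf cg; first by move=> x; apply: cvgM; [exact: cf|exact: cg].
apply: (@Cn_intro n _ (fun v x => f x * 'D_v g x + g x * 'D_v f x)) => [x|v|v x].
- by apply: cvgM; [exact: (Cn_cont cf)|exact: (Cn_cont cg)].
- by apply: CnD; apply: IH; [exact: CnW|exact: Cn_derive|exact: CnW|exact: Cn_derive].
- exact: (is_deriveM (Cn_is_derive x v cf) (Cn_is_derive x v cg)).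
Qed.

Lemma CnZ n k f : Cn n f -> Cn n (fun x => k * f x).
Proof. by apply: CnM; exact: Cn_cst. Qed.

Lemma CnN n f : Cn n f -> Cn n (fun x => - f x).
Proof. by move=> /(CnZ (-1)); under eq_fun do rewrite mulN1r. Qed.

Lemma CnB n f g : Cn n f -> Cn n g -> Cn n (fun x => f x - g x).
Proof. by move=> cf cg; apply: CnD => //; exact: CnN. Qed.

End Cn.

Lemma Cn_affine (U V : normedModType R) n (A : U -> V) (L : U -> V) (f : V -> R) :
  continuous A -> (forall (h : R) (v y : U), A (h *: v + y) = h *: L v + A y) ->
  Cn n f -> Cn n (f \o A).
Proof.
move=> cA hA; elim: n f => [|n IH] f cf.
  by move=> x; apply: continuous_comp; [exact: cA|exact: cf].
apply: (@Cn_intro _ n _ (fun v => 'D_(L v) f \o A)) => [x|v|v x].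
- by apply: continuous_comp; [exact: cA|exact: (Cn_cont cf)].
- by apply: IH; exact: Cn_derive.
- exact: (is_derive_affine (fun h => hA h v x) (Cn_is_derive (A x) (L v) cf)).
Qed.

Section Cn1.
Variables (V : normedModType R).
Implicit Types (f g : V -> R) (x v w : V) (n : nat).

Lemma is_derive_homog f x v (k d : R) : is_derive x v f d -> is_derive x (k *: v) f (k * d).
Proof.
have E w : x = x + 0 *: w by rewrite scale0r addr0.
rewrite {1}(E v) => /is_derive_line hf; rewrite (E (k *: v)); apply/is_derive_line.
have -> : (fun s : R => f (x + s *: (k *: v))) = (fun s : R => f (x + s *: v)) \o (fun s => k * s).
  by apply/funext => s /=; rewrite scalerA mulrC.
rewrite mulrC; apply: (@is_derive1_comp R).
  by rewrite mulr0.
have := is_deriveZ k (is_derive_id (0 : R) 1).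
by rewrite /GRing.scale /= mulr1.
Qed.

(** [Cn] only provides each directional derivative separately, so linearity in the direction has to
    be proved. The increment along v + w splits at x + h v; the second piece is a derivative along w
    at an intermediate point, and tends to its value at x by continuity. *)
Lemma is_derive_add f x v w : Cn 1 f ->
  is_derive x (v + w) f ('D_v f x + 'D_w f x).
Proof.
move=> cf.
suff H : (fun h : R => h^-1 *: (f (h *: (v + w) + x) - f x)) h @[h --> (0:R)^'] --> 'D_v f x + 'D_w f x.
  apply: DeriveDef; first by apply/cvg_ex; exists ('D_v f x + 'D_w f x).
  exact/cvg_lim.
have -> : (fun h : R => h^-1 *: (f (h *: (v + w) + x) - f x)) =
   (fun h : R => h^-1 *: (f (h *: v + x) - f x) + h^-1 *: (f (h *: (v + w) + x) - f (h *: v + x))).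
  by apply/funext => h; rewrite -[RHS]scalerDr; congr (_ *: _); ring.
apply: cvgD.
  have [d1 _] := Cn_is_derive x v cf.
  exact: d1.
apply/cvgrPdist_lt => e e0.
have cw : {for x, continuous ('D_w f)} by have := Cn_cont (Cn_derive w cf); exact.
have : \forall y \near x, `|'D_w f x - 'D_w f y| < e.
  by move/cvgrPdist_lt : cw; exact.
move=> /nbhs_ballP[r r0 hr].
near=> h.
have h0 : h != 0 by near: h; exact: nbhs_dnbhs_neq.
have [s s01 hs] : exists2 s, s \in `]0, 1[%R & f (h *: (v + w) + x) - f (h *: v + x) = h * 'D_w f (h *: v + x + s *: (h *: w)).
  have dg (s : R) : is_derive s (1:R) (fun s : R => f (h *: v + x + s *: (h *: w))) (h * 'D_w f (h *: v + x + s *: (h *: w))).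
    by apply/is_derive_line; apply: is_derive_homog; exact: (Cn_is_derive _ _ cf).
  have := @MVT R (fun s : R => f (h *: v + x + s *: (h *: w))) _ 0 1 ltr01 (fun s _ => dg s).
  case.
    by apply: derivable_within_continuous => s _; have [] := dg s.
  move=> s s01; rewrite scale1r scale0r addr0 subr0 mulr1 => hs; exists s => //.
  by rewrite -hs scalerDr; congr (f _ - _); rewrite addrAC.
rewrite hs /GRing.scale /= mulrA mulVf // mul1r.
apply: hr; rewrite -ball_normE /=.
rewrite [h *: v + x]addrC -addrA opprD addrA subrr sub0r normrN.
move: s01; rewrite in_itv /= => /andP[s0 s1].
rewrite (le_lt_trans (ler_normD _ _)) // !normrZ (gtr0_norm s0).
apply: (@le_lt_trans _ _ (`|h| * (`|v| + `|w|))).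
  by rewrite mulrDr lerD2l ler_piMl ?mulr_ge0 // ltW.
apply: (@le_lt_trans _ _ (`|h| * (`|v| + `|w| + 1))).
  by rewrite ler_wpM2l // lerDl.
rewrite -ltr_pdivlMr; last by have := normr_ge0 v; have := normr_ge0 w; lra.
near: h; apply: dnbhs0_lt; rewrite divr_gt0 //.
Unshelve. all: by end_near. Qed.

Lemma deriveDv f x v w : Cn 1 f -> 'D_(v + w) f x = 'D_v f x + 'D_w f x.
Proof. by move=> cf; apply: derive_val; exact: is_derive_add. Qed.

Lemma deriveZv f x v (k : R) : Cn 1 f -> 'D_(k *: v) f x = k * 'D_v f x.
Proof. by move=> cf; apply: derive_val; apply: is_derive_homog; exact: (Cn_is_derive _ _ cf). Qed.
End Cn1.

Section Schwarz.
Variables (V : normedModType R) (f : V -> R) (x v w : V).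
Hypothesis cf : Cn 2 f.

(* The second difference on the left is symmetric in a and b, and the right-hand
   side tends to 'D_b ('D_a f) x: this gives Schwarz's theorem. *)
Lemma mean_value_mixed (a b : V) (h : R) : 0 < h -> exists s t,
  [/\ 0 < s < h, 0 < t < h &
   f (x + h *: a + h *: b) - f (x + h *: a) - f (x + h *: b) + f x =
   h * h * 'D_b ('D_a f) (x + s *: a + t *: b)].
Proof.
move=> h0.
pose phi (s : R) := f (x + h *: b + s *: a) - f (x + s *: a).
have dphi (s : R) : is_derive s (1:R) phi ('D_a f (x + h *: b + s *: a) - 'D_a f (x + s *: a)).
  apply: is_deriveB; apply/is_derive_line; exact: (Cn_is_derive _ _ cf).
have [s] := @MVT R phi _ 0 h h0 (fun s _ => dphi s)
  (derivable_within_continuous (fun s _ => let: DeriveDef d _ := dphi s in d)).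
rewrite in_itv /= => sh hs.
have cf1 : Cn 1 ('D_a f) by exact: Cn_derive.
pose psi (t : R) := 'D_a f (x + s *: a + t *: b).
have dpsi (t : R) : is_derive t (1:R) psi ('D_b ('D_a f) (x + s *: a + t *: b)).
  exact: (proj2 (is_derive_line ('D_a f) (x + s *: a) b t _) (Cn_is_derive _ _ cf1)).
have [t] := @MVT R psi _ 0 h h0 (fun s _ => dpsi s)
  (derivable_within_continuous (fun s _ => let: DeriveDef d _ := dpsi s in d)).
rewrite in_itv /= => th ht.
exists s, t; split => //.
move: hs ht; rewrite /phi /psi !scale0r !addr0 !subr0.
rewrite ![x + h *: b + _]addrAC => hs ht.
have alg (A B C D E : R) : A - B - (C - D) = E * h * h -> A - B - C + D = h * h * E.
  have -> : A - B - C + D = A - B - (C - D) by ring.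
  by move=> ->; ring.
by apply: alg; rewrite hs ht.
Qed.

Let half (a b c e : R) : `|a - c| < e / 2 -> `|b - c| < e / 2 -> `|a - b| <= e.
Proof.
rewrite (distrC b) => h1 h2; rewrite -(subrKA c) (le_trans (ler_normD _ _)) //; lra.
Qed.

Let perm4 (a b c d a' b' : R) : a' - c - b + d = b' -> a = a' -> a - b - c + d = b'.
Proof. by move=> <- ->; ring. Qed.

Lemma Schwarz : 'D_v ('D_w f) x = 'D_w ('D_v f) x.
Proof.
apply/eqP; rewrite -subr_eq0 -normr_le0; apply/ler_addgt0Pl => e e0; rewrite addr0.
have near1 (a b : V) : \forall y \near x, `|'D_b ('D_a f) x - 'D_b ('D_a f) y| < e / 2.
  have c : {for x, continuous ('D_b ('D_a f))}.
    by have := Cn_cont (Cn_derive b (Cn_derive a cf)); exact.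
  by move/cvgrPdist_lt : c; apply; lra.
have : \forall y \near x, `|'D_v ('D_w f) x - 'D_v ('D_w f) y| < e / 2 /\
    `|'D_w ('D_v f) x - 'D_w ('D_v f) y| < e / 2.
  by apply: filterI; exact: near1.
move=> /nbhs_ballP[r r0 hr].
pose h := r / (`|v| + `|w| + 1).
have vw : 0 < `|v| + `|w| + 1 by have := normr_ge0 v; have := normr_ge0 w; lra.
have h0 : 0 < h by rewrite divr_gt0.
have small (a b : V) (s t : R) : `|a| + `|b| = `|v| + `|w| -> 0 < s < h -> 0 < t < h ->
    ball x r (x + s *: a + t *: b).
  move=> ab /andP[s0 sh] /andP[t0 th]; rewrite -ball_normE /= -addrA opprD addrA subrr sub0r normrN.
  rewrite (le_lt_trans (ler_normD _ _)) // !normrZ !gtr0_norm //.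
  apply: (@le_lt_trans _ _ (h * `|a| + h * `|b|)).
    by rewrite lerD // ler_wpM2r // ltW.
  by rewrite -mulrDr ab /h mulrAC ltr_pdivrMr // ltr_pM2l // ltrDl.
have [s1 [t1 [a1 b1 e1]]] := @mean_value_mixed w v h h0.
have [s2 [t2 [a2 b2 e2]]] := @mean_value_mixed v w h h0.
have E : 'D_v ('D_w f) (x + s1 *: w + t1 *: v) = 'D_w ('D_v f) (x + s2 *: v + t2 *: w).
  have hh : h * h != 0 by rewrite mulf_neq0 // gt_eqF.
  have e3 := perm4 e2 (congr1 f (addrAC x (h *: w) (h *: v))).
  by have /(mulfI hh) := etrans (esym e1) e3.
have [n1 _] := hr _ (small w v s1 t1 (addrC _ _) a1 b1).
have [_ n2] := hr _ (small v w s2 t2 erefl a2 b2).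
rewrite E in n1; exact: half n1 n2.
Qed.
End Schwarz.

End SmoothFunctions.

(** * A smooth bump function and its Fourier transform *)

Section Bump.
Variable R : realType.

Section pair.
Variable V : normedModType R.
Implicit Types (f : V -> R * R).

Lemma cvg_pair1 (T : Type) (F : set_system T) {FF : Filter F} (g : T -> R * R) (l : R * R) :
  g @ F --> l -> (fun t => (g t).1) @ F --> l.1.
Proof. by move=> gl; apply: cvg_comp gl _; exact: cvg_fst. Qed.

Lemma cvg_pair2 (T : Type) (F : set_system T) {FF : Filter F} (g : T -> R * R) (l : R * R) :
  g @ F --> l -> (fun t => (g t).2) @ F --> l.2.
Proof. by move=> gl; apply: cvg_comp gl _; exact: cvg_snd. Qed.

Lemma is_derive_pair1 f x v : derivable f x v -> is_derive x v (fun z => (f z).1) ('D_v f x).1.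
Proof.
move=> df; have h : (fun h : R => h^-1 *: ((f (h *: v + x)).1 - (f x).1)) @ 0^' --> ('D_v f x).1.
  exact: cvg_pair1 df.
by apply: DeriveDef; [apply/cvg_ex; exists ('D_v f x).1|exact/cvg_lim].
Qed.

Lemma is_derive_pair2 f x v : derivable f x v -> is_derive x v (fun z => (f z).2) ('D_v f x).2.
Proof.
move=> df; have h : (fun h : R => h^-1 *: ((f (h *: v + x)).2 - (f x).2)) @ 0^' --> ('D_v f x).2.
  exact: cvg_pair2 df.
by apply: DeriveDef; [apply/cvg_ex; exists ('D_v f x).2|exact/cvg_lim].
Qed.

Lemma Cn_pair1 n f : Cn n f -> Cn n (fun z => (f z).1).
Proof.
elim: n f => [|n IH] f cf; first by move=> x; exact: cvg_pair1 (cf x).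
apply: (@Cn_intro _ _ n _ (fun v z => ('D_v f z).1)) => [x|v|v x].
- by case: cf => c _; exact: cvg_pair1 (c x).
- by apply: IH; case: cf => _ /(_ v)[].
- by apply: is_derive_pair1; case: cf => _ /(_ v)[/(_ x)].
Qed.

Lemma Cn_pair2 n f : Cn n f -> Cn n (fun z => (f z).2).
Proof.
elim: n f => [|n IH] f cf; first by move=> x; exact: cvg_pair2 (cf x).
apply: (@Cn_intro _ _ n _ (fun v z => ('D_v f z).2)) => [x|v|v x].
- by case: cf => c _; exact: cvg_pair2 (c x).
- by apply: IH; case: cf => _ /(_ v)[].
- by apply: is_derive_pair2; case: cf => _ /(_ v)[/(_ x)].
Qed.
End pair.

Lemma Cn_fst n : Cn n (fun y : R * R => y.1).
Proof.
case: n => [|n]; first by move=> x; exact: cvg_pair1 cvg_id.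
apply: (@Cn_intro _ _ n _ (fun v _ => v.1)) => [x|v|v x].
- exact: cvg_pair1 cvg_id.
- exact: Cn_cst.
- by have := @is_derive_pair1 _ (fun y => y) x v (@derivable_id _ _ x v); rewrite derive_id.
Qed.

Lemma Cn_snd n : Cn n (fun y : R * R => y.2).
Proof.
case: n => [|n]; first by move=> x; exact: cvg_pair2 cvg_id.
apply: (@Cn_intro _ _ n _ (fun v _ => v.2)) => [x|v|v x].
- exact: cvg_pair2 cvg_id.
- exact: Cn_cst.
- by have := @is_derive_pair2 _ (fun y => y) x v (@derivable_id _ _ x v); rewrite derive_id.
Qed.

Lemma Cn_dot n : Cn n (fun y : R * R => dot y y).
Proof. by apply: CnD; apply: CnM; [exact: Cn_fst|exact: Cn_fst|exact: Cn_snd|exact: Cn_snd]. Qed.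

Lemma derive_fst (x v : R * R) : is_derive x v (fun y : R * R => y.1) v.1.
Proof. by have := @is_derive_pair1 _ (fun y => y) x v (@derivable_id _ _ x v); rewrite derive_id. Qed.

Lemma derive_snd (x v : R * R) : is_derive x v (fun y : R * R => y.2) v.2.
Proof. by have := @is_derive_pair2 _ (fun y => y) x v (@derivable_id _ _ x v); rewrite derive_id. Qed.

Lemma derive_dot (x v : R * R) : is_derive x v (fun y : R * R => dot y y) (2 * dot x v).
Proof.
have d1 := is_deriveM (derive_fst x v) (derive_fst x v).
have d2 := is_deriveM (derive_snd x v) (derive_snd x v).
apply: is_derive_eq (is_deriveD d1 d2) _.
by rewrite /GRing.scale /= /dot; ring.
Qed.

(* The family is closed under differentiation, bump n' = n bump n.+1 - bump n.+2,
   which makes the smoothness of eta an induction. *)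
Definition bump (n : nat) (s : R) : R :=
  if s < 1 then (1 - s)^-1 ^+ n * expR (- (1 - s)^-1) else 0.

Lemma bump_ge0 n s : 0 <= bump n s.
Proof.
rewrite /bump; case: ifPn => // s1; rewrite mulr_ge0 ?expR_ge0 // exprn_ge0 // invr_ge0; lra.
Qed.

(** The exponential series gives w^(n+2) <= (n+2)! exp(w) with w = 1 / (1 - s). Vanishing to second
    order at s = 1 is what makes the extension by 0 differentiable there. *)
Lemma bump_le n s : s <= 1 -> bump n s <= (n.+2)`!%:R * (1 - s) ^+ 2.
Proof.
move=> s1; rewrite /bump; case: ifPn => [s2|_]; last first.
  by rewrite mulr_ge0 // sqr_ge0.
have w0 : 0 < 1 - s by lra.
set w := (1 - s)^-1; have wp : 0 < w by rewrite invr_gt0.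
have -> : 1 - s = w^-1 by rewrite invrK.
have := @expR_ge1Dxn R w n.+1 (ltW wp).
move=> h; have {}h : w ^+ n.+2 <= (n.+2)`!%:R * expR w.
  by rewrite -ler_pdivrMl ?ltr0n ?fact_gt0 // mulrC (le_trans _ h) // lerDr.
rewrite expRN (exprVn w 2) ler_pdivrMr ?expR_gt0 // [leRHS]mulrAC ler_pdivlMr ?exprn_gt0 //.
by rewrite -exprD addn2.
Qed.

Lemma is_derive_quad (f : R -> R) (s C : R) : (forall t, `|f t - f s| <= C * (t - s) ^+ 2) ->
  is_derive s 1 f 0.
Proof.
move=> fC.
suff h : (fun h : R => h^-1 *: (f (h *: (1:R) + s) - f s)) @ 0^' --> (0 : R).
  by apply: DeriveDef; [apply/cvg_ex; exists 0|exact/cvg_lim].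
apply/cvgr0Pnorm_lt => e e0; near=> h.
have h0 : h != 0 by near: h; exact: nbhs_dnbhs_neq.
rewrite /GRing.scale /= mulr1 normrM normfV.
have := fC (h + s); rewrite addrK => h1.
rewrite ltr_pdivrMl ?normr_gt0 // (le_lt_trans h1) //.
rewrite -(@real_normK _ h) ?num_real // expr2 mulrCA ltr_pM2l ?normr_gt0 // mulrC.
apply: (@le_lt_trans _ _ (`|h| * (`|C| + 1))).
  by rewrite ler_wpM2l // (le_trans (ler_norm C)) // lerDl.
rewrite -ltr_pdivlMr; last by have := normr_ge0 C; lra.
near: h; apply: dnbhs0_lt; rewrite divr_gt0 //.
Unshelve. all: by end_near. Qed.

Lemma is_derive_bump (n : nat) (s : R) : is_derive s 1 (bump n) (n%:R * bump n.+1 s - bump n.+2 s).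
Proof.
have [s1|s1] := ltP s 1; last first.
  have z m : bump m s = 0 by rewrite /bump ltNge s1.
  rewrite !z mulr0 subr0; apply: (@is_derive_quad _ _ (n.+2)`!%:R) => t.
  rewrite z subr0 ger0_norm ?bump_ge0 //.
  have [t1|t1] := leP t 1.
    rewrite (le_trans (bump_le _ t1)) // ler_wpM2l // -(sqrrN (t - s)) opprB ler_sqr ?nnegrE; lra.
  by rewrite /bump ltNge (ltW t1) /= mulr_ge0 // sqr_ge0.
have w0 : 1 - s != 0 by rewrite gt_eqF //; lra.
have d1 : is_derive s 1 (fun s : R => 1 - s) (-1).
  have := is_deriveB (is_derive_cst (1:R) s 1) (is_derive_id s (1:R)).
  by rewrite sub0r.
have d2 := @is_derive_inv R R _ s 1 _ w0 d1.
have d3 := is_deriveX n d2.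
have d4 : is_derive s 1 (fun s : R => expR (- (1 - s)^-1)) (expR (- (1 - s)^-1) * - (- (1 - s) ^- 2 * -1)).
  exact: (is_derive_comp (is_deriveN d2) (is_derive_expR _)).
have fE : (fun y : R => (1 - y)^-1) ^+ n = (fun y : R => (1 - y)^-1 ^+ n).
  by apply/funext => y; rewrite fctE.
rewrite fE in d3; have d5 := is_deriveM d3 d4.
have ne : {near s, (fun s => (1 - s)^-1 ^+ n * expR (- (1 - s)^-1)) =1 bump n}.
  near=> t; rewrite /bump; suff -> : t < 1 by [].
  by near: t; exact: lt_nbhsl.
have {}d5 : is_derive s 1 (fun s => (1 - s)^-1 ^+ n * expR (- (1 - s)^-1)) (n%:R * bump n.+1 s - bump n.+2 s).
  apply: is_derive_eq d5 _; rewrite /bump s1 /GRing.scale /=.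
  set w := (1 - s)^-1; rewrite -exprVn -/w.
  case: n {fE d3 ne} => [|n]; first by rewrite expr0 !mul0r mulr0 addr0; ring.
  rewrite /= !exprS; ring.
exact: (near_eq_is_derive ne d5).
Unshelve. all: by end_near. Qed.

Lemma continuous_bump n : continuous (bump n).
Proof.
move=> s; apply: differentiable_continuous; apply/derivable1_diffP.
by have [] := is_derive_bump n s.
Qed.

Lemma Cn_bump (V : normedModType R) m n (g : V -> R) : Cn m g -> Cn m (bump n \o g).
Proof.
elim: m n g => [|m IH] n g cg.
  by move=> x; apply: continuous_comp; [exact: cg|exact: continuous_bump].
apply: (@Cn_intro _ _ m _ (fun v x => (n%:R * bump n.+1 (g x) - bump n.+2 (g x)) * 'D_v g x)) => [x|v|v x].
- by apply: continuous_comp; [exact: (Cn_cont cg)|exact: continuous_bump].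
- apply: CnM; last exact: Cn_derive.
  by apply: CnB; [apply: CnZ|]; apply: IH; exact: CnW.
- exact: (is_derive_comp (Cn_is_derive x v cg) (is_derive_bump n (g x))).
Qed.

(** The index is 2 because the derivative of [bump 0] is minus [bump 2]: the radial field y [eta] y
    is then a gradient, on which the decay of the pressure kernel relies. *)
Definition eta (y : R * R) : R := bump 2 (dot y y).
(* Normalised so that grad etaH y = eta y *: y. *)
Definition etaH (y : R * R) : R := - 2^-1 * bump 0 (dot y y).

Lemma Cn_eta n : Cn n eta.
Proof. exact: (@Cn_bump _ n 2 _ (Cn_dot n)). Qed.

Lemma Cn_etaH n : Cn n etaH.
Proof. by apply: CnZ; exact: (@Cn_bump _ n 0 _ (Cn_dot n)). Qed.

Lemma derive_etaH y v : 'D_v etaH y = dot y v * eta y.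
Proof.
apply: derive_val.
have d := is_deriveZ (- 2^-1) (is_derive_comp (derive_dot y v) (is_derive_bump 0 (dot y y))).
apply: is_derive_eq d _; rewrite /GRing.scale /= /eta.
by field.
Qed.

Lemma dot_ge0 (y : R * R) : 0 <= dot y y.
Proof. by rewrite addr_ge0 // -expr2 sqr_ge0. Qed.

Lemma norm_sqr_le_dot (y : R * R) : `|y| ^+ 2 <= dot y y.
Proof.
rewrite prod_normE /dot -!expr2 maxEle; case: ifP => _; rewrite real_normK ?num_real //.
  by rewrite lerDr sqr_ge0.
by rewrite lerDl sqr_ge0.
Qed.

Lemma dot_le_norm_sqr (y : R * R) : dot y y <= 2 * `|y| ^+ 2.
Proof.
rewrite /dot -!expr2 mulr2n mulrDl mul1r -(@real_normK _ y.1) ?num_real // -(@real_normK _ y.2) ?num_real //.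
by rewrite lerD // ler_sqr ?nnegrE // prod_normE le_max lexx ?orbT.
Qed.

Lemma bump_out n s : 1 <= s -> bump n s = 0.
Proof. by move=> s1; rewrite /bump ltNge s1. Qed.

Lemma eta_out y : 1 <= dot y y -> eta y = 0.
Proof. exact: bump_out. Qed.

Lemma etaH_out y : 1 <= dot y y -> etaH y = 0.
Proof. by move=> h; rewrite /etaH bump_out // mulr0. Qed.

Lemma dot_gt1 (y : R * R) : 1 < `|y| -> 1 <= dot y y.
Proof.
move=> h; rewrite (le_trans _ (norm_sqr_le_dot y)) // -[leLHS](expr1n _ 2) ler_sqr ?nnegrE //.
exact: ltW.
Qed.

Lemma eta_ge0 y : 0 <= eta y.
Proof. exact: bump_ge0. Qed.

Lemma adm_eta : adm eta.
Proof.
apply: (@adm_compactC _ _ 1); first exact: Cn_cont (Cn_eta 0).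
by move=> x /dot_gt1 /eta_out.
Qed.

Definition ceta : R := int2 eta.

Definition square (a : R * R) (l : R) : set (R * R) :=
  `[a.1, a.1 + l[%classic `*` `[a.2, a.2 + l[%classic.

Lemma measurable_square a l : measurable (square a l : set (measurableTypeR R * measurableTypeR R)).
Proof. by apply: measurableX; exact: measurable_itv. Qed.

Lemma leb2_square a l : 0 <= l -> leb2 R (square a l) = (l ^+ 2)%:E.
Proof.
move=> l0; rewrite leb2X; [|exact: measurable_itv|exact: measurable_itv].
rewrite !lebesgue_measure_itv /= !lte_fin !ltrDl -!EFinD.
case: ltP => [_|l1]; first by rewrite -EFinM; congr EFin; ring.
have -> : l = 0 by lra.
by rewrite mule0 expr2 mul0r.
Qed.

Lemma int2_indic_square a l : 0 <= l -> int2 (\1_(square a l)) = l ^+ 2.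
Proof.
move=> l0; rewrite /int2 /Rintegral.
rewrite integral_indic //; last exact: measurable_square.
by rewrite setIT leb2_square.
Qed.

Lemma adm_indic_square a l : adm (\1_(square a l)).
Proof.
apply: (@adm_compact _ _ (`|a| + `|l|)).
- by apply: measurable_indic; exact: measurable_square.
- exists 1 => x; rewrite indicE; case: (_ \in _); rewrite ?normr1 ?normr0 //.
- move=> x; rewrite indicE; case: (boolP (_ \in _)) => // /set_mem [/=].
  rewrite !in_itv /= => h1 h2; rewrite ltNge => /negP[].
  have [a1 a2] : `|a.1| <= `|a| /\ `|a.2| <= `|a|.
    by rewrite prod_normE !le_max !lexx orbT.
  have := ler_norm l; move: a1 a2; rewrite !ler_norml => /andP[? ?] /andP[? ?] ?.
  by rewrite prod_normE ge_max /= !ler_norml; apply/andP; split; apply/andP; split; lra.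
Qed.

Lemma ceta_gt0 : 0 < ceta.
Proof.
(* On this unit square dot y y <= 1/2, so 1 / (1 - dot y y) lies between 1 and 2 and [eta] is at
   least exp(-2). *)
set B := square (- 2^-1, - 2^-1) 1.
apply: (@lt_le_trans _ _ (int2 (fun y => expR (-2) * \1_B y))).
  rewrite int2Z; last exact: adm_indic_square.
  by rewrite int2_indic_square // expr1n mulr1 expR_gt0.
apply: int2_le => [||y].
- by apply: admZ; exact: adm_indic_square.
- exact: adm_eta.
rewrite indicE; case: (boolP (_ \in _)) => [/set_mem [/=]|_]; last by rewrite mulr0 eta_ge0.
rewrite !in_itv /= => h1 h2; rewrite mulr1 /eta /bump.
have y1 : y.1 * y.1 <= 4^-1 by nra.
have y2 : y.2 * y.2 <= 4^-1 by nra.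
have s1 : dot y y <= 2^-1 by rewrite /dot; lra.
have s0 := dot_ge0 y.
rewrite ifT; last by lra.
have w1 : 1 <= (1 - dot y y)^-1.
  by rewrite -[leLHS]invr1 lef_pV2 ?posrE; lra.
have w2 : (1 - dot y y)^-1 <= 2.
  by rewrite -[leRHS]invrK lef_pV2 ?posrE ?invr_gt0; lra.
apply: (@le_trans _ _ (expR (- (1 - dot y y)^-1))); first by rewrite ler_expR; lra.
by rewrite ler_peMl ?expR_ge0 // exprn_ege1.
Qed.

Lemma affE (a : R * R) r (y : R * R) : aff a r y = a + r *: y.
Proof. by case: a y => [? ?] [? ?]. Qed.

Lemma continuous_aff (a : R * R) r : continuous (aff a r).
Proof.
have -> : aff a r = (fun y => a + r *: y) by apply/funext => y; rewrite affE.
by move=> y; apply: cvgD; [exact: cvg_cst|apply: cvgZr; exact: cvg_id].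
Qed.

Lemma aff_affine (a : R * R) r (h : R) (v y : R * R) : aff a r (h *: v + y) = h *: (r *: v) + aff a r y.
Proof. by rewrite !affE scalerDr addrCA !scalerA mulrC. Qed.

Lemma Cn_aff n (a : R * R) r (f : R * R -> R) : Cn n f -> Cn n (f \o aff a r).
Proof. exact: (Cn_affine (@continuous_aff a r) (@aff_affine a r)). Qed.

Lemma derive_aff n (a : R * R) r (f : R * R -> R) y v : Cn n.+1 f ->
  is_derive y v (f \o aff a r) (r * 'D_v f (aff a r y)).
Proof.
move=> cf; have d := is_derive_homog r (Cn_is_derive (aff a r y) v cf).
by apply: is_derive_affine d => h; exact: aff_affine.
Qed.

Lemma norm_le_enorm (z : R * R) : `|z| <= enorm z.
Proof. by rewrite -[leLHS]ger0_norm // -sqrtr_sqr ler_wsqrtr // norm_sqr_le_dot. Qed.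

Lemma enorm_le_norm (z : R * R) : enorm z <= 2 * `|z|.
Proof.
apply: (@le_trans _ _ (Num.sqrt ((2 * `|z|) ^+ 2))); last by rewrite sqrtr_sqr ger0_norm.
by apply: ler_wsqrtr; rewrite (le_trans (dot_le_norm_sqr z)) // exprMn; have := sqr_ge0 `|z|; lra.
Qed.

Lemma enorm_ge0 (z : R * R) : 0 <= enorm z.
Proof. exact: sqrtr_ge0. Qed.

Lemma enorm_sqr (z : R * R) : enorm z ^+ 2 = dot z z.
Proof. by rewrite sqr_sqrtr // dot_ge0. Qed.

Lemma test_eta (x : R * R) (r : R) : 0 < r ->
  test_function (fun z => r ^- 2 * eta (aff (- (r^-1 *: x)) r^-1 z)).
Proof.
move=> r0; split.
  by move=> n; apply: CnZ; apply: (@Cn_aff n _ _ eta); exact: Cn_eta.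
exists (2 * (`|x| + r)) => z hz; rewrite eta_out ?mulr0 //; apply: dot_gt1.
have h : `|x| + r < `|z| by have := enorm_le_norm z; lra.
rewrite affE -scalerN -scalerDr normrZ gtr0_norm ?invr_gt0 // ltr_pdivlMl // mulr1 addrC.
by have := ler_normD (z - x) x; rewrite subrK; lra.
Qed.

End Bump.

(** * Sine and cosine transforms of test functions supported in the unit box *)

Section Transforms.
Variable R : realType.
Notation mT := (measurableTypeR R).
Implicit Types (phi : R * R -> R) (xi x y v : R * R).

(** The restriction |v| <= 1 of [int2_derive0] is removed by dividing v by |v| + 1, the derivative
    being homogeneous in the direction. *)
Lemma int2_derive_eq0 (F F' : R * R -> R) v : adm F -> adm F' ->
  (forall x, is_derive x v F (F' x)) -> int2 F' = 0.
Proof.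
move=> aF aF' dF; pose k := `|v| + 1.
have k0 : 0 < k by rewrite /k; have := normr_ge0 v; lra.
have k1 : k^-1 != 0 by rewrite invr_eq0 gt_eqF.
have akF := admZ k^-1 aF'; have [_ [K hK]] := akF.
have : int2 (fun x => k^-1 * F' x) = 0.
  apply: (@int2_derive0 R F _ (k^-1 *: v) K) => // [|x].
    by rewrite normrZ gtr0_norm ?invr_gt0 // ler_pdivrMl // mulr1 /k lerDl.
  exact: is_derive_homog.
by rewrite int2Z // => /eqP; rewrite mulf_eq0 (negbTE k1) => /eqP.
Qed.

Definition unit_test phi := smooth phi /\ forall y, 1 < `|y| -> phi y = 0.

Lemma dotC x y : dot x y = dot y x.
Proof. by rewrite /dot mulrC [X in _ + X]mulrC. Qed.

Lemma dotDl x y v : dot (x + y) v = dot x v + dot y v.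
Proof. by rewrite /dot /=; ring. Qed.

Lemma dotZl (k : R) x v : dot (k *: x) v = k * dot x v.
Proof. by rewrite /dot /= /GRing.scale /=; ring. Qed.

Lemma dot_norm x y : `|dot x y| <= 2 * (`|x| * `|y|).
Proof.
have [x1 x2] : `|x.1| <= `|x| /\ `|x.2| <= `|x| by rewrite prod_normE !le_max !lexx orbT.
have [y1 y2] : `|y.1| <= `|y| /\ `|y.2| <= `|y| by rewrite prod_normE !le_max !lexx orbT.
rewrite (le_trans (ler_normD _ _)) // mulr2n mulrDl mul1r !normrM.
by apply: lerD; apply: ler_pM.
Qed.

Lemma derive_dotl xi y v : is_derive y v (fun y => dot y xi) (dot v xi).
Proof.
have d1 := is_deriveM (derive_fst y v) (is_derive_cst xi.1 y v).
have d2 := is_deriveM (derive_snd y v) (is_derive_cst xi.2 y v).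
apply: is_derive_eq (is_deriveD d1 d2) _.
by rewrite /GRing.scale /= /dot; ring.
Qed.

Lemma Cn_dotl n xi : Cn n (fun y => dot y xi).
Proof.
by apply: CnD; apply: CnM; rewrite ?(Cn_fst, Cn_snd); try exact: Cn_cst; [exact: Cn_fst|exact: Cn_snd].
Qed.

Lemma continuous_dotl xi : continuous (fun y => dot y xi).
Proof. exact: (Cn_cont (Cn_dotl 0 xi)). Qed.

Lemma derive_cosdot xi y v :
  is_derive y v (fun y => cos (dot y xi)) (- sin (dot y xi) * dot v xi).
Proof. exact: (is_derive_comp (derive_dotl xi y v) (is_derive_cos _)). Qed.

Lemma derive_sindot xi y v :
  is_derive y v (fun y => sin (dot y xi)) (cos (dot y xi) * dot v xi).
Proof. exact: (is_derive_comp (derive_dotl xi y v) (is_derive_sin _)). Qed.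

Lemma measurable_cosdot xi : measurable_fun setT (fun y : mT * mT => cos (dot y xi)).
Proof.
apply: continuous_measurable2 => y; apply: continuous_comp; first exact: continuous_dotl.
exact: continuous_cos.
Qed.

Lemma measurable_sindot xi : measurable_fun setT (fun y : mT * mT => sin (dot y xi)).
Proof.
apply: continuous_measurable2 => y; apply: continuous_comp; first exact: continuous_dotl.
exact: continuous_sin.
Qed.

Lemma norm_cos (t : R) : `|cos t| <= 1.
Proof. by rewrite ler_norml cos_geN1 cos_le1. Qed.

Lemma norm_sin (t : R) : `|sin t| <= 1.
Proof. by rewrite ler_norml sin_geN1 sin_le1. Qed.

Lemma adm_cos phi xi : adm phi -> adm (fun y => cos (dot y xi) * phi y).
Proof. by apply: admM; [exact: measurable_cosdot|move=> y; exact: norm_cos]. Qed.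

Lemma adm_sin phi xi : adm phi -> adm (fun y => sin (dot y xi) * phi y).
Proof. by apply: admM; [exact: measurable_sindot|move=> y; exact: norm_sin]. Qed.

Lemma unit_test_adm phi : unit_test phi -> adm phi.
Proof. by move=> [sp zp]; apply: (@adm_compactC _ _ 1) => //; exact: (Cn_cont (sp 0)). Qed.

Lemma unit_test_derive phi v : unit_test phi -> unit_test ('D_v phi).
Proof.
move=> [sp zp]; split=> [n|y y1]; first exact: (Cn_derive v (sp n.+1)).
have ne : \near y, (cst 0 : _ -> R) y = phi y.
  have : nbhs y [set z : R * R | 1 < `|z|].
    apply: (@norm_continuous _ _ y [set s : R | 1 < s]); exact: lt_nbhsr.
  by apply: filterS => z /zp.
rewrite -(near_eq_derive v ne); exact: derive_cst.
Qed.

Lemma unit_testM phi (g : R * R -> R) : smooth g -> unit_test phi -> unit_test (fun y => g y * phi y).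
Proof.
move=> sg [sp zp]; split=> [n|y y1]; first exact: (CnM (sg n) (sp n)).
by rewrite zp // mulr0.
Qed.

Lemma unit_testB phi (g : R * R -> R) : unit_test g -> unit_test phi -> unit_test (fun y => g y - phi y).
Proof.
move=> [sg zg] [sp zp]; split=> [n|y y1]; first exact: (CnB (sg n) (sp n)).
by rewrite zp // zg // subr0.
Qed.

(** The Fourier transform is [cosT] - i [sinT]; the two parts are kept apart so that all integrals
    are real. *)
Definition cosT phi xi := int2 (fun y => cos (dot y xi) * phi y).
Definition sinT phi xi := int2 (fun y => sin (dot y xi) * phi y).

Lemma cosT_derive phi v xi : unit_test phi -> cosT ('D_v phi) xi = dot v xi * sinT phi xi.
Proof.
move=> tp; have [sp _] := tp.
have a1 := adm_cos xi (unit_test_adm (unit_test_derive v tp)).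
have a2 := adm_sin xi (unit_test_adm tp).
apply/eqP; rewrite -subr_eq0 -int2Z // -int2B //; last exact: admZ.
apply/eqP; apply: (@int2_derive_eq0 (fun y => cos (dot y xi) * phi y) _ v) => [||y].
- exact: adm_cos (unit_test_adm tp).
- by apply: admB => //; exact: admZ.
have d := is_deriveM (derive_cosdot xi y v) (Cn_is_derive y v (sp 1)).
by apply: is_derive_eq d _; rewrite /GRing.scale /=; ring.
Qed.

Lemma sinT_derive phi v xi : unit_test phi -> sinT ('D_v phi) xi = - (dot v xi * cosT phi xi).
Proof.
move=> tp; have [sp _] := tp.
have a1 := adm_sin xi (unit_test_adm (unit_test_derive v tp)).
have a2 := adm_cos xi (unit_test_adm tp).
apply/eqP; rewrite -subr_eq0 opprK -int2Z // -int2D //; last exact: admZ.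
apply/eqP; apply: (@int2_derive_eq0 (fun y => sin (dot y xi) * phi y) _ v) => [||y].
- exact: adm_sin (unit_test_adm tp).
- by apply: admD => //; exact: admZ.
have d := is_deriveM (derive_sindot xi y v) (Cn_is_derive y v (sp 1)).
by apply: is_derive_eq d _; rewrite /GRing.scale /=; ring.
Qed.

Let e1 : R * R := (1, 0).
Let e2 : R * R := (0, 1).

Lemma cosTB f g xi : adm f -> adm g -> cosT (fun y => f y - g y) xi = cosT f xi - cosT g xi.
Proof.
move=> af ag; rewrite /cosT -int2B; [|exact: adm_cos|exact: adm_cos].
by apply: eq_int2 => y; rewrite mulrBr.
Qed.

Lemma sinTB f g xi : adm f -> adm g -> sinT (fun y => f y - g y) xi = sinT f xi - sinT g xi.
Proof.
move=> af ag; rewrite /sinT -int2B; [|exact: adm_sin|exact: adm_sin].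
by apply: eq_int2 => y; rewrite mulrBr.
Qed.

(* The symbol of 1 - D_v^2 is 1 + (v . xi)^2, which turns smoothness of phi into
   decay of its transforms. *)
Definition one_minus_dd v phi y := phi y - 'D_v ('D_v phi) y.

Lemma unit_test_one_minus_dd v phi : unit_test phi -> unit_test (one_minus_dd v phi).
Proof. by move=> tp; apply: unit_testB => //; do 2 apply: unit_test_derive. Qed.

Lemma cosT_one_minus_dd v phi xi : unit_test phi -> cosT (one_minus_dd v phi) xi = (1 + dot v xi ^+ 2) * cosT phi xi.
Proof.
move=> tp; have tv := unit_test_derive v tp.
rewrite cosTB; [|exact: unit_test_adm|by apply: unit_test_adm; exact: unit_test_derive].
by rewrite cosT_derive // sinT_derive //; ring.
Qed.

Lemma sinT_one_minus_dd v phi xi : unit_test phi -> sinT (one_minus_dd v phi) xi = (1 + dot v xi ^+ 2) * sinT phi xi.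
Proof.
move=> tp; have tv := unit_test_derive v tp.
rewrite sinTB; [|exact: unit_test_adm|by apply: unit_test_adm; exact: unit_test_derive].
by rewrite sinT_derive // cosT_derive //; ring.
Qed.

Lemma cosT_le phi xi : adm phi -> `|cosT phi xi| <= int2 (fun y => `|phi y|).
Proof.
move=> ap; rewrite (le_trans (int2_norm (adm_cos xi ap))) //.
apply: int2_le; [by apply: adm_norm; exact: adm_cos|exact: adm_norm|move=> y].
by rewrite normrM ler_piMl // norm_cos.
Qed.

Lemma sinT_le phi xi : adm phi -> `|sinT phi xi| <= int2 (fun y => `|phi y|).
Proof.
move=> ap; rewrite (le_trans (int2_norm (adm_sin xi ap))) //.
apply: int2_le; [by apply: adm_norm; exact: adm_sin|exact: adm_norm|move=> y].
by rewrite normrM ler_piMl // norm_sin.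
Qed.

(** The operator 1 - D_v^2 is applied once per coordinate direction, which gives the product form of
    decay that [adm_sq] compares with [wt]. *)
Lemma transform_decay phi : unit_test phi -> exists K, forall xi,
  `|cosT phi xi| <= K / ((1 + xi.1 ^+ 2) * (1 + xi.2 ^+ 2)) /\
  `|sinT phi xi| <= K / ((1 + xi.1 ^+ 2) * (1 + xi.2 ^+ 2)).
Proof.
move=> tp; have t1 := unit_test_one_minus_dd e1 tp; have t2 := unit_test_one_minus_dd e2 t1.
exists (int2 (fun y => `|one_minus_dd e2 (one_minus_dd e1 phi) y|)) => xi.
have p1 : 0 < 1 + xi.1 ^+ 2 by have := sqr_ge0 xi.1; lra.
have p2 : 0 < 1 + xi.2 ^+ 2 by have := sqr_ge0 xi.2; lra.
have d1 : dot e1 xi = xi.1 by rewrite /dot /=; ring.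
have d2 : dot e2 xi = xi.2 by rewrite /dot /=; ring.
split; rewrite ler_pdivlMr ?mulr_gt0 //.
  rewrite (le_trans _ (cosT_le xi (unit_test_adm t2))) // cosT_one_minus_dd // cosT_one_minus_dd // d1 d2 !normrM.
  by rewrite (gtr0_norm p1) (gtr0_norm p2) [leRHS]mulrA [leRHS]mulrC [X in _ <= _ * X]mulrC.
rewrite (le_trans _ (sinT_le xi (unit_test_adm t2))) // sinT_one_minus_dd // sinT_one_minus_dd // d1 d2 !normrM.
by rewrite (gtr0_norm p1) (gtr0_norm p2) [leRHS]mulrA [leRHS]mulrC [X in _ <= _ * X]mulrC.
Qed.

Lemma lip_of_derive (f f' : R -> R) (a b : R) : (forall t : R, is_derive t 1 f (f' t)) ->
  (forall t, `|f' t| <= 1) -> `|f a - f b| <= `|a - b|.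
Proof.
move=> df f1; wlog ab : a b / a < b => [H|].
  have [ab|ba|->] := ltgtP a b; first exact: H.
    by rewrite distrC (distrC a); exact: H.
  by rewrite !subrr.
have [c _ h] := @MVT R f f' a b ab (fun t _ => df t)
  (derivable_within_continuous (fun s _ => let: DeriveDef d _ := df s in d)).
by rewrite distrC (distrC a) h normrM ler_piMl.
Qed.

Lemma cos_lip (a b : R) : `|cos a - cos b| <= `|a - b|.
Proof. by apply: (@lip_of_derive cos (fun t => - sin t) a b) => t; rewrite normrN norm_sin. Qed.

Lemma sin_lip (a b : R) : `|sin a - sin b| <= `|a - b|.
Proof. by apply: (@lip_of_derive sin cos a b) => t; exact: norm_cos. Qed.

Lemma lip_continuous (f : R * R -> R) K : (forall x y, `|f x - f y| <= K * `|x - y|) -> continuous f.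
Proof.
move=> fK x; apply/cvgrPdist_lt => e e0; near=> y.
rewrite (le_lt_trans (fK _ _)) // (@le_lt_trans _ _ ((`|K| + 1) * `|x - y|)) //.
  by rewrite ler_wpM2r // (le_trans (ler_norm K)) // lerDl.
rewrite mulrC -ltr_pdivlMr; last by have := normr_ge0 K; lra.
near: y; apply: cvgr_dist_lt => //; rewrite divr_gt0 //.
Unshelve. all: by end_near. Qed.

(** [c] stands for [cos] and [sin]: being 1-Lipschitz, they make the transform Lipschitz, with
    constant twice the first absolute moment of [phi]. *)
Lemma osc_int_continuous (c : R -> R) phi : (forall a b, `|c a - c b| <= `|a - b|) ->
  (forall xi, adm (fun y => c (dot y xi) * phi y)) -> adm (fun y => `|y| * phi y) ->
  continuous (fun xi => int2 (fun y => c (dot y xi) * phi y)).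
Proof.
move=> cl ac an; apply: (@lip_continuous _ (2 * int2 (fun y => `| `|y| * phi y|))) => x x'.
rewrite -int2B // (le_trans (int2_norm _)) //; first exact: admB.
rewrite mulrAC -int2Z; last exact: adm_norm.
apply: int2_le => [||y]; first by apply/adm_norm/admB.
  by apply/admZ/adm_norm.
rewrite -mulrBl !normrM normr_id mulrA ler_wpM2r // (le_trans (cl _ _)) //.
rewrite dotC (dotC y) -[X in _ - X]mul1r -mulN1r mulrA mulr1 -dotZl -dotDl scaleN1r.
by rewrite (le_trans (dot_norm _ _)) // mulrA.
Qed.

Lemma unit_test_adm_norm phi : unit_test phi -> adm (fun y => `|y| * phi y).
Proof.
move=> tp; have ap := unit_test_adm tp; apply: (@adm_le _ _ phi 1) => // [|y].
  apply: measurable_funM; last by case: ap.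
  exact: continuous_measurable2 (@norm_continuous _ _).
rewrite mul1r normrM normr_id; have [y1|y1] := leP `|y| 1; first by rewrite ler_piMl.
by case: tp => _ /(_ _ y1) ->; rewrite normr0 mulr0.
Qed.

Lemma cosT_continuous phi : unit_test phi -> continuous (cosT phi).
Proof.
move=> tp; apply: osc_int_continuous; [exact: cos_lip| |exact: unit_test_adm_norm].
by move=> xi; exact: adm_cos (unit_test_adm tp).
Qed.

Lemma sinT_continuous phi : unit_test phi -> continuous (sinT phi).
Proof.
move=> tp; apply: osc_int_continuous; [exact: sin_lip| |exact: unit_test_adm_norm].
by move=> xi; exact: adm_sin (unit_test_adm tp).
Qed.

Lemma cosT_adm phi : unit_test phi -> adm (cosT phi).
Proof.
move=> tp; have [K hK] := transform_decay tp; apply: (@adm_sq _ _ K) => [|xi].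
  exact: continuous_measurable2 (cosT_continuous tp).
by case: (hK xi).
Qed.

Lemma sinT_adm phi : unit_test phi -> adm (sinT phi).
Proof.
move=> tp; have [K hK] := transform_decay tp; apply: (@adm_sq _ _ K) => [|xi].
  exact: continuous_measurable2 (sinT_continuous tp).
by case: (hK xi).
Qed.

Lemma smooth_dotl v : smooth (fun y => dot y v).
Proof. by move=> n; exact: Cn_dotl. Qed.

Lemma derive_cosT phi xi v : unit_test phi ->
  is_derive xi v (cosT phi) (- sinT (fun y => dot y v * phi y) xi).
Proof.
move=> tp; have E : xi = xi + 0 *: v by rewrite scale0r addr0.
rewrite {1}E; apply/is_derive_line.
have tv := unit_testM (smooth_dotl v) tp; have [_ [K hK]] := unit_test_adm tv.
have h : is_derive (0:R) (1:R) (fun t : R => cosT phi (xi + t *: v))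
    (int2 (fun y => - (sin (dot y (xi + 0 *: v)) * (dot y v * phi y)))).
  apply: (@diff_int2 R (fun t y => cos (dot y (xi + t *: v)) * phi y)
    (fun t y => - (sin (dot y (xi + t *: v)) * (dot y v * phi y))) 0 1 K ltr01).
  - by move=> t _; apply: adm_cos (unit_test_adm tp).
  - move=> t y _.
    have d1 : is_derive t (1:R) (fun t : R => dot y (xi + t *: v)) (dot y v).
      under eq_fun do rewrite dotC.
      by apply/(is_derive_line (fun z => dot z y)); rewrite (dotC y); exact: derive_dotl.
    have d2 := @is_derive1_comp R cos _ _ _ _ (is_derive_cos _) d1.
    have d3 := is_deriveM d2 (is_derive_cst (phi y) t (1:R)).
    by apply: is_derive_eq d3 _; rewrite /GRing.scale /=; ring.
  - by move=> t y _; rewrite normrN normrM (le_trans _ (hK y)) // ler_piMl // norm_sin.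
apply: is_derive_eq h _; rewrite -[RHS]mulN1r -int2Z; last exact: adm_sin (unit_test_adm tv).
by apply: eq_int2 => y; rewrite -E mulN1r.
Qed.

Lemma derive_sinT phi xi v : unit_test phi ->
  is_derive xi v (sinT phi) (cosT (fun y => dot y v * phi y) xi).
Proof.
move=> tp; have E : xi = xi + 0 *: v by rewrite scale0r addr0.
rewrite {1}E; apply/is_derive_line.
have tv := unit_testM (smooth_dotl v) tp; have [_ [K hK]] := unit_test_adm tv.
have h : is_derive (0:R) (1:R) (fun t : R => sinT phi (xi + t *: v))
    (int2 (fun y => cos (dot y (xi + 0 *: v)) * (dot y v * phi y))).
  apply: (@diff_int2 R (fun t y => sin (dot y (xi + t *: v)) * phi y)
    (fun t y => cos (dot y (xi + t *: v)) * (dot y v * phi y)) 0 1 K ltr01).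
  - by move=> t _; apply: adm_sin (unit_test_adm tp).
  - move=> t y _.
    have d1 : is_derive t (1:R) (fun t : R => dot y (xi + t *: v)) (dot y v).
      under eq_fun do rewrite dotC.
      by apply/(is_derive_line (fun z => dot z y)); rewrite (dotC y); exact: derive_dotl.
    have d2 := @is_derive1_comp R sin _ _ _ _ (is_derive_sin _) d1.
    have d3 := is_deriveM d2 (is_derive_cst (phi y) t (1:R)).
    by apply: is_derive_eq d3 _; rewrite /GRing.scale /=; ring.
  - by move=> t y _; rewrite normrM (le_trans _ (hK y)) // ler_piMl // norm_cos.
by apply: is_derive_eq h _; apply: eq_int2 => y; rewrite -E.
Qed.

(** By Fourier inversion the double transforms are multiples of the odd and even parts of [phi].
    Inversion is avoided: only decay in x is needed, and it follows by exchanging multiplication by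
    dot v x for multiplication of [phi] by dot y v. *)
Definition sinTT phi x := int2 (fun xi => sin (dot xi x) * sinT phi xi).
Definition cosTT phi x := int2 (fun xi => cos (dot xi x) * cosT phi xi).

Lemma sinTT_mul phi x v : unit_test phi -> dot v x * sinTT phi x = cosTT (fun y => dot y v * phi y) x.
Proof.
move=> tp; have tv := unit_testM (smooth_dotl v) tp.
have a1 := adm_sin x (sinT_adm tp); have a2 := adm_cos x (cosT_adm tv).
apply/esym/eqP; rewrite -subr_eq0 -int2Z // -int2B //; last exact: admZ.
apply/eqP; apply: (@int2_derive_eq0 (fun xi => cos (dot xi x) * sinT phi xi) _ v) => [||xi].
- exact: adm_cos (sinT_adm tp).
- by apply: admB => //; exact: admZ.
have d := is_deriveM (derive_cosdot x xi v) (derive_sinT xi v tp).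
by apply: is_derive_eq d _; rewrite /GRing.scale /=; ring.
Qed.

Lemma cosTT_mul phi x v : unit_test phi -> dot v x * cosTT phi x = sinTT (fun y => dot y v * phi y) x.
Proof.
move=> tp; have tv := unit_testM (smooth_dotl v) tp.
have a1 := adm_cos x (cosT_adm tp); have a2 := adm_sin x (sinT_adm tv).
apply/esym/eqP; rewrite -subr_eq0 -oppr_eq0 opprB -int2Z // -int2B //; last exact: admZ.
apply/eqP; apply: (@int2_derive_eq0 (fun xi => sin (dot xi x) * cosT phi xi) _ v) => [||xi].
- exact: adm_sin (cosT_adm tp).
- by apply: admB => //; exact: admZ.
have d := is_deriveM (derive_sindot x xi v) (derive_cosT xi v tp).
by apply: is_derive_eq d _; rewrite /GRing.scale /=; ring.
Qed.

Lemma sinTT_le phi x : unit_test phi -> `|sinTT phi x| <= int2 (fun y => `|sinT phi y|).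
Proof.
move=> tp; have ap := sinT_adm tp; rewrite (le_trans (int2_norm (adm_sin x ap))) //.
apply: int2_le; [by apply: adm_norm; exact: adm_sin|exact: adm_norm|move=> y].
by rewrite normrM ler_piMl // norm_sin.
Qed.

(** Each multiplication by dot v x swaps [sinTT] and [cosTT], so four of them return to [sinTT].
    Order four is exactly what makes l^-4 |sinTT(x / l)| <= C |x|^-4 uniform in l, as the kernel
    estimate requires. *)
Lemma sinTT_decay phi : unit_test phi -> exists C, forall x, `|x| ^+ 4 * `|sinTT phi x| <= C.
Proof.
move=> tp.
have one v : exists C, forall x, `|dot v x| ^+ 4 * `|sinTT phi x| <= C.
  have t1 := unit_testM (smooth_dotl v) tp; have t2 := unit_testM (smooth_dotl v) t1.
  have t3 := unit_testM (smooth_dotl v) t2; have t4 := unit_testM (smooth_dotl v) t3.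
  exists (int2 (fun y => `|sinT (fun y => dot y v * (dot y v * (dot y v * (dot y v * phi y)))) y|)) => x.
  rewrite (le_trans _ (sinTT_le x t4)) // -cosTT_mul // -sinTT_mul // -cosTT_mul // -sinTT_mul //.
  by rewrite -normrX -normrM !exprS expr0 mulr1 !mulrA.
have [C1 h1] := one e1; have [C2 h2] := one e2.
exists (Num.max C1 C2) => x; move: (h1 x) (h2 x).
rewrite {1}/dot {1}/dot /= !mul1r !mul0r addr0 add0r => k1 k2.
rewrite prod_normE maxEle; case: ifP => _; rewrite le_max ?k1 ?k2 ?orbT //.
Qed.

End Transforms.

(** * The pressure *)

Section PressureKernel.
Variable R : realType.
Notation mT := (measurableTypeR R).
Implicit Types (phi : R * R -> R) (xi x y v : R * R) (k i j : 'I_2).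

(** [pressure_symbol] is -i times this real symbol, which is homogeneous of degree one; division by
    zero makes it 0 at the origin. *)
Definition symbol3 k i j xi : R := coor k xi * coor i xi * coor j xi / dot xi xi.

Lemma coorE k xi : coor k xi = dot (Defs.basis R k) xi.
Proof. by rewrite /coor /Defs.basis /dot; case: ifP => _ /=; ring. Qed.

Lemma coorZ k (l : R) xi : coor k (l *: xi) = l * coor k xi.
Proof. by rewrite /coor; case: ifP. Qed.

Lemma dotZr (l : R) x v : dot x (l *: v) = l * dot x v.
Proof. by rewrite dotC dotZl dotC. Qed.

Lemma dot_scale (l : R) x v : 0 < l -> dot (l *: x) (l^-1 *: v) = dot x v.
Proof. by move=> l0; rewrite dotZl dotZr mulrA mulfV ?mul1r ?gt_eqF. Qed.

Lemma coor_norm k xi : `|coor k xi| <= `|xi|.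
Proof. by rewrite /coor prod_normE le_max; case: ifP; rewrite lexx ?orbT. Qed.

Lemma coor_enorm k xi : `|coor k xi| <= enorm xi.
Proof. exact: le_trans (coor_norm k xi) (norm_le_enorm xi). Qed.

Lemma Cn_coor n k : Cn n (coor k : R * R -> R).
Proof.
have [h|h] := eqVneq k ord0.
  by have -> : coor k = (fun y : R * R => y.1); [rewrite /coor h eqxx|exact: Cn_fst].
have -> : coor k = (fun y : R * R => y.2); last exact: Cn_snd.
by apply/funext => y; rewrite /coor (negbTE h).
Qed.

Lemma measurable_coor k : measurable_fun setT (coor k : mT * mT -> R).
Proof. by apply: continuous_measurable2; exact: (Cn_cont (Cn_coor 0 k)). Qed.

Lemma symbol3_le k i j xi : `|symbol3 k i j xi| <= `|coor k xi|.
Proof.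
have d0 := dot_ge0 xi.
have [d|d] := eqVneq (dot xi xi) 0; first by rewrite /symbol3 d invr0 mulr0 normr0.
have dp : 0 < dot xi xi by rewrite lt_neqAle eq_sym d.
rewrite /symbol3 -!mulrA normrM ler_piMr // normrM normrM normfV (gtr0_norm dp) mulrA ler_pdivrMr // mul1r.
by rewrite -enorm_sqr expr2; apply: ler_pM => //; exact: coor_enorm.
Qed.

Lemma symbol3Z k i j (l : R) xi : symbol3 k i j (l *: xi) = l * symbol3 k i j xi.
Proof.
rewrite /symbol3 !coorZ dotZl dotZr.
have [->|l0] := eqVneq l 0; first by rewrite !mul0r.
have [->|d0] := eqVneq (dot xi xi) 0; first by rewrite !mulr0 invr0 !mulr0.
by field; rewrite l0 d0.
Qed.

Lemma measurable_symbol3 k i j : measurable_fun setT (symbol3 k i j : mT * mT -> R).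
Proof.
apply: measurable_funM.
  by do ! apply: measurable_funM; exact: measurable_coor.
(* The inverse is not continuous at the origin; as a power with exponent -1 it is still
   measurable. *)
have -> : (fun xi : mT * mT => (dot xi xi)^-1) = (@powR R ^~ (-1)) \o (fun xi => dot xi xi).
  by apply/funext => xi /=; rewrite powR_inv1 // dot_ge0.
apply: measurableT_comp; first exact: measurable_powR.
exact: continuous_measurable2 (Cn_cont (Cn_dot R 0)).
Qed.

Lemma unit_test_eta : unit_test (@eta R).
Proof. by split=> [n|y /dot_gt1 /eta_out //]; exact: Cn_eta. Qed.

Lemma unit_test_etaH : unit_test (@etaH R).
Proof. by split=> [n|y /dot_gt1 /etaH_out //]; exact: Cn_etaH. Qed.

(** Three derivatives produce the cubic numerator of the symbol as a factor of the transform, as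
    [sinT_etaH3] shows; this is the function left once the denominator has cancelled. *)
Definition etaH3 k i j : R * R -> R :=
  'D_(Defs.basis R k) ('D_(Defs.basis R i) ('D_(Defs.basis R j) (@etaH R))).

Lemma unit_test_etaH3 k i j : unit_test (etaH3 k i j).
Proof. by do 3 apply: unit_test_derive; exact: unit_test_etaH. Qed.

Lemma sinT_etaH3 k i j xi : sinT (etaH3 k i j) xi = coor k xi * coor i xi * coor j xi * cosT (@etaH R) xi.
Proof.
have t1 := unit_test_derive (Defs.basis R j) unit_test_etaH; have t2 := unit_test_derive (Defs.basis R i) t1.
rewrite /etaH3 sinT_derive // cosT_derive // sinT_derive; last exact: unit_test_etaH.
by rewrite -!coorE; ring.
Qed.

(** Differentiating in l brings down dot y xi, and dot y xi times [eta] y is the derivative of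
    [etaH] along xi. Its transform gives a second factor dot xi (l xi), whence l |xi|^2. *)
Lemma derive_cosT_eta xi (l : R) :
  is_derive l 1 (fun l : R => cosT (@eta R) (l *: xi)) (l * dot xi xi * cosT (@etaH R) (l *: xi)).
Proof.
have d := derive_cosT (l *: xi) xi unit_test_eta.
have d' : is_derive (0 + l *: xi) xi (cosT (@eta R)) (l * dot xi xi * cosT (@etaH R) (l *: xi)).
  rewrite add0r; apply: is_derive_eq d _.
  have -> : (fun y => dot y xi * eta y) = 'D_xi (@etaH R).
    by apply/funext => y; rewrite derive_etaH.
  by rewrite sinT_derive ?opprK ?dotZr //; exact: unit_test_etaH.
by move/is_derive_line : d'; under eq_fun do rewrite add0r.
Qed.

(* Up to normalisation, scaled_kernel l is the kernel of the pressure operator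
   applied to eta at scale l.  Since d/dl cosT eta (l xi) = l |xi|^2 cosT etaH (l xi), the singular
   denominator of the symbol cancels in its l-derivative, which is therefore a
   rescaled rapidly decreasing function; integrating from l = +oo, where scaled_kernel l
   vanishes like l^-3, gives |scaled_kernel 1 x| <= C |x|^-3. *)
Definition scaled_kernel k i j (l : R) x : R :=
  int2 (fun xi => sin (dot xi x) * (symbol3 k i j xi * cosT (@eta R) (l *: xi))).

Lemma measurable_cosTZ phi (l : R) : unit_test phi -> measurable_fun setT (fun xi : mT * mT => cosT phi (l *: xi)).
Proof.
move=> tp; have -> : (fun xi : mT * mT => cosT phi (l *: xi)) = cosT phi \o aff 0 l.
  by apply/funext => xi /=; rewrite affE add0r.
apply: continuous_measurable2 => xi; apply: continuous_comp; first exact: continuous_aff.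
exact: cosT_continuous.
Qed.

Lemma adm_scale (f : R * R -> R) (l : R) : 0 < l -> adm f -> adm (fun xi => f (l *: xi)).
Proof.
move=> l0 af; have := adm_aff 0 l0 af.
by congr adm; apply/funext => xi /=; rewrite affE add0r.
Qed.

Lemma int2_scale (f : R * R -> R) (l : R) : 0 < l -> adm f ->
  l ^+ 2 * int2 (fun xi => f (l *: xi)) = int2 f.
Proof.
move=> l0 af; rewrite -(int2_aff 0 l0 af); congr (_ * _).
by apply: eq_int2 => xi /=; rewrite affE add0r.
Qed.

(** The symbol is at most |xi_k|, and xi_k times the transform of [eta] is, up to l, the transform
    of a derivative of [eta], which is admissible. *)
Lemma adm_symbol_cosT k i j (l : R) : 0 < l -> adm (fun xi => symbol3 k i j xi * cosT (@eta R) (l *: xi)).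
Proof.
move=> l0; apply: (@adm_le _ _ (fun xi => sinT ('D_(Defs.basis R k) (@eta R)) (l *: xi)) l^-1).
- by apply: measurable_funM; [exact: measurable_symbol3|exact: measurable_cosTZ unit_test_eta].
- by apply: adm_scale => //; apply: sinT_adm; apply: unit_test_derive; exact: unit_test_eta.
move=> xi; rewrite sinT_derive; last exact: unit_test_eta.
rewrite -coorE normrN coorZ -mulrA [X in _ <= _ * X]normrM (gtr0_norm l0) mulrA mulVf ?gt_eqF // mul1r.
by rewrite [leLHS]normrM [leRHS]normrM ler_wpM2r // symbol3_le.
Qed.

Definition scaled_kernel_bound k i j : R := int2 (fun xi => `|symbol3 k i j xi * cosT (@eta R) (1 *: xi)|).

Lemma scaled_kernel_le k i j (l : R) x : 0 < l -> l ^+ 3 * `|scaled_kernel k i j l x| <= scaled_kernel_bound k i j.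
Proof.
move=> l0; have a1 := adm_symbol_cosT k i j l0; have a2 := adm_symbol_cosT k i j ltr01.
rewrite /scaled_kernel_bound -(int2_scale l0 (adm_norm a2)) exprSr -mulrA ler_wpM2l ?sqr_ge0 //.
rewrite -ler_pdivlMl // -int2Z; last exact: adm_scale (adm_norm a2).
rewrite (le_trans (int2_norm (adm_sin x a1))) //.
apply: int2_le => [||xi]; first by apply: adm_norm; exact: adm_sin.
  by apply: admZ; exact: (adm_scale l0 (adm_norm a2)).
rewrite normrM scale1r symbol3Z -mulrA [X in _ <= _ * X]normrM (gtr0_norm l0) mulrA mulVf ?gt_eqF // mul1r.
by rewrite ler_piMl // norm_sin.
Qed.

Lemma scaled_kernel_scale k i j (l : R) x : 0 < l -> l ^+ 3 * scaled_kernel k i j l x = scaled_kernel k i j 1 (l^-1 *: x).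
Proof.
move=> l0; have a2 := adm_symbol_cosT k i j ltr01.
rewrite /scaled_kernel -[RHS](@int2_scale (fun xi => sin (dot xi (l^-1 *: x)) *
  (symbol3 k i j xi * cosT (@eta R) (1 *: xi))) l l0 (adm_sin _ a2)) exprSr -mulrA; congr (_ * _).
rewrite -int2Z; last by apply: adm_sin; exact: adm_symbol_cosT.
by apply: eq_int2 => xi; rewrite dot_scale // scale1r symbol3Z; ring.
Qed.

(** The factor |xi|^2 of [derive_cosT_eta] cancels the denominator; writing the cubic numerator at l
    xi leaves l^-2, and the change of variables xi to l xi gives another l^-2. *)
Lemma derive_scaled_kernel k i j x (l : R) : 1 <= l ->
  is_derive l 1 (fun l => scaled_kernel k i j l x) (l ^- 4 * sinTT (etaH3 k i j) (l^-1 *: x)).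
Proof.
move=> l1; have l0 : 0 < l by lra.
have tT := unit_test_etaH3 k i j; have aT := sinT_adm tT.
have [_ [K hK]] := aT.
have K0 : 0 <= K by have := le_trans (normr_ge0 _) (hK 0); rewrite pmulr_lge0 // wt_gt0.
have h : is_derive l 1 (fun l => scaled_kernel k i j l x)
    (int2 (fun xi => sin (dot xi x) * (l ^- 2 * sinT (etaH3 k i j) (l *: xi)))).
  (* Within distance 1/2 of l one has t > 1/2, so that t^-2 <= 4 and each factor [q] of the weight
     at t xi is at most 2^2 times its value at xi. *)
  apply: (@diff_int2 R (fun (l : R) xi => sin (dot xi x) * (symbol3 k i j xi * cosT (@eta R) (l *: xi)))
    (fun l xi => sin (dot xi x) * (l ^- 2 * sinT (etaH3 k i j) (l *: xi))) l 2^-1 (4 * (K * 16))).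
  - by lra.
  - by move=> t; rewrite ltr_distl => ht; apply: adm_sin; apply: adm_symbol_cosT; lra.
  - move=> t xi; rewrite ltr_distl => ht; have t0 : 0 < t by lra.
    have d := is_deriveZ (sin (dot xi x)) (is_deriveZ (symbol3 k i j xi) (derive_cosT_eta xi t)).
    apply: is_derive_eq d _; rewrite /GRing.scale /=; congr (_ * _).
    rewrite sinT_etaH3 !coorZ /symbol3.
    have [d0|d0] := eqVneq (dot xi xi) 0.
      have z m : coor m xi = 0.
        apply/eqP; rewrite -normr_le0 (le_trans (coor_enorm m xi)) //.
        by rewrite /enorm d0 sqrtr0.
      by rewrite !z !(mulr0, mul0r).
    by field; rewrite d0 gt_eqF.
  - move=> t xi; rewrite ltr_distl => ht; have t0 : 2^-1 < t by lra.
    rewrite normrM -[leRHS]mul1r; apply: ler_pM => //; first exact: norm_sin.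
    rewrite normrM -mulrA; apply: ler_pM => //.
      rewrite ger0_norm ?invr_ge0 ?exprn_ge0 //; last by lra.
      rewrite -[leRHS]invrK lef_pV2 ?posrE ?exprn_gt0 ?invr_gt0 //; last by lra.
      by rewrite (_ : 4^-1 = 2^-1 ^+ 2) ?ler_sqr ?nnegrE; [lra|lra|lra|rewrite expr2; field].
    rewrite (le_trans (hK _)) // -mulrA ler_wpM2l //.
    have qs (s : R) : q (t * s) <= 2 ^+ 2 * q s.
      apply: q_le; first by lra.
      rewrite normrM gtr0_norm; last by lra.
      by have := normr_ge0 s; nra.
    rewrite /wt /= (_ : 16 * _ = (2 ^+ 2 * q xi.1) * (2 ^+ 2 * q xi.2)); last by ring.
    by apply: ler_pM; rewrite ?qs // ltW // q_gt0.
apply: is_derive_eq h _; rewrite /sinTT.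
rewrite -[X in _ = _ * X](@int2_scale (fun xi => sin (dot xi (l^-1 *: x)) * sinT (etaH3 k i j) xi) l l0 (adm_sin _ aT)).
rewrite mulrA (_ : l ^- 4 * l ^+ 2 = l ^- 2); last by field; rewrite gt_eqF.
rewrite -int2Z; last by apply: (adm_scale l0 (adm_sin _ aT)).
by apply: eq_int2 => xi; rewrite dot_scale // mulrCA.
Qed.

Let combine (r A B N C : R) : 1 <= r -> 0 <= C -> r ^+ 3 * `|B| <= N ->
  `|B - A| <= C / r ^+ 4 * (r - 1) -> r ^+ 3 * `|A| <= N + C.
Proof.
move=> r1 C0 hB hA; have r0 : 0 < r by lra.
have h : r ^+ 3 * `|B - A| <= C.
  rewrite (le_trans (ler_wpM2l _ hA)) ?exprn_ge0 ?(ltW r0) //.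
  have -> : r ^+ 3 * (C / r ^+ 4 * (r - 1)) = C * ((r - 1) / r) by field; rewrite gt_eqF.
  by rewrite ler_piMr // ler_pdivrMr // mul1r gerBl.
have {}hA : `|A| <= `|B| + `|B - A|.
  by have := ler_normB B (B - A); rewrite subKr.
rewrite (le_trans (ler_wpM2l _ hA)) ?exprn_ge0 ?(ltW r0) // mulrDr; exact: lerD.
Qed.

(** The integration in l may stop at l = |x|: there [scaled_kernel_le] already gives |x|^-3, and
    between 1 and |x| the derivative is at most C |x|^-4 over a length |x| - 1. *)
Lemma scaled_kernel_decay k i j : exists C, forall x, 1 <= `|x| -> `|x| ^+ 3 * `|scaled_kernel k i j 1 x| <= C.
Proof.
have [C hC] := sinTT_decay (unit_test_etaH3 k i j).
exists (scaled_kernel_bound k i j + C) => x x1.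
have x0 : 0 < `|x| by lra.
have hd (l : R) : 1 <= l -> `|l ^- 4 * sinTT (etaH3 k i j) (l^-1 *: x)| <= C / `|x| ^+ 4.
  move=> l1; have l0 : 0 < l by lra.
  rewrite ler_pdivlMr ?exprn_gt0 // (le_trans _ (hC (l^-1 *: x))) //.
  rewrite normrM normrZ exprMn !normfV !normrX (gtr0_norm l0) exprVn.
  by rewrite mulrAC.
have C0 : 0 <= C by have := hC 0; apply: le_trans; rewrite mulr_ge0 // exprn_ge0.
apply: (combine x1 C0 (scaled_kernel_le k i j x x0)).
have [xe|xe] := eqVneq `|x| 1; first by rewrite xe !subrr normr0 mulr0.
have x1' : 1 < `|x| by rewrite lt_neqAle eq_sym xe.
have dA (t : R) : t \in `]1, `|x|[ -> is_derive t (1:R) (fun l => scaled_kernel k i j l x) (t ^- 4 * sinTT (etaH3 k i j) (t^-1 *: x)).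
  by rewrite in_itv /= => /andP[t1 _]; apply: derive_scaled_kernel; exact: ltW.
have cA : {within `[1, `|x|], continuous (fun l => scaled_kernel k i j l x)}.
  apply: derivable_within_continuous => t; rewrite in_itv /= => /andP[t1 _].
  by have [] := derive_scaled_kernel k i j x t1.
have [c hc ->] := @MVT R (fun l => scaled_kernel k i j l x) _ 1 `|x| x1' dA cA.
rewrite normrM (ger0_norm (_ : 0 <= `|x| - 1)) ?subr_ge0 // ler_wpM2r ?subr_ge0 //.
by apply: hd; move: hc; rewrite in_itv /= => /andP[/ltW].
Qed.

Lemma continuous_scaled_kernel k i j : continuous (scaled_kernel k i j 1).
Proof.
have am := adm_symbol_cosT k i j ltr01.
have : continuous (fun x => int2 (fun y => sin (dot y x) * (symbol3 k i j y * cosT (@eta R) (1 *: y)))).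
  apply: osc_int_continuous; first exact: sin_lip.
    by move=> xi; exact: adm_sin.
  (* The first moment of the integrand is dominated by transforms of second derivatives of [eta],
     equal in size to |y_m| |y_k| |cosT eta|. *)
  pose D m := cosT ('D_(Defs.basis R m) ('D_(Defs.basis R k) (@eta R))).
  have tD m : unit_test ('D_(Defs.basis R m) ('D_(Defs.basis R k) (@eta R))).
    by do 2 apply: unit_test_derive; exact: unit_test_eta.
  apply: (@adm_le _ _ (fun y => `|D ord0 y| + `|D ord_max y|) 1) => [||y].
  - apply: measurable_funM; first exact: continuous_measurable2 (@norm_continuous _ _).
    by case: am.
  - by apply: admD; apply: adm_norm; exact: cosT_adm.
  have DE m : `|D m y| = `|coor m y| * (`|coor k y| * `|cosT (@eta R) y|).
    rewrite /D cosT_derive; last by apply: unit_test_derive; exact: unit_test_eta.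
    rewrite sinT_derive; last exact: unit_test_eta.
    by rewrite -!coorE normrM normrN normrM.
  have -> : cosT (@eta R) (1 *: y) = cosT (@eta R) y by congr cosT; exact: scale1r.
  move: (DE ord0) (DE ord_max); generalize (D ord0 y) (D ord_max y) => a0 a1 E0 E1.
  rewrite mul1r (ger0_norm (addr_ge0 (normr_ge0 a0) (normr_ge0 a1))) E0 E1 -mulrDl.
  have h1 : `|y| <= `|coor ord0 y| + `|coor ord_max y|.
    by rewrite prod_normE /coor /= ge_max lerDl lerDr !normr_ge0.
  rewrite [leLHS]normrM normr_id [`|_ * cosT _ _|]normrM; apply: ler_pM => //.
  by rewrite ler_wpM2r //; exact: symbol3_le.
by [].
Qed.

(** For |x| < 1 the kernel is bounded and [wt] is bounded below. For |x| >= 1 both coordinates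
    satisfy 1 + |s| <= 2 |x|, so [wt] x >= (2 |x|)^-3: this is the factor 8. *)
Lemma adm_scaled_kernel k i j : adm (scaled_kernel k i j 1).
Proof.
split.
  by apply: continuous_measurable2; exact: continuous_scaled_kernel.
have [C hC] := scaled_kernel_decay k i j.
have hN x := scaled_kernel_le k i j x ltr01.
exists (`|scaled_kernel_bound k i j| / (q 1 * q 1) + 8 * `|C|) => x.
have w0 := ltW (wt_gt0 x).
have [x1|x1] := leP 1 `|x|; last first.
  rewrite (le_trans _ (_ : `|scaled_kernel_bound k i j| / (q 1 * q 1) * wt x <= _)) //; last first.
    by rewrite ler_wpM2r // lerDl mulr_ge0.
  have := hN x; rewrite expr1n mul1r => h; rewrite (le_trans h) // (le_trans (ler_norm _)) //.
  rewrite -mulrA ler_peMr // mulrC ler_pdivlMr ?mulr_gt0 ?q_gt0 // mul1r.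
  have qs (s : R) : `|s| <= `|x| -> q 1 <= q s.
    move=> sx; have := @q_le R s 1 1 (lexx _); rewrite expr1n !mul1r; apply.
    by rewrite normr1 lerD2l (le_trans sx) // ltW.
  by apply: ler_pM; rewrite ?(ltW (q_gt0 _)) // qs // prod_normE le_max lexx ?orbT.
rewrite (le_trans _ (_ : 8 * `|C| * wt x <= _)) //; last first.
  by rewrite ler_wpM2r // lerDr divr_ge0 // ltW // mulr_gt0 ?q_gt0.
have x0 : 0 < `|x| by lra.
have h := hC x x1.
have h2 : `|scaled_kernel k i j 1 x| <= `|C| / `|x| ^+ 3.
  by rewrite ler_pdivlMr ?exprn_gt0 // mulrC (le_trans h) // ler_norm.
rewrite (le_trans h2) // [8 * _]mulrC -mulrA ler_wpM2l //.
have qs (s : R) : `|s| <= `|x| -> (2 * `|x| * Num.sqrt (2 * `|x|))^-1 <= q s.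
  move=> sx; rewrite /q lef_pV2 ?posrE ?mulr_gt0 ?sqrtr_gt0 ?mulr_gt0 //; try by have := normr_ge0 s; lra.
  have h1 : 1 + `|s| <= 2 * `|x| by lra.
  by apply: ler_pM => //; exact: ler_wsqrtr.
have q1 := qs x.1; have q2 := qs x.2.
set b := 2 * `|x| in q1 q2; have b0 : 0 < b by rewrite mulr_gt0.
apply: (@le_trans _ _ (8 * ((b * Num.sqrt b)^-1 * (b * Num.sqrt b)^-1))).
  have e : Num.sqrt b * Num.sqrt b = b by rewrite -expr2 sqr_sqrtr // ltW.
  rewrite -invfM mulrACA e /b le_eqVlt; apply/orP; left; apply/eqP; field; by rewrite gt_eqF.
rewrite ler_wpM2l //; apply: ler_pM; rewrite ?invr_ge0 ?mulr_ge0 ?sqrtr_ge0 ?(ltW b0) //.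
  by apply: q1; rewrite prod_normE le_max lexx.
by apply: q2; rewrite prod_normE le_max lexx orbT.
Qed.

End PressureKernel.

(** * The mollified pressure gradient *)

Section PressureBound.
Variable R : realType.
Notation mT := (measurableTypeR R).
Implicit Types (phi : R * R -> R) (xi x y v z : R * R) (k i j : 'I_2).

Definition flip (y : R * R) : R * R := (- y.1, - y.2).

Lemma measurable_flip : measurable_fun setT (flip : mT * mT -> mT * mT).
Proof.
apply: measurable_fun_pair.
  by apply: measurable_funN; exact: measurable_fst.
by apply: measurable_funN; exact: measurable_snd.
Qed.

Lemma leb2_flip (A : set (mT * mT)) : measurable A -> leb2 R (flip @^-1` A) = leb2 R A.
Proof.
move=> mA; have m1 : measurable_fun setT (-%R : mT -> mT) by apply: measurable_funN.
pose m0 : {measure set (mT * mT) -> \bar R} := pushforward (leb2 R) (flip : mT * mT -> mT * mT).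
suff : leb2 R A = m0 measurable_flip A by move->.
apply: product_measure_unique => // B C mB mC.
rewrite (_ : m0 _ _ = leb2 R (flip @^-1` (B `*` C))) //.
have -> : flip @^-1` (B `*` C) = ((-%R : mT -> mT) @^-1` B) `*` ((-%R : mT -> mT) @^-1` C).
  by [].
have mphi D : measurable D -> measurable ((-%R : mT -> mT) @^-1` D).
  by move=> mD; rewrite -[X in measurable X]setTI; exact: m1.
rewrite leb2X; [|exact: mphi|exact: mphi].
transitivity (lebesgue_measure B * lebesgue_measure C)%E; last by [].
by rewrite -(lebesgue_measureN mB) -(lebesgue_measureN mC).
Qed.

Lemma ge0_integral_flip (f : mT * mT -> \bar R) (D : set (mT * mT)) : measurable D ->
  measurable_fun D f -> (forall x, 0 <= f x)%E ->
  (\int[leb2 R]_(y in flip @^-1` D) f (flip y) = \int[leb2 R]_(x in D) f x)%E.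
Proof.
move=> mD mf f0.
pose m0 : {measure set (mT * mT) -> \bar R} := pushforward (leb2 R) (flip : mT * mT -> mT * mT).
have f0' : {in D, forall y, (0 <= f y)%E} by [].
apply: etrans (esym (@ge0_integral_pushforward _ _ _ _ _ _ measurable_flip (leb2 R) D f mD mf f0')) _.
apply: (@eq_measure_integral _ _ _ _ (leb2 R) (m0 measurable_flip)) => A mA AD.
exact: leb2_flip.
Qed.

Lemma int2_flip_ge0 (f : R * R -> R) : measurable_fun setT (f : mT * mT -> R) -> (forall x, 0 <= f x) ->
  int2 (f \o flip) = int2 f.
Proof.
move=> mf f0; rewrite /int2 /Rintegral -(@ge0_integral_flip (EFin \o f) setT) //.
exact/measurable_EFinP.
Qed.

Lemma int2_flip (f : R * R -> R) : adm f -> adm (f \o flip) -> int2 (f \o flip) = int2 f.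
Proof.
move=> af aN; have E g : int2 g = int2 (fun x => (g x + `|g x|) - `|g x|).
  by apply: eq_int2 => x; rewrite addrK.
have an := adm_norm af; have anN := adm_norm aN.
rewrite E [RHS]E int2B //; last exact: admD.
rewrite [RHS]int2B //; last exact: admD.
congr (_ - _).
  apply: (@int2_flip_ge0 (fun y => f y + `|f y|)) => [|y]; first by case: (admD af an).
  by have := ler_norm (- f y); rewrite normrN; lra.
by apply: (@int2_flip_ge0 (fun y => `|f y|)) => [|y //]; case: an.
Qed.

Lemma eta_even y : eta (flip y) = eta y.
Proof. by rewrite /eta; congr bump; rewrite /dot /=; ring. Qed.

(** The integrand is odd, because [eta] is even, and the integral is invariant under [flip]. The
    transform of the mollifier then reduces to a phase times [cosT]. *)
Lemma sinT_eta xi : sinT (@eta R) xi = 0.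
Proof.
have a := adm_sin xi (adm_eta R).
have e : (fun y => sin (dot y xi) * eta y) \o flip = (fun y => -1 * (sin (dot y xi) * eta y)).
  apply/funext => y /=; rewrite eta_even (_ : dot (flip y) xi = - dot y xi) ?sinN ?mulN1r ?mulNr //.
  by rewrite /dot /=; ring.
have h : sinT (@eta R) xi = - sinT (@eta R) xi.
  rewrite -[in RHS]mulN1r /sinT -int2Z // -e int2_flip // e; exact: admZ.
lra.
Qed.

(** The mollifier centred at x with scale r; the factor r^-2 keeps its integral equal to [ceta] at
    every scale. *)
Definition eta_at x (r : R) z : R := r ^- 2 * eta (aff (- (r^-1 *: x)) r^-1 z).

Lemma aff_inv x (r : R) y : 0 < r -> aff (- (r^-1 *: x)) r^-1 (aff x r y) = y.
Proof.
move=> r0; rewrite !affE scalerDr addrA addNr add0r scalerA mulVf ?gt_eqF //.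
by rewrite scale1r.
Qed.

Lemma adm_eta_at x (r : R) : 0 < r -> adm (eta_at x r).
Proof.
move=> r0; apply: admZ; apply: (@adm_aff _ (@eta R)); last exact: adm_eta.
by rewrite invr_gt0.
Qed.

Lemma int2_eta_at x (r : R) (g : R * R -> R) : 0 < r ->
  adm (fun z => g z * eta_at x r z) ->
  int2 (fun z => g z * eta_at x r z) = int2 (fun y => g (aff x r y) * eta y).
Proof.
move=> r0 a; rewrite -(int2_aff x r0 a) -int2Z; last exact: (adm_aff x r0 a).
apply: eq_int2 => y /=; rewrite /eta_at aff_inv // mulrCA; congr (_ * _).
by rewrite mulrA mulfV ?mul1r // expf_neq0 // gt_eqF.
Qed.

Lemma fourier_eta_at x (r : R) xi : 0 < r ->
  fourier (eta_at x r) xi = Complex (cos (dot x xi) * cosT (@eta R) (r *: xi)) (- (sin (dot x xi) * cosT (@eta R) (r *: xi))).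
Proof.
move=> r0; rewrite /fourier /cint /=.
have ac := adm_cos xi (adm_eta_at x r0); have as_ := adm_sin xi (adm_eta_at x r0).
have d1 y : dot (aff x r y) xi = dot x xi + dot y (r *: xi).
  by rewrite affE dotDl dotZl dotZr.
have aC := adm_cos (r *: xi) (adm_eta R); have aS := adm_sin (r *: xi) (adm_eta R).
congr Complex.
  rewrite -/(int2 _) (@eq_int2 _ _ (fun z => cos (dot z xi) * eta_at x r z)); last first.
    by move=> y; rewrite cosN mul0r subr0 mulrC.
  rewrite int2_eta_at // (@eq_int2 _ _ (fun y => cos (dot x xi) * (cos (dot y (r *: xi)) * eta y)
     - sin (dot x xi) * (sin (dot y (r *: xi)) * eta y))); last first.
    by move=> y; rewrite d1 cosD; ring.
  rewrite int2B; [|exact: admZ|exact: admZ].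
  by rewrite int2Z // int2Z // -/(sinT _ _) sinT_eta mulr0 subr0.
rewrite -/(int2 _) (@eq_int2 _ _ (fun z => - 1 * (sin (dot z xi) * eta_at x r z))); last first.
  by move=> y; rewrite sinN mul0r addr0; ring.
rewrite int2Z // mulN1r; congr (- _).
rewrite int2_eta_at // (@eq_int2 _ _ (fun y => sin (dot x xi) * (cos (dot y (r *: xi)) * eta y)
     + cos (dot x xi) * (sin (dot y (r *: xi)) * eta y))); last first.
  by move=> y; rewrite d1 sinD; ring.
rewrite int2D; [|exact: admZ|exact: admZ].
by rewrite int2Z // int2Z // -/(sinT _ _) sinT_eta mulr0 addr0.
Qed.

(** The left-hand side of [recovered_pressure] is real, so real parts are enough. They identify the
    operator applied to the mollifier at x with a translate of [scaled_kernel]. *)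
Lemma Re_fmult k i j x (r : R) z : 0 < r ->
  complex.Re (fmult (fun xi => pressure_symbol k i j (- xi)) (eta_at x r) z) =
  - ((2 * pi) ^- 2 * scaled_kernel k i j r (z - x)).
Proof.
move=> r0; rewrite /fmult /cint.
rewrite (_ : complex.Re _ = (2 * pi) ^- 2 * int2 (fun xi =>
  -1 * (sin (dot xi (z - x)) * (symbol3 k i j xi * cosT (@eta R) (r *: xi))))).
  rewrite int2Z; last by apply: adm_sin; exact: adm_symbol_cosT.
  by rewrite mulN1r mulrN.
rewrite /= mul0r subr0; congr (_ * _); rewrite -/(int2 _); apply: eq_int2 => xi.
have e1 := congr1 (@complex.Re R) (fourier_eta_at x xi r0).
have e2 := congr1 (@complex.Im R) (fourier_eta_at x xi r0).
rewrite /= in e1 e2; rewrite e1 e2 {e1 e2}.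
have cN m : coor m (- xi) = - coor m xi by rewrite /coor; case: ifP.
have dN : dot (- xi) (- xi) = dot xi xi by rewrite /dot /=; ring.
have dzx : dot xi (z - x) = dot z xi - dot x xi by rewrite /dot /=; ring.
rewrite !cN dN dzx sinB /symbol3.
set a := coor k xi; set b := coor i xi; set c := coor j xi; set d := (dot xi xi)^-1.
set E := cosT _ _; ring.
Qed.

Lemma Re_sum2_le (F : 'I_2 -> 'I_2 -> R[i]) (G : 'I_2 -> 'I_2 -> R) :
  (forall i j, `|complex.Re (F i j)| <= G i j) ->
  `|complex.Re (\sum_(i < 2) \sum_(j < 2) F i j)| <= \sum_(i < 2) \sum_(j < 2) G i j.
Proof.
move=> FG; have ReD : {morph @complex.Re R : a b / a + b} by move=> [? ?] [].
rewrite (big_morph _ ReD (erefl : complex.Re (0 : R[i]) = 0)) (le_trans (ler_norm_sum _ _ _)) //.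
apply: ler_sum => i _.
by rewrite (big_morph _ ReD (erefl : complex.Re (0 : R[i]) = 0)) (le_trans (ler_norm_sum _ _ _)) // ler_sum.
Qed.

(* The multiplier has order one and is tested at scale r, hence the gain r^-1. *)
Lemma pressure_bound : exists Cp : R, 0 <= Cp /\ forall (u : R * R -> R * R) (P : R * R -> R) (U r : R) k x,
  0 < r -> recovered_pressure u P -> continuous u -> (forall z, enorm (u z) <= U) ->
  `|int2 (fun z => pd k P z * eta_at x r z)| <= Cp * (U ^+ 2 / r).
Proof.
pose B k i j := int2 (fun y => `|scaled_kernel k i j 1 y|).
have B0 k i j : 0 <= B k i j by apply: int2_ge0.
pose S k := \sum_(i < 2) \sum_(j < 2) B k i j.
have S0 k : 0 <= S k by apply: sumr_ge0 => i _; apply: sumr_ge0.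
exists ((2 * pi) ^- 2 * (S ord0 + S ord_max)); split.
  by rewrite mulr_ge0 ?addr_ge0 // invr_ge0 exprn_ge0 // mulr_ge0 // pi_ge0.
move=> u P U r k x r0 rP cu uU.
have U0 : 0 <= U by exact: le_trans (enorm_ge0 _) (uU 0).
have := rP k (eta_at x r) (test_eta x r0).
move/(congr1 (@complex.Re R)) => /=; rewrite -/(int2 _) => ->.
have mu1 i : measurable_fun setT (fun z : mT * mT => coor i (u z)).
  apply: continuous_measurable2 => z; apply: continuous_comp; first exact: cu.
  exact: (Cn_cont (Cn_coor R 0 i)).
have pb i j : `|complex.Re (fmult_pairing (pressure_symbol k i j)
   (fun z => coor i (u z) * coor j (u z)) (eta_at x r))| <= (2 * pi) ^- 2 * B k i j * (U ^+ 2 / r).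
  have aff_sub z : aff (- (r^-1 *: x)) r^-1 z = r^-1 *: (z - x).
    by rewrite affE addrC scalerBr.
  have aA : adm (fun z => scaled_kernel k i j r (z - x)).
    have e z : scaled_kernel k i j r (z - x) = r ^- 3 * scaled_kernel k i j 1 (aff (- (r^-1 *: x)) r^-1 z).
      rewrite aff_sub -scaled_kernel_scale // mulrA mulVf ?mul1r // expf_neq0 // gt_eqF //.
    rewrite (funext e); apply: admZ; apply: (@adm_aff _ (scaled_kernel k i j 1)); last exact: adm_scaled_kernel.
    by rewrite invr_gt0.
  (* By scaling, the kernel has amplitude r^-3 and spreads over an area r^2: its L^1 norm gains the
     factor r^-1. *)
  have IA : int2 (fun z => `|scaled_kernel k i j r (z - x)|) = B k i j / r.
    have e z : `|scaled_kernel k i j r (z - x)| = r ^- 3 * `|scaled_kernel k i j 1 (aff (- (r^-1 *: x)) r^-1 z)|.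
      rewrite aff_sub -scaled_kernel_scale // normrM gtr0_norm ?exprn_gt0 // mulrA mulVf ?mul1r //.
      by rewrite expf_neq0 // gt_eqF.
    have r1 : 0 < r^-1 by rewrite invr_gt0.
    have a1 := adm_norm (adm_scaled_kernel R k i j).
    rewrite (eq_int2 e) int2Z; last exact: (adm_aff _ r1 a1).
    have h := int2_aff (- (r^-1 *: x)) r1 a1.
    rewrite /B -h exprVn; set I0 := int2 _.
    by field; rewrite gt_eqF.
  have ReM (a : R) (w : R[i]) : complex.Re (Complex a 0 * w) = a * complex.Re w.
    by case: w => b c /=; ring.
  have -> : complex.Re (fmult_pairing (pressure_symbol k i j)
      (fun z => coor i (u z) * coor j (u z)) (eta_at x r)) =
    int2 (fun z => (coor i (u z) * coor j (u z)) * (- ((2 * pi) ^- 2 * scaled_kernel k i j r (z - x)))).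
    transitivity (int2 (fun z => complex.Re (Complex (coor i (u z) * coor j (u z)) 0 *
      fmult (fun xi => pressure_symbol k i j (- xi)) (eta_at x r) z))); first by [].
    by apply: eq_int2 => z; rewrite ReM Re_fmult.
  have ub z : `|coor i (u z) * coor j (u z)| <= U ^+ 2.
    rewrite normrM expr2; apply: ler_pM => //; exact: le_trans (coor_enorm _ _) (uU z).
  have aB : adm (fun z => (coor i (u z) * coor j (u z)) * (- ((2 * pi) ^- 2 * scaled_kernel k i j r (z - x)))).
    apply: (@admM _ _ _ (U ^+ 2)); [exact: measurable_funM|exact: ub|].
    by apply: admN; apply: admZ.
  rewrite (le_trans (int2_norm aB)) //.
  have -> : (2 * pi) ^- 2 * B k i j * (U ^+ 2 / r) = U ^+ 2 * (2 * pi) ^- 2 * (B k i j / r) by ring.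
  rewrite -IA -int2Z; last exact: adm_norm.
  apply: int2_le => [||z]; [exact: adm_norm|by apply: admZ; exact: adm_norm|].
  have p0 : 0 <= (2 * pi : R) ^- 2 by rewrite invr_ge0 exprn_ge0 // mulr_ge0 // pi_ge0.
  by rewrite normrM normrN [`|_ ^- 2 * _|]normrM mulrA ler_wpM2r // (ger0_norm p0) ler_wpM2r.
have Sk : S k <= S ord0 + S ord_max.
  case: k {rP pb mu1} => [[|[|//]] hk].
    by rewrite (_ : Ordinal hk = ord0) ?lerDl //; exact: val_inj.
  by rewrite (_ : Ordinal hk = ord_max) ?lerDr //; exact: val_inj.
apply: (@le_trans _ _ ((2 * pi) ^- 2 * S k * (U ^+ 2 / r))); last first.
  apply: ler_wpM2r; first by rewrite divr_ge0 ?sqr_ge0 // ltW.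
  by rewrite ler_wpM2l // invr_ge0 exprn_ge0 // mulr_ge0 // pi_ge0.
rewrite (le_trans (Re_sum2_le pb)) // /S mulr_sumr mulr_suml le_eqVlt; apply/orP; left; apply/eqP.
by apply: eq_bigr => i _; rewrite mulr_sumr mulr_suml.
Qed.

End PressureBound.

(** * Transport of the vorticity *)

Section SpaceTime.
Variable R : realType.
Notation mT := (measurableTypeR R).
Implicit Types (x y v : R * R) (i j k : 'I_2).

Lemma le_of_derive_le0 (g g' : R -> R) (a b : R) : a <= b ->
  (forall s, a <= s <= b -> {for s, continuous g}) ->
  (forall s, a < s < b -> is_derive s (1:R) g (g' s)) ->
  (forall s, a < s < b -> g' s <= 0) -> g b <= g a.
Proof.
rewrite le_eqVlt => /orP[/eqP -> //|ab] cg dg g0.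
have cg' : {within `[a, b], continuous g}.
  by apply: continuous_in_subspaceT => s /set_mem /=; rewrite in_itv /=; exact: cg.
have dg' (s : R) : s \in `]a, b[ -> is_derive s (1:R) g (g' s).
  by rewrite in_itv /=; exact: dg.
have [c hc h] := MVT ab dg' cg'.
move: hc; rewrite in_itv /= => /g0 h0.
by rewrite -subr_le0 h mulr_le0_ge0 // subr_ge0 ltW.
Qed.

Lemma continuous_pair (T U V : topologicalType) (f : T -> U) (g : T -> V) (x : T) :
  {for x, continuous f} -> {for x, continuous g} -> {for x, continuous (fun z => (f z, g z))}.
Proof.
move=> cf cg A [[B C] /= [hB hC] sub].
have h1 : nbhs x (f @^-1` B) := cf _ hB; have h2 : nbhs x (g @^-1` C) := cg _ hC.
have h : nbhs x (f @^-1` B `&` g @^-1` C) by exact: filterI.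
suff : nbhs x ((fun z => (f z, g z)) @^-1` A) by [].
by apply: filterS h => z [zB zC]; exact: (sub (f z, g z)).
Qed.

Lemma continuous_slice (W : topologicalType) (f : R * (R * R) -> W) (s : R) : continuous f -> continuous (fun x => f (s, x)).
Proof.
move=> cf x; apply: (@continuous_comp _ _ _ (fun x : R * R => (s, x)) f); last exact: cf.
by apply: continuous_pair; [exact: cvg_cst|exact: cvg_id].
Qed.

Definition dt : R * (R * R) := (1, 0).
Definition dx v : R * (R * R) := (0, v).

Lemma derive_slice (f : R * (R * R) -> R) (s : R) x v d :
  is_derive (s, x) (dx v) f d -> is_derive x v (fun x => f (s, x)) d.
Proof.
apply: (@is_derive_affine R _ _ (fun x : R * R => (s, x))) => h.
by rewrite /dx; congr pair; rewrite /= scaler0 add0r.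
Qed.

Lemma derive_slice1 (f : R * (R * R) -> R) (s : R) x d :
  is_derive (s, x) dt f d -> is_derive s (1:R) (fun s => f (s, x)) d.
Proof.
apply: (@is_derive_affine R _ _ (fun s : R => (s, x))) => h.
by rewrite /dt; congr pair; rewrite /= scaler0 add0r.
Qed.

Lemma derive_far (V : normedModType R) (f : V -> R) (x v : V) (M d : R) :
  (forall y : V, M < `|y| -> f y = 0) -> M < `|x| -> is_derive x v f d -> d = 0.
Proof.
move=> f0 Mx df.
have ne : \near x, (cst 0 : V -> R) x = f x.
  have : nbhs x [set z : V | M < `|z|].
    by apply: (@norm_continuous _ _ x [set s : R | M < s]); exact: lt_nbhsr.
  by apply: filterS => z /f0.
exact: is_derive_uniq df (near_eq_is_derive ne (is_derive_cst _ _ _)).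
Qed.

Lemma int2_derive_compact (f f' : R * R -> R) (M : R) v : continuous f -> continuous f' ->
  (forall x, is_derive x v f (f' x)) -> (forall x, M < `|x| -> f x = 0) -> int2 f' = 0.
Proof.
move=> cf cf' df f0; apply: (@int2_derive_eq0 _ f _ v) => //.
  exact: adm_compactC cf f0.
by apply: (@adm_compactC _ _ M cf') => x Mx; exact: derive_far f0 Mx (df x).
Qed.

(** The spatial support is the same at all times, so the time derivative is bounded on the compact
    set of times within 1 of s and points of norm at most M, and vanishes elsewhere. *)
Lemma diff_int2_compact (G G' : R * (R * R) -> R) (M s : R) : continuous G -> continuous G' ->
  (forall z, is_derive z dt G (G' z)) -> (forall t x, M < `|x| -> G (t, x) = 0) ->
  is_derive s (1:R) (fun t => int2 (fun x => G (t, x))) (int2 (fun x => G' (s, x))).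
Proof.
move=> cG cG' dG G0.
have G'0 t x : M < `|x| -> G' (t, x) = 0.
  move=> Mx; have d := derive_slice1 (dG (t, x)).
  have e : (fun s => G (s, x)) = cst 0 by apply/funext => s'; exact: G0.
  by rewrite e in d; exact: is_derive_uniq d (is_derive_cst _ _ _).
have cK : compact (`[s - 1, s + 1]%classic `*` [set x : R * R | `|x| <= M]).
  by apply: compact_setX; [exact: segment_compact|exact: compact_box].
have [B hB] := continuous_bounded_on_compact cK cG'.
have adm1 : adm (fun x : R * R => if `|x| <= M then 1 else 0).
  apply: (@adm_compact _ _ M) => [||x]; last by move=> h; rewrite leNgt h.
    apply: measurable_fun_ifT => //; apply: measurable_fun_ler => //.
    exact: continuous_measurable2 (@norm_continuous _ _).
  by exists 1 => x; case: ifP; rewrite ?normr1 ?normr0.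
have [_ [K1 hK1]] := adm1.
apply: (@diff_int2 _ (fun t x => G (t, x)) (fun t x => G' (t, x)) s 1 (`|B| * K1) ltr01).
- by move=> t _; apply: (@adm_compactC _ _ M); [exact: continuous_slice|exact: G0].
- by move=> t x _; exact: derive_slice1.
- move=> t x; rewrite ltr_distl => ht.
  have h1 := hK1 x; rewrite -mulrA.
  have [xM|Mx] := leP `|x| M; last first.
    by rewrite G'0 // normr0 mulr_ge0 // (le_trans _ h1).
  rewrite xM normr1 in h1; rewrite (le_trans _ (ler_wpM2l (normr_ge0 B) h1)) // mulr1.
  rewrite (le_trans (hB _ _)) ?ler_norm //; split => //=.
  by rewrite in_itv /=; lra.
Qed.

Lemma CauchySchwarz x y : `|dot x y| <= enorm x * enorm y.
Proof.
rewrite /enorm -sqrtrM ?dot_ge0 // -sqrtr_sqr ler_wsqrtr //.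
rewrite /dot -subr_ge0.
rewrite (_ : _ - _ = (x.1 * y.2 - x.2 * y.1) ^+ 2); last by ring.
exact: sqr_ge0.
Qed.

(** The squared positive part is a cutoff of class C^1, enough to differentiate under the integral,
    and its nonnegative derivative is what gives the transport inequality its sign. *)
Definition possq (z : R) : R := if 0 < z then z ^+ 2 else 0.
Definition possq' (z : R) : R := if 0 < z then 2 * z else 0.

Lemma possq_ge0 z : 0 <= possq z.
Proof. by rewrite /possq; case: ifP => // _; exact: sqr_ge0. Qed.

Lemma possq'_ge0 z : 0 <= possq' z.
Proof. by rewrite /possq'; case: ifP => // z0; rewrite mulr_ge0 // ltW. Qed.

Lemma is_derive_possq (z : R) : is_derive z (1:R) possq (possq' z).
Proof.
have [z0|z0] := ltP 0 z; last first.
  have e : possq' z = 0 by rewrite /possq' ltNge z0.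
  rewrite e; apply: (@is_derive_quad _ _ _ 1) => t.
  rewrite {2}/possq (ltNge 0 z) z0 /= subr0 mul1r /possq.
  case: ltP => t0; last by rewrite normr0 sqr_ge0.
  by rewrite ger0_norm ?sqr_ge0 // ler_sqr ?nnegrE; lra.
have ne : \near z, z ^+ 2 = possq z.
  near=> t; rewrite /possq; suff -> : 0 < t by [].
  by near: t; exact: lt_nbhsr.
rewrite /possq' z0; apply: near_eq_is_derive ne _.
have d := is_deriveM (is_derive_id z (1:R)) (is_derive_id z (1:R)).
have -> : (fun x : R => x ^+ 2) = id * id by apply/funext => t; rewrite expr2.
by apply: is_derive_eq d _; rewrite /GRing.scale /=; ring.
Unshelve. all: by end_near. Qed.

Lemma continuous_possq' : continuous possq'.
Proof.
have -> : possq' = (fun z : R => z + `|z|).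
  apply/funext => z; rewrite /possq'; case: ltP => z0; last by rewrite ler0_norm // subrr.
  by rewrite gtr0_norm // mulr2n mulrDl mul1r.
by move=> z; apply: cvgD; [exact: cvg_id|exact: norm_continuous].
Qed.

Lemma continuous_possq : continuous possq.
Proof.
move=> z; apply: differentiable_continuous; apply/derivable1_diffP.
by have [] := is_derive_possq z.
Qed.

(** A differentiable substitute for the distance to x0: it differs from it by at most 1 and its
    gradient has length at most 1. *)
Definition bracket x0 x : R := Num.sqrt (1 + dot (x - x0) (x - x0)).

Lemma bracket_gt0 x0 x : 0 < bracket x0 x.
Proof. by rewrite sqrtr_gt0; have := dot_ge0 (x - x0); lra. Qed.

Lemma enorm_le_bracket x0 x : enorm (x - x0) <= bracket x0 x.
Proof. by apply: ler_wsqrtr; rewrite lerDr. Qed.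

Lemma bracket_le x0 x : bracket x0 x <= 1 + enorm (x - x0).
Proof.
have e0 := enorm_ge0 (x - x0).
rewrite -[leRHS]ger0_norm ?addr_ge0 // -sqrtr_sqr ler_wsqrtr // -enorm_sqr; nra.
Qed.

Lemma derive_bracket x0 x v : is_derive x v (bracket x0) (dot (x - x0) v / bracket x0 x).
Proof.
have d1 : is_derive x v (fun y => dot (y - x0) (y - x0)) (2 * dot (x - x0) v).
  apply: (@is_derive_affine R _ _ (fun y : R * R => y - x0) x v v _ _ _ (derive_dot (x - x0) v)) => h.
  by rewrite addrA.
have d2 := is_deriveD (is_derive_cst (1:R) x v) d1.
have p : 0 < 1 + dot (x - x0) (x - x0) by have := dot_ge0 (x - x0); lra.
have d3 := is_derive_comp d2 (is_derive1_sqrt p).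
apply: is_derive_eq d3 _; rewrite add0r /bracket; field.
by rewrite gt_eqF // sqrtr_gt0.
Qed.

Lemma continuous_bracket x0 : continuous (bracket x0).
Proof.
move=> x; apply: (@continuous_comp _ _ _ (fun y => 1 + dot (y - x0) (y - x0)) Num.sqrt); last exact: sqrt_continuous.
apply: cvgD; first exact: cvg_cst.
apply: (@continuous_comp _ _ _ (fun y => y - x0) (fun y => dot y y)).
  by apply: cvgB; [exact: cvg_id|exact: cvg_cst].
exact: (Cn_cont (Cn_dot R 0)).
Qed.

End SpaceTime.

(** * The vorticity equation and weighted moments of the vorticity *)

Section VorticityTransport.
Variable R : realType.
Notation mT := (measurableTypeR R).
Implicit Types (x y : R * R) (i j k : 'I_2) (t s : R).

Section continuity.
Variable T : topologicalType.
Implicit Types f g : T -> R.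

Lemma cont_comp (U W : topologicalType) (f : T -> U) (g : U -> W) :
  continuous f -> continuous g -> continuous (fun z => g (f z)).
Proof. by move=> cf cg z; apply: (@continuous_comp _ _ _ f g); [exact: cf|exact: cg]. Qed.

Lemma contD f g : continuous f -> continuous g -> continuous (fun z => f z + g z).
Proof. by move=> cf cg z; apply: cvgD; [exact: cf|exact: cg]. Qed.

Lemma contB f g : continuous f -> continuous g -> continuous (fun z => f z - g z).
Proof. by move=> cf cg z; apply: cvgB; [exact: cf|exact: cg]. Qed.

Lemma contM f g : continuous f -> continuous g -> continuous (fun z => f z * g z).
Proof. by move=> cf cg z; apply: cvgM; [exact: cf|exact: cg]. Qed.

Lemma contN f : continuous f -> continuous (fun z => - f z).
Proof. by move=> cf z; apply: cvgN; exact: cf. Qed.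

Lemma contV f : (forall z, f z != 0) -> continuous f -> continuous (fun z => (f z)^-1).
Proof. by move=> f0 cf z; apply: cvgV; [exact: f0|exact: cf]. Qed.

Lemma cont_cst (k : R) : continuous (fun _ : T => k).
Proof. by move=> z; exact: cvg_cst. Qed.
End continuity.

Section flow.
Variables (v : R * (R * R) -> R * R) (u : R -> R * R -> R * R) (u0 : R * R -> R * R).
Hypothesis sv : smooth v.
Hypothesis uv : forall t x, 0 <= t -> u t x = v (t, x).
Hypothesis sol : euler_solution u0 u.

Let e i := Defs.basis R i.
Let o0 : 'I_2 := ord0.
Let o1 : 'I_2 := ord_max.

Let lo : lift ord0 ord0 = o1.
Proof. exact: val_inj. Qed.

Definition velocity k (z : R * (R * R)) : R := coor k (v z).

Lemma Cn_vel n k : Cn n (velocity k).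
Proof.
rewrite /velocity; have [h|h] := eqVneq k ord0.
  by rewrite /coor h eqxx; exact: Cn_pair1 (sv n).
have -> : (fun z => coor k (v z)) = (fun z => (v z).2); last exact: Cn_pair2 (sv n).
by apply/funext => y; rewrite /coor (negbTE h).
Qed.

(** Taken from the extension [v], it is smooth on all of space-time, across t = 0 as well; it is the
    vorticity of the solution for t >= 0 only. *)
Definition vor (z : R * (R * R)) : R := 'D_(dx (e o0)) (velocity o1) z - 'D_(dx (e o1)) (velocity o0) z.

Lemma Cn_vor n : Cn n vor.
Proof. by apply: CnB; apply: Cn_derive; exact: Cn_vel. Qed.

Lemma vel_slice k t : 0 <= t -> (fun x => coor k (u t x)) = (fun x => velocity k (t, x)).
Proof. by move=> t0; apply/funext => x; rewrite uv. Qed.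

Lemma pd_vel i k t x : 0 <= t -> pd i (coor k \o u t) x = 'D_(dx (e i)) (velocity k) (t, x).
Proof.
move=> t0; rewrite /pd (_ : coor k \o u t = (fun x => velocity k (t, x))); last exact: vel_slice.
by apply: derive_val; apply: derive_slice; exact: (Cn_is_derive _ _ (Cn_vel 1 k)).
Qed.

Lemma vorticity_vor t x : 0 <= t -> vorticity (u t) x = vor (t, x).
Proof. by move=> t0; rewrite /vorticity !pd_vel. Qed.

Lemma div_vel t x : 0 <= t -> 'D_(dx (e o0)) (velocity o0) (t, x) + 'D_(dx (e o1)) (velocity o1) (t, x) = 0.
Proof.
move=> t0; have := euler_div sol x t0.
by rewrite /divergence !big_ord_recl big_ord0 addr0 lo !pd_vel.
Qed.

Definition acc k (z : R * (R * R)) : R := 'D_(dt R) (velocity k) z +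
  (velocity o0 z * 'D_(dx (e o0)) (velocity k) z + velocity o1 z * 'D_(dx (e o1)) (velocity k) z).

Lemma momentum : exists P : R -> R * R -> R, forall t, 0 < t ->
  [/\ smooth (P t), recovered_pressure (u t) (P t) & forall k x, pd k (P t) x = - acc k (t, x)].
Proof.
have [P hP] := euler_momentum sol; exists P => t t0; have [sP rP mP] := hP t t0.
split=> // k x; have := mP k x.
have -> : 'D_1 (fun s => coor k (u s x)) t = 'D_(dt R) (velocity k) (t, x).
  apply: derive_val; have ne : \near t, (fun s => velocity k (s, x)) t = coor k (u t x).
    near=> s; rewrite /velocity uv //; suff : 0 < s by move/ltW.
    by near: s; exact: lt_nbhsr.
  apply: near_eq_is_derive ne _.
  by apply: derive_slice1; exact: (Cn_is_derive _ _ (Cn_vel 1 k)).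
rewrite !big_ord_recl big_ord0 addr0 lo.
rewrite !pd_vel ?ltW // !uv ?ltW // => h; apply/eqP; rewrite eq_sym eqr_oppLR; apply/eqP.
rewrite /acc /velocity; apply/eqP; rewrite -subr_eq0 opprK; apply/eqP; exact: h.
Unshelve. all: by end_near. Qed.

Lemma Cn_acc n k : Cn n (acc k).
Proof.
by apply: CnD; [apply: Cn_derive; exact: Cn_vel|apply: CnD; apply: CnM; try exact: Cn_vel; apply: Cn_derive; exact: Cn_vel].
Qed.

(** The acceleration is minus the pressure gradient and the second derivatives of the pressure
    commute; the pressure disappears here. *)
Lemma curl_acc t x : 0 < t -> 'D_(dx (e o0)) (acc o1) (t, x) = 'D_(dx (e o1)) (acc o0) (t, x).
Proof.
move=> t0; have [P hP] := momentum; have [sP _ mP] := hP t t0.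
have d i k : 'D_(dx (e i)) (acc k) (t, x) = - 'D_(e i) ('D_(e k) (P t)) x.
  have h1 := derive_slice (Cn_is_derive (t, x) (dx (e i)) (Cn_acc 1 k)).
  have h2 : is_derive x (e i) (fun y => - 'D_(e k) (P t) y) (- 'D_(e i) ('D_(e k) (P t)) x).
    apply: is_deriveN; apply: (@Cn_is_derive _ _ 0); exact: (Cn_derive _ (sP 2)).
  rewrite (_ : (fun y => - 'D_(e k) (P t) y) = (fun y => acc k (t, y))) in h2.
    exact: is_derive_uniq h1 h2.
  by apply/funext => y; have := mP k y; rewrite /pd => ->; rewrite opprK.
by rewrite !d (@Schwarz _ _ (P t) x (e o0) (e o1) (sP 2)).
Qed.

Let congr5 (A A' B B' C C' p c q d : R) : A = A' -> B = B' -> C = C' ->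
  A + (p *: (B : R^o) + c + (q *: (C : R^o) + d)) = A' + (p * B' + c + (q * C' + d)).
Proof. by move=> -> -> ->. Qed.

Lemma derive_acc i k z : 'D_(dx (e i)) (acc k) z =
  'D_(dt R) ('D_(dx (e i)) (velocity k)) z +
  (velocity o0 z * 'D_(dx (e o0)) ('D_(dx (e i)) (velocity k)) z + 'D_(dx (e o0)) (velocity k) z * 'D_(dx (e i)) (velocity o0) z
  + (velocity o1 z * 'D_(dx (e o1)) ('D_(dx (e i)) (velocity k)) z + 'D_(dx (e o1)) (velocity k) z * 'D_(dx (e i)) (velocity o1) z)).
Proof.
have sc a : 'D_a ('D_(dx (e i)) (velocity k)) z = 'D_(dx (e i)) ('D_a (velocity k)) z.
  exact: (@Schwarz _ _ (velocity k) z _ _ (Cn_vel 2 k)).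
have d1 a : is_derive z (dx (e i)) ('D_a (velocity k)) ('D_(dx (e i)) ('D_a (velocity k)) z).
  exact: (Cn_is_derive _ _ (Cn_derive a (Cn_vel 2 k))).
have d0 j : is_derive z (dx (e i)) (velocity j) ('D_(dx (e i)) (velocity j) z).
  exact: (Cn_is_derive _ _ (Cn_vel 1 j)).
have [_ E] := is_deriveD (d1 (dt R)) (is_deriveD (is_deriveM (d0 o0) (d1 (dx (e o0)))) (is_deriveM (d0 o1) (d1 (dx (e o1))))).
exact: (etrans E (congr5 _ _ _ _ (esym (sc (dt R))) (esym (sc (dx (e o0)))) (esym (sc (dx (e o1)))))).
Qed.

Lemma derive_vor a z : 'D_a vor z = 'D_a ('D_(dx (e o0)) (velocity o1)) z - 'D_a ('D_(dx (e o1)) (velocity o0)) z.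
Proof.
apply: derive_val; apply: is_deriveB; exact: (Cn_is_derive _ _ (Cn_derive _ (Cn_vel 2 _))).
Qed.

Let alg (A0 A1 v0 v1 B0 B1 C0 C1 d00 d01 d10 d11 : R) : d00 + d11 = 0 ->
  A1 + (v0 * B1 + d01 * d00 + (v1 * C1 + d11 * d01)) = A0 + (v0 * B0 + d00 * d10 + (v1 * C0 + d10 * d11)) ->
  A1 - A0 + (v0 * (B1 - B0) + v1 * (C1 - C0)) = 0.
Proof.
move=> dv h; have -> : A1 - A0 + (v0 * (B1 - B0) + v1 * (C1 - C0)) =
  (A1 + (v0 * B1 + d01 * d00 + (v1 * C1 + d11 * d01))) - (A0 + (v0 * B0 + d00 * d10 + (v1 * C0 + d10 * d11)))
  - (d00 + d11) * (d01 - d10) by ring.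
by rewrite h dv subrr mul0r subr0.
Qed.

(** In the curl of the acceleration the products of first derivatives combine into the divergence
    times the vorticity, which vanishes: there is no stretching in two dimensions. *)
Lemma vorticity_equation t x : 0 < t ->
  'D_(dt R) vor (t, x) + (velocity o0 (t, x) * 'D_(dx (e o0)) vor (t, x) + velocity o1 (t, x) * 'D_(dx (e o1)) vor (t, x)) = 0.
Proof.
move=> t0; have h := curl_acc x t0; rewrite !derive_acc in h.
rewrite !derive_vor; apply: alg (div_vel x (ltW t0)) h.
Qed.

Lemma is_derive_fst3 (a : R -> R) (d : R) (z w : R * (R * R)) :
  is_derive z.1 (1:R) a d -> is_derive z w (fun z => a z.1) (w.1 * d).
Proof.
move=> /(is_derive_homog w.1); rewrite [w.1 *: 1]mulr1.
exact: (@is_derive_affine R _ _ (fun z : R * (R * R) => z.1)).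
Qed.

Lemma is_derive_snd3 (g : R * R -> R) (d : R) (z w : R * (R * R)) :
  is_derive z.2 w.2 g d -> is_derive z w (fun z => g z.2) d.
Proof. exact: (@is_derive_affine R _ _ (fun z : R * (R * R) => z.2)). Qed.

Section transport.
Variables (F F' a b : R -> R) (K T : R) (x0 : R * R).
Hypothesis T0 : 0 <= T.
Hypothesis dF : forall z : R, is_derive z (1:R) F (F' z).
Hypothesis cF' : continuous F'.
Hypothesis F0 : forall z, 0 <= F z.
Hypothesis da : forall s, is_derive s (1:R) a (b s).
Hypothesis cb : continuous b.
Hypothesis a0 : forall s, 0 <= a s.
Hypothesis ub : forall s x, 0 <= s <= T -> enorm (u s x) <= b s.

Let arg (z : R * (R * R)) : R := K - a z.1 - bracket x0 z.2.
Let psi z := possq (arg z).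
Let dpsi (z w : R * (R * R)) : R :=
  possq' (arg z) * (- (w.1 * b z.1) - dot (z.2 - x0) w.2 / bracket x0 z.2).

Let is_derive_psi z w : is_derive z w psi (dpsi z w).
Proof.
have d1 := is_deriveB (is_deriveB (is_derive_cst K z w) (is_derive_fst3 w (da z.1)))
  (is_derive_snd3 (derive_bracket x0 z.2 w.2)).
have d2 : is_derive z w arg (- (w.1 * b z.1) - dot (z.2 - x0) w.2 / bracket x0 z.2).
  by apply: is_derive_eq d1 _; rewrite sub0r.
exact: (is_derive_comp d2 (is_derive_possq _)).
Qed.

Let continuous_derivable (f f' : R -> R) : (forall z : R, is_derive z (1:R) f (f' z)) -> continuous f.
Proof.
by move=> df z; apply: differentiable_continuous; apply/derivable1_diffP; have [] := df z.
Qed.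

Let c1 : continuous (fun z : R * (R * R) => z.1).
Proof. by move=> z; exact: cvg_fst. Qed.

Let c2 : continuous (fun z : R * (R * R) => z.2).
Proof. by move=> z; exact: cvg_snd. Qed.

Let carg : continuous arg.
Proof.
apply: contB; first apply: contB.
- exact: cont_cst.
- exact: cont_comp c1 (continuous_derivable da).
- exact: cont_comp c2 (@continuous_bracket _ x0).
Qed.

Let cpsi : continuous psi.
Proof. exact: cont_comp carg (@continuous_possq R). Qed.

Let cdot w : continuous (fun x => dot (x - x0) w / bracket x0 x).
Proof.
apply: contM.
  apply: (@cont_comp _ _ _ (fun x => x - x0) (fun x => dot x w)); last exact: continuous_dotl.
  by move=> x; apply: cvgB; [exact: cvg_id|exact: cvg_cst].
by apply: contV => [x|]; [rewrite gt_eqF // bracket_gt0|exact: continuous_bracket].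
Qed.

Let cdpsi w : continuous (dpsi ^~ w).
Proof.
apply: contM; first exact: cont_comp carg (@continuous_possq' R).
apply: contB; last exact: cont_comp c2 (@cdot w.2).
by apply: contN; apply: contM; [exact: cont_cst|exact: cont_comp c1 cb].
Qed.

Let cvor w : continuous ('D_w vor).
Proof. exact: (Cn_cont (Cn_derive w (Cn_vor 1))). Qed.

Let cFv : continuous (fun z => F (vor z)).
Proof. exact: cont_comp (Cn_cont (Cn_vor 0)) (continuous_derivable dF). Qed.

Let G z := F (vor z) * psi z.
Let dG z w := F (vor z) * dpsi z w + psi z * (F' (vor z) * 'D_w vor z).

Let is_derive_G z w : is_derive z w G (dG z w).
Proof.
have d := is_derive_comp (Cn_is_derive z w (Cn_vor 1)) (dF (vor z)).
exact: (is_deriveM d (is_derive_psi z w)).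
Qed.

Let cG : continuous G.
Proof. exact: contM cFv cpsi. Qed.

Let cdG w : continuous (dG ^~ w).
Proof.
apply: contD; first exact: contM cFv (@cdpsi w).
apply: contM cpsi _; apply: contM _ (@cvor w).
exact: cont_comp (Cn_cont (Cn_vor 0)) cF'.
Qed.

Let M := `|x0| + `|K|.

Let psi_far t x : M < `|x| -> psi (t, x) = 0.
Proof.
move=> Mx; rewrite /psi /possq ifF //; apply/negbTE; rewrite -leNgt /arg /=.
have h1 := le_trans (norm_le_enorm (x - x0)) (enorm_le_bracket x0 x).
have h2 := ler_normD (x - x0) x0; rewrite subrK in h2.
by have := ler_norm K; have := a0 t; move: Mx; rewrite /M; lra.
Qed.

Let flux i z := velocity i z * G z.
Let dflux i z := velocity i z * dG z (dx (e i)) + G z * 'D_(dx (e i)) (velocity i) z.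

Let int_flux i s : int2 (fun x => dflux i (s, x)) = 0.
Proof.
apply: (@int2_derive_compact R (fun x => flux i (s, x)) (fun x => dflux i (s, x)) M (e i)).
- apply: continuous_slice => z; apply: cvgM; [exact: (Cn_cont (Cn_vel 0 i))|exact: cG].
- apply: continuous_slice => z; apply: cvgD; apply: cvgM.
  + exact: (Cn_cont (Cn_vel 0 i)).
  + exact: cdG.
  + exact: cG.
  + exact: (Cn_cont (Cn_derive _ (Cn_vel 1 i))).
- move=> x; apply: derive_slice.
  exact: (is_deriveM (Cn_is_derive _ _ (Cn_vel 1 i)) (is_derive_G _ _)).
- by move=> x Mx; rewrite /flux /G psi_far // !mulr0.
Qed.

(** Adding the fluxes, whose integrals vanish, turns the time derivative into a material derivative.
    The vorticity equation removes the term in [F'], the divergence the term in [F] times [psi], and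
    what is left is [F] times the material derivative of the cutoff, nonpositive by Cauchy-Schwarz
    and |u| <= b. *)
Let pointwise s x : 0 < s -> s < T -> dG (s, x) (dt R) + (dflux o0 (s, x) + dflux o1 (s, x)) <= 0.
Proof.
move=> s0 sT; set z := (s, x).
have E : dG z (dt R) + (dflux o0 z + dflux o1 z) =
   F (vor z) * (dpsi z (dt R) + (velocity o0 z * dpsi z (dx (e o0)) + velocity o1 z * dpsi z (dx (e o1)))).
  have h1 := vorticity_equation x s0; have h2 := div_vel x (ltW s0).
  rewrite -/z in h1 h2; rewrite /dflux /G /dG.
  move: h1 h2; generalize ('D_(dt R) vor z) ('D_(dx (e o0)) vor z) ('D_(dx (e o1)) vor z)
    ('D_(dx (e o0)) (velocity o0) z) ('D_(dx (e o1)) (velocity o1) z) (velocity o0 z) (velocity o1 z)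
    (dpsi z (dt R)) (dpsi z (dx (e o0))) (dpsi z (dx (e o1))) (F (vor z)) (F' (vor z)) (psi z).
  move=> A B C D E0 v0 v1 p0 p1 p2 f f' p h1 h2.
  rewrite [LHS](_ : _ = f * (p0 + (v0 * p1 + v1 * p2)) + p * f' * (A + (v0 * B + v1 * C)) + f * p * (D + E0)); last by ring.
  by rewrite h1 h2 !mulr0 !addr0.
rewrite E mulr_ge0_le0 //.
have -> : dpsi z (dt R) + (velocity o0 z * dpsi z (dx (e o0)) + velocity o1 z * dpsi z (dx (e o1))) =
  possq' (arg z) * (- b s - dot (x - x0) (v z) / bracket x0 x).
  rewrite /dpsi /dt /dx /= /e /Defs.basis /dot /velocity /coor /=.
  generalize (possq' (arg z)) (b s) (bracket x0 x)^-1 (x.1 - x0.1) (x.2 - x0.2) (v z).1 (v z).2.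
  by move=> p b0 j y1 y2 v1 v2; ring.
rewrite mulr_ge0_le0 ?possq'_ge0 //.
have hb : enorm (v z) <= b s.
  by have := @ub s x; rewrite (uv _ (ltW s0)) (ltW s0) (ltW sT) => h; exact: (h isT).
have b0 := le_trans (enorm_ge0 _) hb.
have j0 := bracket_gt0 x0 x.
have cs := CauchySchwarz (x - x0) (v z).
have h : `|dot (x - x0) (v z)| <= b s * bracket x0 x.
  rewrite (le_trans cs) // mulrC; apply: ler_pM => //; try exact: enorm_ge0.
  exact: enorm_le_bracket.
rewrite -opprD oppr_le0.
have h2 : - b s <= dot (x - x0) (v z) / bracket x0 x.
  by rewrite ler_pdivlMr // mulNr lerNl (le_trans _ h) // -normrN ler_norm.
lra.
Qed.

(* The support of the weight shrinks at the speed b >= |u|, so the weight is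
   nonincreasing along the flow. *)
Theorem transport : int2 (fun x => F (vor (T, x)) * possq (K - a T - bracket x0 x)) <=
  int2 (fun x => F (vor (0, x)) * possq (K - a 0 - bracket x0 x)).
Proof.
have G0 t x : M < `|x| -> G (t, x) = 0 by move=> Mx; rewrite /G psi_far // mulr0.
have dg (s : R) := @diff_int2_compact R G (dG ^~ (dt R)) M s cG (@cdG (dt R)) (fun z => is_derive_G z (dt R)) G0.
apply: (@le_of_derive_le0 R (fun s => int2 (fun x => G (s, x))) (fun s => int2 (fun x => dG (s, x) (dt R))) 0 T T0).
- by move=> s _; apply: differentiable_continuous; apply/derivable1_diffP; have [] := dg s.
move=> s /andP[s0 sT].
have aG : adm (fun x => dG (s, x) (dt R)).
  apply: (@adm_compactC _ _ M); first exact: continuous_slice (@cdG (dt R)).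
  move=> x Mx; have d := derive_slice1 (is_derive_G (s, x) (dt R)).
  have e0 : (fun s => G (s, x)) = cst 0 by apply/funext => s'; exact: G0.
  by rewrite e0 in d; exact: is_derive_uniq d (is_derive_cst _ _ _).
have af i : adm (fun x => dflux i (s, x)).
  apply: (@adm_compactC _ _ M).
    apply: continuous_slice; apply: contD; apply: contM.
    + exact: (Cn_cont (Cn_vel 0 i)).
    + exact: cdG.
    + exact: cG.
    + exact: (Cn_cont (Cn_derive _ (Cn_vel 1 i))).
  move=> x Mx; apply: (@derive_far R _ (fun x => flux i (s, x)) x (e i) M _ _ Mx).
    by move=> y My; rewrite /flux G0 // mulr0.
  apply: derive_slice.
  exact: (is_deriveM (Cn_is_derive _ _ (Cn_vel 1 i)) (is_derive_G _ _)).
have afs := admD (af o0) (af o1).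
have -> : int2 (fun x => dG (s, x) (dt R)) =
    int2 (fun x => dG (s, x) (dt R) + (dflux o0 (s, x) + dflux o1 (s, x))).
  have E1 := int2D aG afs; have E2 := int2D (af o0) (af o1).
  by rewrite E1 E2 !int_flux !addr0.
have aS := admD aG afs.
have E3 := int2Z (-1) aS; rewrite -oppr_ge0 -mulN1r -E3.
by apply: int2_ge0 => x; rewrite mulN1r oppr_ge0; exact: pointwise.
Qed.
End transport.
End flow.

End VorticityTransport.

(** * Mean oscillation on squares and the John-Nirenberg inequality *)

Section SetIntegrals.
Variable R : realType.
Notation mT := (measurableTypeR R).
Implicit Types (x y a : R * R) (r l : R) (A B : set (R * R)) (f g : R * R -> R).

Definition bset A := measurable (A : set (mT * mT)) /\ exists M : R, forall y, A y -> `|y| <= M.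

Lemma bset_square a l : bset (square a l).
Proof.
split; first exact: measurable_square.
exists (`|a| + `|l|) => -[y1 y2] [/=]; rewrite !in_itv /= => h1 h2.
have [a1 a2] : `|a.1| <= `|a| /\ `|a.2| <= `|a| by rewrite prod_normE !le_max !lexx orbT.
rewrite prod_normE ge_max /=; have := ler_norm l.
by move: a1 a2; rewrite !ler_norml => /andP[? ?] /andP[? ?] ?; apply/andP; split; lra.
Qed.

Lemma continuous_enormB x : continuous (fun y => enorm (y - x)).
Proof.
move=> y; apply: (@continuous_comp _ _ _ (fun y => dot (y - x) (y - x)) Num.sqrt); last exact: sqrt_continuous.
by apply: cvgD; apply: cvgM; apply: cvgB; try exact: cvg_cst; try exact: cvg_fst; exact: cvg_snd.
Qed.

Lemma bset_eball x r : bset (eball x r).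
Proof.
split.
  rewrite (_ : eball x r = (fun y => enorm (y - x)) @^-1` `]-oo, r[%classic); last first.
    by apply/seteqP; split=> y; rewrite /eball /= in_itv.
  rewrite -[X in measurable X]setTI.
  exact: (continuous_measurable2 (@continuous_enormB x) measurableT (measurable_itv _)).
exists (`|x| + r) => y; rewrite /eball /= => h.
have := norm_le_enorm (y - x); have := ler_normD (y - x) x; rewrite subrK; lra.
Qed.

(** The indicator is put into the integrand so that integrals over a set fall under the [adm]
    calculus on the whole plane. *)
Definition intA A f : R := int2 (fun y => \1_A y * f y).

Lemma indic_cases A y : A y /\ \1_A y = 1 :> R \/ ~ A y /\ \1_A y = 0 :> R.
Proof.
rewrite indicE; have [h|h] := boolP (y \in A); first by left; split => //; exact: set_mem h.
by right; split=> // Ay; move/negP: h; apply; exact: mem_set.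
Qed.

Lemma adm_intA A f : bset A -> continuous f -> adm (fun y => \1_A y * f y).
Proof.
move=> [mA [M hM]] cf; have mf := continuous_measurable2 cf.
apply: (@adm_compact _ _ M).
- by apply: measurable_funM => //; exact: measurable_indic.
- have [B hB] := continuous_bounded_on_compact (@compact_box _ M) cf.
  exists `|B| => x; have [[Ax ->]|[_ ->]] := indic_cases A x; last by rewrite mul0r normr0.
  by rewrite mul1r (le_trans (hB _ (hM _ Ax))) // ler_norm.
- move=> x Mx; have [[Ax _]|[_ ->]] := indic_cases A x; last by rewrite mul0r.
  by move: (hM _ Ax); rewrite leNgt Mx.
Qed.

Lemma intA_le A f g : bset A -> continuous f -> continuous g ->
  (forall y, A y -> f y <= g y) -> intA A f <= intA A g.
Proof.
move=> bA cf cg fg; apply: int2_le; [exact: adm_intA|exact: adm_intA|].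
by move=> y; have [[Ay ->]|[_ ->]] := indic_cases A y; rewrite ?mul0r // !mul1r fg.
Qed.

Lemma intA_sub A B f : bset A -> bset B -> A `<=` B -> continuous f ->
  (forall y, 0 <= f y) -> intA A f <= intA B f.
Proof.
move=> bA bB AB cf f0; apply: int2_le; [exact: adm_intA|exact: adm_intA|].
move=> y; have [[Ay ->]|[_ ->]] := indic_cases A y; last by rewrite mul0r mulr_ge0 // indicE.
by have [[_ ->]|[nB _]] := indic_cases B y; last by have := AB _ Ay.
Qed.

Lemma intA_ge0 A f : (forall y, 0 <= f y) -> 0 <= intA A f.
Proof. by move=> f0; apply: int2_ge0 => y; rewrite mulr_ge0 // indicE. Qed.

Lemma intAD A f g : bset A -> continuous f -> continuous g ->
  intA A (fun y => f y + g y) = intA A f + intA A g.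
Proof.
move=> bA cf cg; have := int2D (adm_intA bA cf) (adm_intA bA cg).
by move=> h; apply: etrans h; apply: eq_int2 => y; rewrite mulrDr.
Qed.

Lemma intAZ A k f : bset A -> continuous f -> intA A (fun y => k * f y) = k * intA A f.
Proof.
move=> bA cf; have h := int2Z k (adm_intA bA cf).
by apply: etrans h; apply: eq_int2 => y; rewrite mulrCA.
Qed.

Definition vol A : R := intA A (fun=> 1).

Lemma intA_cst A k : bset A -> intA A (fun=> k) = k * vol A.
Proof.
move=> bA; rewrite -intAZ //; last exact: cont_cst.
by apply: eq_int2 => y; rewrite mulr1.
Qed.

Lemma intA_norm A f : bset A -> continuous f -> `|intA A f| <= intA A (fun y => `|f y|).
Proof.
move=> bA cf; apply: le_trans (int2_norm (adm_intA bA cf)) _.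
by rewrite le_eqVlt; apply/orP; left; apply/eqP; apply: eq_int2 => y; rewrite normrM indicE normr_nat.
Qed.

Lemma intA_patch A f : intA A f = \int[leb2 R]_(y in (A : set (mT * mT))) f y.
Proof.
rewrite [RHS]Rintegral_mkcond; congr Rintegral; apply/funext => y.
rewrite patchE; case: (boolP (y \in A)) => h; rewrite indicE ?h ?mul1r //.
by rewrite (negbTE h) mul0r.
Qed.

Lemma ereal_intA A f : bset A -> continuous f ->
  (\int[leb2 R]_(y in (A : set (mT * mT))) (f y)%:E)%E = (intA A f)%:E.
Proof.
move=> bA cf; have [mA _] := bA.
rewrite intA_patch /Rintegral fineK //; apply: integrable_fin_num => //.
apply/integrable_mkcond => //.
have := adm_int (adm_intA bA cf); congr (integrable _ _ _); apply/funext => y /=.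
rewrite patchE; case: (boolP (y \in A)) => h; rewrite indicE ?h ?mul1r //.
by rewrite (negbTE h) mul0r.
Qed.

Lemma area_vol A : bset A -> area A = vol A.
Proof.
move=> bA; rewrite /area /vol; have := ereal_intA bA (@cont_cst _ _ 1).
have [mA _] := bA.
rewrite (_ : integral _ _ _ = leb2 R A) => [-> //|].
by rewrite integral_cst // mul1e.
Qed.

Lemma cont_norm (T : topologicalType) (f : T -> R) : continuous f -> continuous (fun z => `|f z|).
Proof. by move=> cf z; apply: cvg_norm; exact: cf. Qed.

Definition mean A f : R := (vol A)^-1 * intA A f.


Lemma osc_intA x r f : continuous f ->
  osc x r f = ((vol (eball x r))^-1 * intA (eball x r) (fun y => `|f y - mean (eball x r) f|))%:E.
Proof.
move=> cf; have bB := bset_eball x r; rewrite /osc area_vol // /Avg area_vol // -intA_patch.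
rewrite ereal_intA //; apply: cont_norm; apply: contB => //; exact: cont_cst.
Qed.

Let cfk f k : continuous f -> continuous (fun y => f y - k).
Proof. by move=> cf; apply: contB => //; exact: cont_cst. Qed.

Let cnfk f k : continuous f -> continuous (fun y => `|f y - k|).
Proof. by move=> cf; apply: cont_norm; exact: cfk. Qed.

Lemma intA_subk A f k : bset A -> continuous f -> intA A (fun y => f y - k) = intA A f - k * vol A.
Proof.
move=> bA cf; rewrite -mulNr -intA_cst // -intAD //; exact: cont_cst.
Qed.

Lemma mean_dist A f k : bset A -> continuous f -> 0 < vol A ->
  `|mean A f - k| * vol A <= intA A (fun y => `|f y - k|).
Proof.
move=> bA cf A0; apply: le_trans (intA_norm bA (@cfk _ k cf)).
rewrite intA_subk // -[in leLHS](gtr0_norm A0) -normrM mulrBl /mean mulrAC mulVf ?gt_eqF // mul1r.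
by rewrite lexx.
Qed.

Lemma dev_mean A f k : bset A -> continuous f -> 0 < vol A ->
  intA A (fun y => `|f y - mean A f|) <= 2 * intA A (fun y => `|f y - k|).
Proof.
move=> bA cf A0; have h := mean_dist k bA cf A0.
apply: (@le_trans _ _ (intA A (fun y => `|f y - k| + `|mean A f - k|))).
  apply: intA_le => //; first exact: cnfk.
    by apply: contD; [exact: cnfk|exact: cont_cst].
  move=> y _; have := ler_normB (f y - k) (mean A f - k).
  by rewrite opprB addrA subrK.
rewrite intAD //; [|exact: cnfk|exact: cont_cst].
by rewrite intA_cst // mulr2n mulrDl mul1r lerD2l.
Qed.

Lemma vol_square a l : 0 <= l -> vol (square a l) = l ^+ 2.
Proof.
move=> l0; rewrite -(int2_indic_square a l0); by apply: eq_int2 => y; rewrite mulr1.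
Qed.

Definition centred_square x r := square (x.1 - r, x.2 - r) (2 * r).

Lemma eball_centred_square x r : eball x r `<=` centred_square x r.
Proof.
move=> y; rewrite /eball /= => h; have := le_lt_trans (norm_le_enorm (y - x)) h.
rewrite prod_normE gt_max /= !ltr_norml => /andP[/andP[? ?] /andP[? ?]].
by split; rewrite /= in_itv /=; lra.
Qed.

Lemma centred_square_eball x r : 0 < r -> centred_square x (r / 2) `<=` eball x r.
Proof.
move=> r0 y [/=]; rewrite !in_itv /= => /andP[h1 h2] /andP[h3 h4].
rewrite /eball /= /enorm -[ltRHS]gtr0_norm // -sqrtr_sqr ltr_sqrt ?exprn_gt0 // /dot /=.
have : `|y.1 - x.1| <= r / 2 by rewrite ler_norml; lra.
have : `|y.2 - x.2| <= r / 2 by rewrite ler_norml; lra.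
rewrite -!expr2 -(@real_normK _ (y.1 - x.1)) ?num_real // -(@real_normK _ (y.2 - x.2)) ?num_real //.
move: (normr_ge0 (y.1 - x.1)) (normr_ge0 (y.2 - x.2)); nra.
Qed.

Lemma vol_le A B : bset A -> bset B -> A `<=` B -> vol A <= vol B.
Proof. by move=> bA bB AB; apply: intA_sub => // ; exact: cont_cst. Qed.

Lemma vol_eball_ge x r : 0 < r -> r ^+ 2 <= vol (eball x r).
Proof.
move=> r0; have := vol_le (bset_square _ _) (bset_eball x r) (centred_square_eball r0 (x:=x)).
by rewrite vol_square; [rewrite mulrC divfK|lra].
Qed.

Lemma vol_eball_le x r : 0 < r -> vol (eball x r) <= 4 * r ^+ 2.
Proof.
move=> r0; have := vol_le (bset_eball x r) (bset_square _ _) (eball_centred_square (x:=x) (r:=r)).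
by rewrite vol_square; [rewrite exprMn; lra|lra].
Qed.

Definition centre a l : R * R := (a.1 + l / 2, a.2 + l / 2).

Lemma square_eball a l : 0 < l -> square a l `<=` eball (centre a l) l.
Proof.
move=> l0; have := centred_square_eball l0 (x := centre a l).
rewrite /centred_square /centre /= !addrK mulrC divfK // -surjective_pairing; exact.
Qed.

(** The square lies in the ball of radius l about its centre. Replacing the mean over the ball by
    the mean over the square costs 2 and the area of the ball at most 4 l^2, whence 8. *)
Lemma osc_square f (c : R) a l : continuous f -> 0 < l ->
  (osc (centre a l) l f <= c%:E)%E ->
  intA (square a l) (fun y => `|f y - mean (square a l) f|) <= 8 * c * l ^+ 2.
Proof.
move=> cf l0; set x := centre a l; rewrite osc_intA // lee_fin; set m := mean _ _ => h.
have v0 := lt_le_trans (exprn_gt0 2 l0) (vol_eball_ge x l0).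
have bQ := bset_square a l; have bB := bset_eball x l.
have c0 : 0 <= c.
  by apply: le_trans h; rewrite mulr_ge0 ?invr_ge0 ?(ltW v0) // intA_ge0.
rewrite mulrC ler_pdivrMr // in h.
apply: le_trans (dev_mean m bQ cf _) _; first by rewrite vol_square ?exprn_gt0 // ltW.
have h2 := intA_sub bQ bB (square_eball l0) (@cnfk _ m cf) (fun=> normr_ge0 _).
have h3 := vol_eball_le x l0.
have h4 : c * vol (eball x l) <= c * (4 * l ^+ 2) by rewrite ler_wpM2l.
by lra.
Qed.

Lemma indic_squareE a l y :
  \1_(square a l) y = (a.1 <= y.1 < a.1 + l)%R%:R * (a.2 <= y.2 < a.2 + l)%R%:R :> R.
Proof.
rewrite -natrM mulnb indicE; congr (_ %:R); congr nat_of_bool; apply/idP/idP.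
  by move=> /set_mem[/=]; rewrite !in_itv /= => -> ->.
by move=> /andP[h1 h2]; apply: mem_set; split; rewrite /= in_itv /=.
Qed.

Lemma itv_split (c h s : R) : 0 <= h -> (c <= s < c + 2 * h)%R%:R =
  (c <= s < c + h)%R%:R + (c + h <= s < c + h + h)%R%:R :> R.
Proof.
move=> h0; rewrite (_ : c + 2 * h = c + h + h); last by ring.
have [h1|h1] := leP c s; have [h2|h2] := ltP s (c + h) => /=; have [h3|h3] := ltP s (c + h + h) => //=;
  have [h4|h4] := leP (c + h) s => //=; rewrite ?addr0 ?add0r //; exfalso; lra.
Qed.

Definition corner a h (n : nat) : R * R := nth a [:: a; (a.1 + h, a.2); (a.1, a.2 + h); (a.1 + h, a.2 + h)] n.

Lemma intA_split a h f : 0 <= h -> continuous f ->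
  intA (square a (2 * h)) f = \sum_(i < 4) intA (square (corner a h i) h) f.
Proof.
move=> h0 cf; rewrite !big_ord_recl big_ord0 addr0 /=.
have ad b := adm_intA (bset_square b h) cf.
have e1 := int2D (ad (a.1, a.2 + h)) (ad (a.1 + h, a.2 + h)).
have a1 := admD (ad (a.1, a.2 + h)) (ad (a.1 + h, a.2 + h)).
have e2 := int2D (ad (a.1 + h, a.2)) a1; have a2 := admD (ad (a.1 + h, a.2)) a1.
have e3 := int2D (ad a) a2.
rewrite /intA -e1 -e2 -e3; apply: eq_int2 => y; rewrite !indic_squareE /= !itv_split //.
ring.
Qed.

End SetIntegrals.

(** * The John-Nirenberg inequality by induction on the scale *)

Section UniformContinuityAndJohnNirenberg.
Variable R : realType.
Notation mT := (measurableTypeR R).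
Implicit Types (x y a : R * R) (r l h c d : R) (A B : set (R * R)) (f g : R * R -> R).

Lemma uniformly_continuous_on_box f (M e : R) : continuous f -> 0 < e ->
  exists2 d, 0 < d & forall y z, `|y| <= M -> `|z - y| < d -> `|f z - f y| < e.
Proof.
move=> cf e0; have /compact_near_coveringP cov := @compact_box R M.
pose P (d : R) y := forall z, `|z - y| < d -> `|f z - f y| < e.
have near x : `|x| <= M -> \forall x' \near x & d \near 0^'+, P d x'.
  move=> _; have /cvgrPdist_lt /(_ (e / 2)) := cf x; rewrite divr_gt0 // => /(_ isT).
  move=> /nbhs_ballP[h /= h0 hb].
  exists (ball x (h / 2), [set d | d < h / 2]) => /=.
    split; first by apply: nbhsx_ballx; rewrite divr_gt0.
    by apply: nbhs_right_lt; rewrite divr_gt0.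
  move=> [y d] [/= xy dh] z zy.
  have h1 : `|x - y| < h / 2 by rewrite -ball_normE in xy.
  have h2 : `|f x - f y| < e / 2 by apply: hb; rewrite -ball_normE /=; lra.
  have h3 : `|f x - f z| < e / 2.
    apply: hb; rewrite -ball_normE /=; have := ler_normB (x - y) (z - y).
    by rewrite opprB addrA subrK; lra.
  have := ler_normB (f x - f y) (f x - f z); rewrite opprB addrA.
  by rewrite (_ : f x - f y + f z - f x = f z - f y); [lra|ring].
have H := cov R (0^'+ : set_system R) P _ near.
have [d [d0 dP]] : exists d : R, 0 < d /\ [set x | `|x| <= M] `<=` P d.
  apply: (@filter_ex _ (0^'+ : set_system R)); apply: filterI; [exact: nbhs_right_gt|exact: H].
by exists d => // y z yM; exact: dP.
Qed.

Lemma vol_square_gt0 a l : 0 < l -> 0 < vol (square a l).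
Proof. by move=> l0; rewrite vol_square ?exprn_gt0 // ltW. Qed.

Lemma corner_sub a h (i : 'I_4) : 0 <= h -> square (corner a h i) h `<=` square a (2 * h).
Proof.
move=> h0 y; case: i => [[|[|[|[|//]]]]] ? /= [/=]; rewrite !in_itv /= => /andP[h1 h2] /andP[h3 h4];
  by split; rewrite /= in_itv /=; lra.
Qed.

Lemma intA_le_cst A f k : bset A -> continuous f -> (forall y, A y -> f y <= k) -> intA A f <= k * vol A.
Proof. by move=> bA cf h; rewrite -intA_cst //; apply: intA_le => //; exact: cont_cst. Qed.

Lemma continuous_expR_norm (s c : R) f : continuous f -> continuous (fun y => expR (s * `|f y - c|)).
Proof.
move=> cf; apply: (@cont_comp _ _ _ (fun y => s * `|f y - c|) expR) => //; last exact: continuous_expR.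
apply: contM; first exact: cont_cst.
by apply: cont_norm; apply: contB => //; exact: cont_cst.
Qed.

Section JohnNirenberg.
Variables (f : R * R -> R) (b L : R).
Hypothesis cf : continuous f.
Hypothesis b0 : 0 < b.
Hypothesis bmo : forall a l, 0 < l <= L ->
  intA (square a l) (fun y => `|f y - mean (square a l) f|) <= b * l ^+ 2.

(** With this exponent, moving the centre by at most 8 b multiplies the integrand by at most
    exp(1/2) <= 2. The 8 b is 4 b from c to the mean over the parent square plus 4 b from there to
    the mean over a quarter. *)
Let s : R := (16 * b)^-1.
Let s0 : 0 < s. Proof. by rewrite invr_gt0 mulr_gt0. Qed.

Let exp_le2 (k : R) : k <= 8 * b -> expR (s * k) <= 2.
Proof.
move=> kb; have h : s * k <= 2^-1.
  by rewrite /s mulrC ler_pdivrMr ?mulr_gt0 //; lra.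
apply: (@le_trans _ _ (expR 2^-1)); first by rewrite ler_expR.
have := @expR_ge1Dx R (- 2^-1); rewrite expRN => h2.
by rewrite -[leLHS]invrK -[leRHS]invrK lef_pV2 ?posrE ?invr_gt0 ?expR_gt0 //; lra.
Qed.

Let cE c : continuous (fun y => expR (s * `|f y - c|)).
Proof. exact: continuous_expR_norm. Qed.

Let cN c : continuous (fun y => `|f y - c|).
Proof. by apply: cont_norm; apply: contB => //; exact: cont_cst. Qed.

(* Proved by induction on the depth below which f oscillates less than b: on each
   quarter of the square, either the mean of f is still within 4 b of c and the
   induction hypothesis applies to c, or it is more than 4 b away and the integral
   of |f - c| pays for the quarter. *)
Let level a l := (forall c, `|mean (square a l) f - c| <= 4 * b ->
    intA (square a l) (fun y => expR (s * `|f y - c|)) <=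
      2 * l ^+ 2 + 2 / b * intA (square a l) (fun y => `|f y - c|)).

Let level_mean a l : 0 < l <= L -> level a l ->
  intA (square a l) (fun y => expR (s * `|f y - mean (square a l) f|)) <= 4 * l ^+ 2.
Proof.
move=> ll /(_ (mean (square a l) f)); rewrite subrr normr0 mulr_ge0 // => [/(_ isT) h|]; last exact: ltW.
apply: (le_trans h); have := bmo a ll; rewrite -(ler_pM2l (_ : 0 < 2 / b)) ?divr_gt0 //.
by rewrite mulrA divfK ?gt_eqF //; lra.
Qed.

Let level_step a h : 0 < h -> 2 * h <= L -> (forall i : 'I_4, level (corner a h i) h) -> level a (2 * h).
Proof.
move=> h0 hL lev c hc; have h00 := ltW h0.
rewrite (intA_split a h00 (@cE c)) (intA_split a h00 (@cN c)).
have -> : 2 * (2 * h) ^+ 2 + 2 / b * \sum_(i < 4) intA (square (corner a h i) h) (fun y => `|f y - c|) =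
   \sum_(i < 4) (2 * h ^+ 2 + 2 / b * intA (square (corner a h i) h) (fun y => `|f y - c|)).
  rewrite big_split /=; congr (_ + _); last by rewrite mulr_sumr.
  rewrite sumr_const card_ord -mulr_natl exprMn; ring.
apply: ler_sum => i _; set Q := square (corner a h i) h; set m := mean Q f.
have [mc|mc] := leP `|m - c| (4 * b); first exact: lev mc.
have bQ : bset Q := bset_square _ _.
have v0 : 0 < vol Q by exact: vol_square_gt0.
have vE : vol Q = h ^+ 2 by exact: vol_square.
(* The quarter has one fourth of the area of its parent, so its mean moves by at most four times the
   mean oscillation of the parent. *)
have d1 : `|m - mean (square a (2 * h)) f| <= 4 * b.
  have h1 := mean_dist (mean (square a (2 * h)) f) bQ cf v0.
  have h2 := intA_sub bQ (bset_square a (2 * h)) (@corner_sub a h i h00) (@cN (mean (square a (2 * h)) f)) (fun=> normr_ge0 _).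
  have h3 : 0 < 2 * h <= L by rewrite hL mulr_gt0.
  have := le_trans h1 (le_trans h2 (bmo a h3)).
  by rewrite vE (_ : b * _ = 4 * b * h ^+ 2); [rewrite ler_pM2r ?exprn_gt0|ring].
have d2 : `|m - c| <= 8 * b.
  have := ler_normD (m - mean (square a (2 * h)) f) (mean (square a (2 * h)) f - c).
  by rewrite addrA subrK; lra.
have hh : 0 < h <= L by lra.
have P1 := level_mean hh (lev i); rewrite -/Q -/m in P1.
(* Recentring at the mean over the quarter costs a factor 2 on the bound 4 h^2. This is paid by the
   integral of |f - c|, at least 4 b h^2 on a quarter whose mean is more than 4 b away from c. *)
apply: (@le_trans _ _ (8 * h ^+ 2)).
  apply: (@le_trans _ _ (intA Q (fun y => 2 * expR (s * `|f y - m|)))).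
    apply: intA_le => //; first by apply: contM; [exact: cont_cst|exact: cE].
    move=> y _; apply: le_trans (_ : expR (s * `|m - c|) * expR (s * `|f y - m|) <= _).
      rewrite -expRD ler_expR -mulrDr ler_pM2l //.
      by have := ler_normD (f y - m) (m - c); rewrite addrA subrK; lra.
    by rewrite ler_wpM2r ?expR_ge0 // exp_le2.
  by rewrite intAZ //; lra.
have h1 := mean_dist c bQ cf v0; rewrite vE -/m in h1.
have h2 : 4 * b * h ^+ 2 <= intA Q (fun y => `|f y - c|).
  by apply: le_trans h1; rewrite ler_wpM2r ?exprn_ge0 // ltW.
have h3 : 8 * h ^+ 2 <= 2 / b * intA Q (fun y => `|f y - c|).
  rewrite -(ler_pM2l (_ : 0 < 2 / b)) ?divr_gt0 // in h2; apply: le_trans h2.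
  by rewrite !mulrA (_ : 2 / b * 4 * b = 8) //; field; rewrite gt_eqF.
by apply: (le_trans h3); rewrite lerDr mulr_ge0 // exprn_ge0.
Qed.

Let b58 : b + 4 * b <= 8 * b. Proof. by have := b0; lra. Qed.

Let level_fine (M d : R) (n : nat) : 0 < d ->
  (forall y z, `|y| <= M -> `|z - y| < d -> `|f z - f y| < b) ->
  forall a l, 0 < l <= L -> square a l `<=` [set y | `|y| <= M] -> l < d * 2 ^+ n -> level a l.
Proof.
move=> d0 uc; elim: n => [|n IH] a l ll sub ld.
  rewrite expr0 mulr1 in ld; have /andP[l0 lL] := ll.
  have bQ := bset_square a l; have v0 := vol_square_gt0 a l0.
  have vE : vol (square a l) = l ^+ 2 by apply: vol_square; exact: ltW.
  move=> c hc.
  have fine y : square a l y -> `|f y - mean (square a l) f| <= b.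
    move=> Qy; rewrite distrC -(ler_pM2r v0); apply: le_trans (mean_dist (f y) bQ cf v0) _.
    apply: intA_le_cst => // z Qz; apply/ltW/uc; first exact: sub.
    apply: le_lt_trans ld; move: Qy Qz => [/=]; rewrite !in_itv /= => /andP[? ?] /andP[? ?] [/=].
    rewrite !in_itv /= => /andP[? ?] /andP[? ?].
    by rewrite prod_normE ge_max /= !ler_norml; lra.
  apply: (@le_trans _ _ (2 * l ^+ 2)).
    rewrite -vE; apply: intA_le_cst => // y Qy; apply: exp_le2.
    have := ler_normD (f y - mean (square a l) f) (mean (square a l) f - c).
    rewrite addrA subrK => h; apply: (le_trans h).
    have h1 := fine _ Qy; exact: le_trans (lerD h1 hc) b58.
  by rewrite lerDl mulr_ge0 ?divr_ge0 ?(ltW b0) // intA_ge0.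
have E : l = 2 * (l / 2) by rewrite mulrC divfK.
have /andP[l0 lL] := ll; have l2 : 0 < l / 2 by rewrite divr_gt0.
rewrite E; apply: level_step => //; first by rewrite -E.
move=> i; apply: IH.
- by rewrite l2; lra.
- by move=> y /(corner_sub (ltW l2)); rewrite -E; exact: sub.
- by move: ld; rewrite exprS; lra.
Qed.

Theorem John_Nirenberg a : 0 < L ->
  intA (square a L) (fun y => expR ((16 * b)^-1 * `|f y - mean (square a L) f|)) <= 4 * L ^+ 2.
Proof.
move=> L0; have ll : 0 < L <= L by rewrite L0 lexx.
apply: level_mean => //; have [_ [M hM]] := bset_square a L.
have [d d0 uc] := uniformly_continuous_on_box M cf b0.
pose n := Num.truncn (L / d).
apply: (@level_fine M d n.+1) => //.
have h := truncnS_gt (L / d).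
rewrite mulrC -ltr_pdivrMr //; apply: (lt_le_trans h); rewrite -natrX ler_nat.
exact: ltn_trans (ltnSn _) (ltn_expl n.+1 (ltnSn 1)).
Qed.
End JohnNirenberg.

End UniformContinuityAndJohnNirenberg.

(** * Exponential moments of a function in L^alpha bmo *)

Section ExponentialMoments.
Variable R : realType.
Notation mT := (measurableTypeR R).
Implicit Types (x y a : R * R) (r l h c d : R) (A B : set (R * R)) (f g : R * R -> R).

Lemma intA_tile f h (M : R) n a : 0 <= h -> continuous f ->
  (forall b, intA (square b h) f <= M) -> intA (square a (2 ^+ n * h)) f <= 4 ^+ n * M.
Proof.
move=> h0 cf fM; elim: n a => [|n IH] a; first by rewrite !expr0 !mul1r.
rewrite exprS -mulrA intA_split //; last by rewrite mulr_ge0 // exprn_ge0.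
apply: le_trans (ler_sum _ (fun i _ => IH _)) _.
by rewrite sumr_const card_ord exprS -mulrA mulr_natl.
Qed.

Section Labmo.
Variables (f : R * R -> R) (alpha N : R).
Hypothesis cf : continuous f.
Hypothesis al0 : 0 <= alpha.
Hypothesis N0 : 0 < N.
Hypothesis oscN : forall x r, 0 < r < 1 -> (osc x r f <= (N / (- ln r) `^ alpha)%:E)%E.
Hypothesis L1N : forall x, intA (eball x 1) (fun y => `|f y|) <= N.

(* bk k bounds the mean oscillation on squares of side at most 2 ^- k, and Phi k
   the means over squares of side 2 ^- k. *)
Definition amp : R := 8 * N / ln 2 `^ alpha.
Definition bk (k : nat) : R := amp / k%:R `^ alpha.
Definition Phi (k : nat) : R := 4 * N + 4 * \sum_(1 <= j < k) bk j.

Let ln2_gt0 : 0 < ln 2 :> R. Proof. by rewrite ln_gt0 // ltr1n. Qed.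

Lemma bk_gt0 k : (0 < k)%N -> 0 < bk k.
Proof.
by move=> k0; rewrite /bk /amp !divr_gt0 ?mulr_gt0 ?powR_gt0 // ?ltr0n.
Qed.

Let side_gt0 k : 0 < 2 ^- k :> R. Proof. by rewrite invr_gt0 exprn_gt0. Qed.

Let side_half k : 2 * 2 ^- k.+1 = 2 ^- k :> R.
Proof. by rewrite exprS invfM mulVKf // pnatr_eq0. Qed.

Let side_lt1 k : (0 < k)%N -> 2 ^- k <= 2^-1 :> R.
Proof.
by case: k => // k _; rewrite lef_pV2 ?posrE ?exprn_gt0 // exprS ler_peMr // exprn_ege1 // ler1n.
Qed.

(** A side at most 2^-k means -ln l >= k ln 2; together with the 8 of [osc_square] this explains the
    value of [amp]. *)
Lemma Labmo_square k a l : (0 < k)%N -> 0 < l <= 2 ^- k ->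
  intA (square a l) (fun y => `|f y - mean (square a l) f|) <= bk k * l ^+ 2.
Proof.
move=> k0 /andP[l0 lk]; have l1 := le_trans lk (side_lt1 k0).
have ll1 : 0 < l < 1 by rewrite l0 /=; move: l1; lra.
have lnl : k%:R * ln 2 <= - ln l.
  rewrite mulr_natl -lnXn // lerNr -lnV ?posrE ?exprn_gt0 //.
  by rewrite ler_ln ?posrE.
have P : 0 < k%:R * ln 2 :> R by rewrite mulr_gt0 // ltr0n.
apply: le_trans (@osc_square R f (N / (k%:R * ln 2) `^ alpha) a l cf l0 _) _.
  apply: le_trans (oscN _ ll1) _; rewrite lee_fin ler_pM2l // lef_pV2 ?posrE ?powR_gt0 //.
    by apply: ge0_ler_powR => //; rewrite nnegrE ltW // (lt_le_trans P).
  exact: lt_le_trans lnl.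
rewrite /bk /amp powRM ?ler0n ?(ltW ln2_gt0) // le_eqVlt; apply/orP; left; apply/eqP.
by rewrite invfM; ring.
Qed.

(** A square of side 2^-(k+1) is a quarter of one of side 2^-k, and its mean differs from the larger
    one by at most 4 [bk] k. The telescoping starts at side 1/2, where the area 1/4 and the local
    L^1 bound give 4 N. *)
Lemma mean_Phi k a : (0 < k)%N -> `|mean (square a (2 ^- k)) f| <= Phi k.
Proof.
case: k => // k _; elim: k => [|k IH].
  rewrite /Phi big_geq // mulr0 addr0 expr1.
  have h0 : 0 < 2^-1 :> R by rewrite invr_gt0.
  have bQ := bset_square a (2^-1); have v0 := vol_square_gt0 a h0.
  have := mean_dist 0 bQ cf v0; rewrite subr0 vol_square ?(ltW h0) // => h.
  have h2 : intA (square a 2^-1) (fun y => `|f y - 0|) <= N.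
    apply: le_trans (L1N (centre a (2^-1))).
    have -> : (fun y => `|f y|) = (fun y => `|f y - 0|) by apply/funext => y; rewrite subr0.
    apply: intA_sub => //; first exact: bset_eball.
      move=> y /(square_eball h0); rewrite /eball /= => /lt_trans; apply.
      by rewrite invf_lt1 // ltr1n.
    by apply: cont_norm; apply: contB => //; exact: cont_cst.
  have := le_trans h h2; rewrite exprVn ler_pdivrMr ?exprn_gt0 // expr2; lra.
set m := mean _ _; set m' := mean (square a (2 ^- k.+1)) f.
have [h0 h00] := (side_gt0 k.+2, ltW (side_gt0 k.+2)).
have bQ := bset_square a (2 ^- k.+2); have v0 := vol_square_gt0 a h0.
have h1 := mean_dist m' bQ cf v0; rewrite -/m vol_square // in h1.
have cN : continuous (fun y => `|f y - m'|).
  by apply: cont_norm; apply: contB => //; exact: cont_cst.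
have := @corner_sub R a (2 ^- k.+2) ord0 h00; rewrite side_half => sub.
have h2 := intA_sub bQ (bset_square a (2 ^- k.+1)) sub cN (fun=> normr_ge0 _).
have ll := introT andP (conj (side_gt0 k.+1) (lexx (2 ^- k.+1 : R))).
have h3 := le_trans h1 (le_trans h2 (Labmo_square a (ltn0Sn k) ll)).
rewrite -(side_half k.+1) (_ : bk k.+1 * _ = 4 * bk k.+1 * 2 ^- k.+2 ^+ 2) in h3; last by ring.
rewrite ler_pM2r ?exprn_gt0 // in h3.
rewrite /Phi big_nat_recr //= mulrDr addrA -/(Phi k.+1).
have := ler_normD (m - m') m'; rewrite subrK => h4; apply: (le_trans h4).
by rewrite addrC lerD.
Qed.

Definition sig k : R := (16 * bk k)^-1.

(** John-Nirenberg is used on squares of side 2^-k, where the means are at most [Phi] k, and 4^(n+k)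
    of them tile the large square. The bound is thus proportional to the area. *)
Lemma exp_moment_square k a n : (0 < k)%N ->
  intA (square a (2 ^+ n)) (fun y => expR (sig k * `|f y|)) <= 4 * (2 ^+ n) ^+ 2 * expR (sig k * Phi k).
Proof.
move=> k0; have b0 := bk_gt0 k0.
have s0 : 0 < sig k by rewrite invr_gt0 mulr_gt0.
have h0 := side_gt0 k.
have cE c : continuous (fun y => expR (sig k * `|f y - c|)) by exact: continuous_expR_norm.
have ce : continuous (fun y => expR (sig k * `|f y|)).
  by have := cE 0; rewrite (_ : (fun y => expR (sig k * `|f y - 0|)) = (fun y => expR (sig k * `|f y|))) //; apply/funext => y; rewrite subr0.
have H b : intA (square b (2 ^- k)) (fun y => expR (sig k * `|f y|)) <= expR (sig k * Phi k) * (4 * 2 ^- k ^+ 2).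
  have JN := @John_Nirenberg R f (bk k) (2 ^- k) cf b0 (fun a l => @Labmo_square k a l k0) b h0.
  apply: le_trans (ler_wpM2l (expR_ge0 (sig k * Phi k)) JN).
  rewrite -intAZ; [|exact: bset_square|exact: cE].
  apply: intA_le => //; first exact: bset_square.
    by apply: contM; [exact: cont_cst|exact: cE].
  move=> y _; rewrite -expRD ler_expR -mulrDr ler_pM2l //.
  have := ler_normD (f y - mean (square b (2 ^- k)) f) (mean (square b (2 ^- k)) f); rewrite subrK.
  by move=> /le_trans; apply; rewrite addrC lerD // mean_Phi.
have := @intA_tile (fun y => expR (sig k * `|f y|)) (2 ^- k) _ (n + k) a (ltW h0) ce H.
rewrite exprD mulfK ?expf_neq0 ?pnatr_eq0 // => h; apply: (le_trans h).
rewrite le_eqVlt; apply/orP; left; apply/eqP.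
rewrite (_ : 4 = 2 ^+ 2); last by ring.
rewrite -!exprM mulnC exprM mulnC !exprM exprD !exprMn.
have : 2 ^+ k != 0 :> R by rewrite expf_neq0 // pnatr_eq0.
move: (2 ^+ k) (2 ^+ n) (expR _) => p q e p0.
by field.
Qed.
End Labmo.

End ExponentialMoments.

(** * Velocity bound *)

Section MomentTransport.
Variable R : realType.
Notation mT := (measurableTypeR R).
Implicit Types (x y a : R * R) (r l h c d t s : R) (A B : set (R * R)) (f g : R * R -> R).

Lemma pow2_between (K : R) : 1 <= K -> exists n : nat, K <= 2 ^+ n <= 2 * K.
Proof.
move=> K1; have H : exists n : nat, K <= 2 ^+ n.
  exists (Num.truncn K).+1; have h := truncnS_gt K.
  by apply/ltW/(lt_trans h); rewrite -natrX ltr_nat ltn_expl.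
case: (ex_minnP H) => -[|n] h1 h2; first by exists 0; rewrite h1 expr0; lra.
exists n.+1; rewrite h1 /= exprS ler_pM2l //.
by rewrite leNgt; apply/negP => /ltW /h2; rewrite ltnn.
Qed.

Lemma expr4_le_expR (z w : R) : 0 < w -> z ^+ 4 <= 24 / w ^+ 4 * expR (w * `|z|).
Proof.
move=> w0; have h := @expR_ge1Dxn R (w * `|z|) 3 (mulr_ge0 (ltW w0) (normr_ge0 _)).
have f4 : (4`!)%:R = 24 :> R by [].
rewrite f4 exprMn in h; have w4 := exprn_gt0 4 w0.
have E : `|z| ^+ 4 = z ^+ 4 by rewrite -normrX ger0_norm // exprn_even_ge0.
rewrite E in h; rewrite mulrAC ler_pdivlMr // mulrC.
move: h; move: (w ^+ 4 * z ^+ 4) (expR _) => p q; lra.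
Qed.

Section flow.
Variables (v : R * (R * R) -> R * R) (u : R -> R * R -> R * R) (u0 : R * R -> R * R).
Hypothesis sv : smooth v.
Hypothesis uv : forall t x, 0 <= t -> u t x = v (t, x).
Hypothesis sol : euler_solution u0 u.
Variables (a b : R -> R) (T : R).
Hypothesis T0 : 0 <= T.
Hypothesis da : forall s, is_derive s (1:R) a (b s).
Hypothesis cb : continuous b.
Hypothesis a0 : forall s, 0 <= a s.
Hypothesis ub : forall s x, 0 <= s <= T -> enorm (u s x) <= b s.

Let cvor t : continuous (fun x => vor v (t, x)).
Proof. exact: continuous_slice (Cn_cont (Cn_vor sv 0)). Qed.

(** The cutoff of [transport] is at least d^2 on the ball at time T, since [bracket] is at most 1 +
    rho there; at time 0 it is at most K^2 and vanishes outside the square of half-side K. *)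
Lemma transport_ball (F F' : R -> R) (K rho d : R) x0 : 0 < d -> 0 < rho ->
  (forall z : R, is_derive z (1:R) F (F' z)) -> continuous F -> continuous F' -> (forall z, 0 <= F z) ->
  a T + 1 + rho + d <= K ->
  d ^+ 2 * intA (eball x0 rho) (fun x => F (vor v (T, x))) <=
  K ^+ 2 * intA (centred_square x0 K) (fun x => F (vor v (0, x))).
Proof.
move=> d0 r0 dF cF cF' F0 hK.
have aT := a0 T; have a00 := a0 0; have K0 : 0 < K by lra.
have cFt t : continuous (fun x => F (vor v (t, x))) by move=> x; apply: (@continuous_comp _ _ _ (fun x => vor v (t, x)) F); [exact: cvor|exact: cF].
have cp (k : R) : continuous (fun x => possq (k - bracket x0 x)).
  apply: (@cont_comp _ _ _ (fun x => k - bracket x0 x)); last exact: continuous_possq.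
  by apply: contB; [exact: cont_cst|exact: continuous_bracket].
have far k x : `|x0| + `|k| < `|x| -> possq (k - bracket x0 x) = 0.
  move=> Mx; rewrite /possq ifF //; apply/negbTE; rewrite -leNgt.
  have h1 := le_trans (norm_le_enorm (x - x0)) (enorm_le_bracket x0 x).
  have h2 := ler_normD (x - x0) x0; rewrite subrK in h2.
  by have := ler_norm k; move: Mx; lra.
have ad k t : adm (fun x => F (vor v (t, x)) * possq (k - bracket x0 x)).
  apply: (@adm_compactC _ _ (`|x0| + `|k|)); first exact: contM.
  by move=> x /far ->; rewrite mulr0.
have bB := bset_eball x0 rho; have bQ : bset (centred_square x0 K) := bset_square _ _.
have E1 := int2Z (d ^+ 2) (adm_intA bB (cFt T)).
have E2 := int2Z (K ^+ 2) (adm_intA bQ (cFt 0)).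
rewrite /intA -E1 -E2 {E1 E2}.
apply: le_trans (le_trans (@transport R v u u0 sv uv sol F F' a b K T x0 T0 dF cF' F0 da cb a0 ub) _).
  apply: int2_le; [exact: admZ (adm_intA bB (cFt T))|exact: ad|] => x.
  have [[Bx ->]|[_ ->]] := indic_cases (eball x0 rho) x; last by rewrite mul0r mulr0 mulr_ge0 ?possq_ge0.
  rewrite mul1r mulrC ler_wpM2l //; have := bracket_le x0 x; move: Bx; rewrite /eball /= => Bx hj.
  have h : d <= K - a T - bracket x0 x by lra.
  by rewrite /possq (lt_le_trans d0 h) ler_sqr ?nnegrE ?(ltW d0) // (le_trans (ltW d0) h).
apply: int2_le; [exact: ad|exact: admZ (adm_intA bQ (cFt 0))|] => x.
have [[_ ->]|[nQ ->]] := indic_cases (centred_square x0 K) x.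
  rewrite mul1r mulrC ler_wpM2r // /possq; case: ltP => h; last exact: sqr_ge0.
  by rewrite ler_sqr ?nnegrE ?(ltW h) ?(ltW K0) //; have := bracket_gt0 x0 x; lra.
rewrite mul0r mulr0 /possq ifF ?mulr0 //; apply/negbTE; rewrite -leNgt.
have h : ~ enorm (x - x0) < K by move=> h; apply: nQ; exact: eball_centred_square.
by have := enorm_le_bracket x0 x; move/negP: h; rewrite -leNgt; lra.
Qed.

(** Here K = 4 rho and d = rho give 16, and a dyadic square of side at most 16 rho covers the
    initial support and gives 256: the product is 4096. *)
Lemma moment_ball (D rho : R) x0 : 0 <= D -> 1 <= rho -> a T <= rho ->
  (forall y n, intA (square y (2 ^+ n)) (fun x => vor v (0, x) ^+ 4) <= D * (2 ^+ n) ^+ 2) ->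
  intA (eball x0 rho) (fun x => vor v (T, x) ^+ 4) <= 4096 * D * rho ^+ 2.
Proof.
move=> D0 r1 ar hD; have r0 : 0 < rho by lra.
have dF (z : R) : is_derive z (1:R) (fun z => z ^+ 4) (4 * z ^+ 3).
  have d1 := is_derive_id z (1:R); have d2 := is_deriveM d1 d1; have d4 := is_deriveM d2 d2.
  have -> : (fun z : R => z ^+ 4) = id * id * (id * id) by apply/funext => w; rewrite !fctE; ring.
  by apply: is_derive_eq d4 _; rewrite /GRing.scale /= !fctE; ring.
have cF n : continuous (fun z : R => z ^+ n) by exact: exprn_continuous.
have h5 : a T + 1 + rho + rho <= 4 * rho by lra.
have h8 : 1 <= 8 * rho by lra.
have [n /andP[n1 n2]] := pow2_between h8.
have c4 : continuous (fun x => vor v (0, x) ^+ 4) by move=> x; apply: (@continuous_comp _ _ _ (fun x => vor v (0, x)) (fun z => z ^+ 4)); [exact: cvor|exact: (cF 4%N)].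
have sub : centred_square x0 (4 * rho) `<=` square (x0.1 - 4 * rho, x0.2 - 4 * rho) (2 ^+ n).
  by move=> y [/=]; rewrite !in_itv /= => /andP[? ?] /andP[? ?]; split; rewrite /= in_itv /=; lra.
have h3 : (2 ^+ n) ^+ 2 <= (16 * rho) ^+ 2 :> R by rewrite ler_sqr ?nnegrE ?exprn_ge0 //; lra.
have h1 := intA_sub (bset_square _ _) (bset_square _ _) sub c4 (fun x => @exprn_even_ge0 R 4 _ isT).
have h2 := le_trans h1 (hD _ n).
have h4 := le_trans h2 (ler_wpM2l D0 h3).
rewrite -(ler_pM2l (_ : 0 < rho ^+ 2)) ?exprn_gt0 //.
have tr := @transport_ball (fun z => z ^+ 4) (fun z => 4 * z ^+ 3) (4 * rho) rho rho x0 r0 r0 dF (cF 4%N).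
have c3 : continuous (fun z : R => 4 * z ^+ 3) by apply: contM; [exact: cont_cst|exact: (cF 3%N)].
have {}tr := tr c3 (fun z => @exprn_even_ge0 R 4 z isT).
apply: le_trans (tr h5) _; apply: le_trans (ler_wpM2l _ h4) _; first exact: sqr_ge0.
rewrite (_ : (4 * rho) ^+ 2 * _ = 4096 * (D * (rho ^+ 2) ^+ 2)); last by ring.
by rewrite (_ : rho ^+ 2 * _ = 4096 * (D * (rho ^+ 2) ^+ 2)); last by ring.
Qed.

(** Transport needs a differentiable function, so exp(s |z|) is replaced by exp(s z) + exp(-s z),
    which agrees with it up to a factor 2. With d = 2 and a dyadic side at most 4 K, the constant is
    (K^2 / 4) 2 (4 K)^2 = 8 K^4. *)
Lemma exp_ball (s M : R) x0 : 0 < s ->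
  (forall y n, intA (square y (2 ^+ n)) (fun x => expR (s * `|vor v (0, x)|)) <= M * (2 ^+ n) ^+ 2) ->
  intA (eball x0 1) (fun x => expR (s * `|vor v (T, x)|)) <= 8 * (a T + 4) ^+ 4 * M.
Proof.
move=> s0 hM; set K := a T + 4; have K0 : 1 <= 2 * K by have := a0 T; rewrite /K; lra.
have dE (k z : R) : is_derive z (1:R) (fun z => expR (k * z)) (k * expR (k * z)).
  have d1 := is_derive_homog k (is_derive_id z (1:R)).
  have d2 : is_derive z (1:R) (fun z => k * z) k.
    have d := is_deriveZ k (is_derive_id z (1:R)).
    by apply: is_derive_eq d _; rewrite /GRing.scale /= mulr1.
  have d := is_derive_comp d2 (is_derive_expR (k * z)).
  by apply: is_derive_eq d _; rewrite mulrC.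
have cE (k : R) : continuous (fun z : R => expR (k * z)).
  apply: (@cont_comp _ _ _ (fun z : R => k * z) expR); last exact: continuous_expR.
  by apply: contM; [exact: cont_cst|move=> z; exact: cvg_id].
have dF (z : R) := is_deriveD (dE s z) (dE (- s) z).
pose F z := expR (s * z) + expR (- s * z).
have F0 (z : R) : 0 <= F z by rewrite addr_ge0 ?expR_ge0.
have FE z : F z <= 2 * expR (s * `|z|).
  have h1 : expR (s * z) <= expR (s * `|z|) by rewrite ler_expR ler_pM2l // ler_norm.
  have h2 : expR (- s * z) <= expR (s * `|z|).
    by rewrite ler_expR mulNr -mulrN ler_pM2l // -normrN ler_norm.
  by rewrite /F; lra.
have EF z : expR (s * `|z|) <= F z.
  have p1 := expR_ge0 (s * z); have p2 := expR_ge0 (- s * z).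
  rewrite /F; case: (ger0P z) => _; first by rewrite lerDl.
  by rewrite mulrN -mulNr lerDr.
have cF : continuous F by apply: contD; exact: cE.
have cF' : continuous (fun z => s * expR (s * z) + - s * expR (- s * z)).
  by apply: contD; apply: contM; try exact: cont_cst; exact: cE.
have hK : a T + 1 + 1 + 2 <= K by rewrite /K; lra.
have [n /andP[n1 n2]] := pow2_between K0.
have cn t : continuous (fun x => expR (s * `|vor v (t, x)|)).
  apply: (@cont_comp _ _ _ (fun x => s * `|vor v (t, x)|) expR); last exact: continuous_expR.
  by apply: contM; [exact: cont_cst|apply: cont_norm; exact: cvor].
have cFv t : continuous (fun x => F (vor v (t, x))).
  by move=> x; apply: (@continuous_comp _ _ _ (fun x => vor v (t, x)) F); [exact: cvor|exact: cF].
have bQ : bset (centred_square x0 K) := bset_square _ _.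
have h1 : intA (centred_square x0 K) (fun x => F (vor v (0, x))) <= 2 * (M * (4 * K) ^+ 2).
  apply: (@le_trans _ _ (intA (centred_square x0 K) (fun x => 2 * expR (s * `|vor v (0, x)|)))).
    by apply: intA_le => //; apply: contM; [exact: cont_cst|exact: cn].
  rewrite intAZ // ler_pM2l //.
  have sub : centred_square x0 K `<=` square (x0.1 - K, x0.2 - K) (2 ^+ n).
    by move=> y [/=]; rewrite !in_itv /= => /andP[? ?] /andP[? ?]; split; rewrite /= in_itv /=; lra.
  have h1 := intA_sub (bset_square _ _) (bset_square _ _) sub (cn 0) (fun=> expR_ge0 _).
  have h2 := hM (x0.1 - K, x0.2 - K) n; apply: le_trans h1 (le_trans h2 _).
  have M0 : 0 <= M * (2 ^+ n) ^+ 2 by apply: le_trans h2; apply: intA_ge0 => y; exact: expR_ge0.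
  rewrite pmulr_lge0 ?exprn_gt0 // in M0; rewrite ler_wpM2l // ler_sqr ?nnegrE ?exprn_ge0 //.
    by apply: (le_trans n2); rewrite le_eqVlt; apply/orP; left; apply/eqP; ring.
  by rewrite mulr_ge0 // addr_ge0.
have h2 : intA (eball x0 1) (fun x => expR (s * `|vor v (T, x)|)) <= intA (eball x0 1) (fun x => F (vor v (T, x))).
  by apply: intA_le => //; exact: bset_eball.
have tr := @transport_ball F _ K 1 2 x0 _ _ dF cF cF' F0 hK.
have {}tr := tr (ltr0n _ 2) ltr01.
have h3 := le_trans tr (ler_wpM2l (sqr_ge0 K) h1).
rewrite (_ : K ^+ 2 * _ = 2 ^+ 2 * (8 * K ^+ 4 * M)) in h3; last by ring.
by rewrite ler_pM2l ?exprn_gt0 // in h3; exact: le_trans h2 h3.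
Qed.
End flow.

End MomentTransport.

(** * Dependence of the mollified velocity on the scale *)

Section RadialAverages.
Variable R : realType.
Notation mT := (measurableTypeR R).
Implicit Types (x y a : R * R) (r l h c d t s : R) (A B : set (R * R)) (f g : R * R -> R).

Let e i := Defs.basis R i.
Let o0 : 'I_2 := ord0.
Let o1 : 'I_2 := ord_max.

Lemma derive_dir g x y : Cn 1 g -> 'D_y g x = y.1 * 'D_(e o0) g x + y.2 * 'D_(e o1) g x.
Proof.
move=> cg; rewrite -(deriveZv x (e o0) y.1 cg) -(deriveZv x (e o1) y.2 cg) -(deriveDv x _ _ cg); congr ('D_ _ g x).
case: y => y1 y2; apply/eqP; rewrite /e /Defs.basis xpair_eqE /=; apply/andP; split; apply/eqP.
  by rewrite [y1 *: _]mulr1 scaler0 addr0.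
by rewrite [y2 *: _]mulr1 scaler0 add0r.
Qed.

Lemma derive_eta y v : 'D_v (@eta R) y = dot y v * (2 * (2 * bump 3 (dot y y) - bump 4 (dot y y))).
Proof.
have d := is_derive_comp (derive_dot y v) (is_derive_bump 2 (dot y y)).
by have [_ E] := d; apply: (etrans E); ring.
Qed.

Let ceta0 : continuous (@eta R). Proof. exact: (Cn_cont (@Cn_eta R 0)). Qed.

Let eta_far y : 1 < `|y| -> @eta R y = 0.
Proof. by move=> /dot_gt1/eta_out. Qed.

Let c1 : continuous (fun y : R * R => y.1). Proof. by move=> z; exact: cvg_fst. Qed.
Let c2 : continuous (fun y : R * R => y.2). Proof. by move=> z; exact: cvg_snd. Qed.

Lemma diff_radial g x s : Cn 1 g ->
  is_derive s (1:R) (fun r => int2 (fun y => eta y * g (aff x r y)))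
    (int2 (fun y => eta y * (y.1 * 'D_(e o0) g (aff x s y) + y.2 * 'D_(e o1) g (aff x s y)))).
Proof.
move=> cg; pose A (z : R * (R * R)) := aff x z.1 z.2.
have cA : continuous A.
  rewrite (_ : A = fun z => x + z.1 *: z.2); last by apply/funext => z; rewrite /A affE.
  move=> z; apply: cvgD; first exact: cvg_cst.
  by apply: cvgZ; [exact: cvg_fst|exact: cvg_snd].
have s2 : continuous (fun z : R * (R * R) => z.2) by move=> z; exact: cvg_snd.
have cgA f : continuous f -> continuous (fun z => f (A z)).
  by move=> cf z; apply: (@continuous_comp _ _ _ A f); [exact: cA|exact: cf].
have cz f : continuous f -> continuous (fun z : R * (R * R) => f z.2).
  by move=> cf z; apply: (@continuous_comp _ _ _ (fun z : R * (R * R) => z.2) f); [exact: s2|exact: cf].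
have cD i : continuous ('D_(e i) g) by exact: (Cn_cont (Cn_derive (e i) cg)).
apply: (@diff_int2_compact R (fun z => eta z.2 * g (A z))
  (fun z => eta z.2 * (z.2.1 * 'D_(e o0) g (A z) + z.2.2 * 'D_(e o1) g (A z))) 1 s).
- by apply: contM; [exact: cz|apply: cgA; exact: (Cn_cont cg)].
- apply: contM; first exact: cz.
  by apply: contD; apply: contM; [exact: (cz (fun y : R * R => y.1) c1)|exact: (cgA _ (cD o0))|exact: (cz (fun y : R * R => y.2) c2)|exact: (cgA _ (cD o1))].
- move=> z; have d1 : is_derive z (dt R) (fun z => eta z.2) 0.
    apply: is_derive_snd3; have := is_derive_homog 0 (Cn_is_derive z.2 (dt R).2 (@Cn_eta R 1)).
    by rewrite mul0r scale0r.
  have d2 : is_derive z (dt R) (fun z => g (A z)) ('D_(z.2) g (A z)).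
    apply: (@is_derive_affine R _ _ A z (dt R) z.2 g); last exact: (Cn_is_derive _ _ cg).
    move=> h; rewrite /A !affE /= [h *: 1]mulr1 scaler0 add0r scalerDl addrCA //.
  have d := is_deriveM d1 d2; rewrite derive_dir // in d.
  by apply: is_derive_eq d _; rewrite scaler0 addr0.
- by move=> t y /eta_far ->; rewrite mul0r.
Qed.

Let zeroB (p q : R) : p = 0 -> q = 0 -> p - q = 0.
Proof. by move=> -> ->; rewrite subrr. Qed.

(* The field (y.2, - y.1) is divergence free and tangent to the level sets of eta. *)
Lemma int2_rotation g x r : Cn 1 g -> 0 < r ->
  int2 (fun y => eta y * (y.2 * 'D_(e o0) g (aff x r y) - y.1 * 'D_(e o1) g (aff x r y))) = 0.
Proof.
move=> cg r0.
have cgA : continuous (fun y => g (aff x r y)) := Cn_cont (Cn_aff x r cg).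
have cDA i : continuous (fun y => 'D_(e i) g (aff x r y)) := Cn_cont (Cn_aff x r (Cn_derive (e i) cg)).
have cE i : continuous ('D_(e i) (@eta R)) := Cn_cont (Cn_derive (e i) (@Cn_eta R 1)).
have dE i y : is_derive y (e i) (@eta R) ('D_(e i) (@eta R) y) := Cn_is_derive y (e i) (@Cn_eta R 1).
have dg i y := @derive_aff R 0 x r g y (e i) cg.
pose F (p : R * R -> R) y := p y * (eta y * g (aff x r y)).
pose F' i (p : R * R -> R) y := p y * (eta y * (r * 'D_(e i) g (aff x r y)) + g (aff x r y) * 'D_(e i) (@eta R) y).
have main i (p : R * R -> R) : continuous p -> (forall y, is_derive y (e i) p 0) ->
    int2 (F' i p) = 0 /\ adm (F' i p).
  move=> cp dp.
  have cF' : continuous (F' i p).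
    apply: contM => //; apply: contD; apply: contM => //.
    by apply: contM => //; exact: cont_cst.
  have dF y : is_derive y (e i) (F p) (F' i p y).
    have d := is_deriveM (dp y) (is_deriveM (dE i y) (dg i y)).
    by apply: is_derive_eq d _; rewrite scaler0 addr0.
  have F0 y : 1 < `|y| -> F p y = 0 by move=> /eta_far h; rewrite /F h mul0r mulr0.
  split.
    apply: (@int2_derive_compact R (F p) (F' i p) 1 (e i)) => //.
    by apply: contM => //; apply: contM.
  apply: (@adm_compactC R _ 1) => // y y1; exact: (derive_far F0 y1 (dF y)).
have lin0 (y v : R * R) (L : R * R -> R) : (forall h z, L (h *: v + z) = L z) -> is_derive y v L 0.
  move=> hL; rewrite (_ : L = id \o L) //; apply: (@is_derive_affine R _ _ L y v 0 id 0).
    by move=> h; rewrite hL scaler0 add0r.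
have [I0 A0] : int2 (F' o0 snd) = 0 /\ adm (F' o0 snd).
  apply: main => // y; apply: lin0 => h z.
  by rewrite /e /Defs.basis /= scaler0 add0r.
have [I1 A1] : int2 (F' o1 fst) = 0 /\ adm (F' o1 fst).
  apply: main => // y; apply: lin0 => h z.
  by rewrite /e /Defs.basis /= scaler0 add0r.
have E : int2 (fun y => F' o0 snd y - F' o1 fst y) = 0.
  by transitivity (int2 (F' o0 snd) - int2 (F' o1 fst)); [exact: int2B A0 A1|exact: zeroB I0 I1].
have a3 : adm (fun y => r * (eta y * (y.2 * 'D_(e o0) g (aff x r y) - y.1 * 'D_(e o1) g (aff x r y)))).
  apply: (@adm_compactC R _ 1) => [|y /eta_far ->]; last by rewrite mul0r mulr0.
  apply: contM; first exact: cont_cst; apply: contM => //.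
  by apply: contB; apply: contM.
have E2 : int2 (fun y => r * (eta y * (y.2 * 'D_(e o0) g (aff x r y) - y.1 * 'D_(e o1) g (aff x r y)))) = 0.
  transitivity (int2 (fun y => F' o0 snd y - F' o1 fst y)); last exact: E.
  apply: eq_int2 => y; rewrite /F' !derive_eta /e /Defs.basis /dot /=.
  move: ('D__ g _) ('D__ g _) (g _) (bump _ _) (bump _ _) (eta _) => a1 a2 a4 a5 a6 a7; ring.
have E3 := @int2Z R r^-1 _ a3.
transitivity (int2 (fun y => r^-1 * (r * (eta y * (y.2 * 'D_(e o0) g (aff x r y) - y.1 * 'D_(e o1) g (aff x r y)))))).
  by apply: eq_int2 => y; rewrite mulKf // gt_eqF.
by apply: (etrans E3); move: E2 => ->; rewrite mulr0.
Qed.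

Lemma eta_bound : exists2 Ce : R, 0 < Ce & forall y, `|eta y| <= Ce.
Proof.
have [B hB] := continuous_bounded_on_compact (@compact_box R 1) ceta0.
exists (`|B| + 1) => [|y]; first by rewrite ltr_wpDl.
have [y1|y1] := ltP 1 `|y|; first by rewrite eta_far // normr0 addr_ge0.
by rewrite (le_trans (hB _ y1)) // (le_trans (ler_norm _)) // lerDl.
Qed.

Lemma enorm_affB x r y : 0 < r -> enorm (aff x r y - x) = r * enorm y.
Proof.
move=> r0; rewrite affE addrAC subrr add0r /enorm.
have -> : dot (r *: y) (r *: y) = r ^+ 2 * dot y y by rewrite /dot /= /GRing.scale /=; ring.
by rewrite sqrtrM ?sqr_ge0 // sqrtr_sqr gtr0_norm.
Qed.

Lemma intA_aff g x r : 0 < r -> continuous g ->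
  r ^+ 2 * intA (eball 0 1) (fun y => g (aff x r y)) = intA (eball x r) g.
Proof.
move=> r0 cg; have bB := bset_eball x r.
rewrite /intA -(int2_aff x r0 (adm_intA bB cg)); congr (_ * _); apply: eq_int2 => y /=.
have ball_aff : eball x r (aff x r y) <-> eball 0 1 y.
  by rewrite /eball /= subr0 enorm_affB // gtr_pMr.
by have [[p ->]|[p ->]] := indic_cases (eball 0 1) y;
  have [[p' ->]|[p' ->]] := indic_cases (eball x r) (aff x r y) => //; exfalso; tauto.
Qed.

Lemma norm_le_expr4 (z w : R) : 0 < w -> `|z| <= w + z ^+ 4 / w ^+ 3.
Proof.
move=> w0; have w3 := exprn_gt0 3 w0.
have z4 : 0 <= z ^+ 4 by exact: exprn_even_ge0.
have [zw|zw] := leP `|z| w; first by rewrite (le_trans zw) // lerDl divr_ge0 // ltW.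
apply: (@le_trans _ _ (z ^+ 4 / w ^+ 3)); last by rewrite lerDr ltW.
rewrite ler_pdivlMr // (_ : z ^+ 4 = `|z| * `|z| ^+ 3); last first.
  by rewrite -exprS -normrX ger0_norm.
by rewrite ler_pM2l ?(lt_trans w0) // lerXn2r ?nnegrE ?(ltW w0) // ltW.
Qed.

Lemma continuous_expr4 f : continuous f -> continuous (fun y => f y ^+ 4).
Proof.
move=> cf y; apply: (@continuous_comp _ _ _ f (fun z => z ^+ 4)); first exact: cf.
exact: (@exprn_continuous R 4%N).
Qed.

(** Instead of Holder's inequality, |z| <= w + z^4 / w^3 with w = sqrt(rho / r): after rescaling the
    fourth moment is at most D w^4, so both terms are of order w. The 4 bounds the area of the unit
    ball. *)
Lemma avg4_bound f x (r rho D : R) : continuous f -> 0 < r <= rho ->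
  intA (eball x rho) (fun y => f y ^+ 4) <= D * rho ^+ 2 ->
  intA (eball 0 1) (fun y => `|f (aff x r y)|) <= Num.sqrt (rho / r) * (4 + D).
Proof.
move=> cf /andP[r0 rr] hD; set w := Num.sqrt _.
have rho0 := lt_le_trans r0 rr.
have w0 : 0 < w by rewrite sqrtr_gt0 divr_gt0.
have w2 : w ^+ 2 = rho / r by rewrite sqr_sqrtr // divr_ge0 // ltW.
have c4 := continuous_expr4 cf.
have cfa : continuous (fun y => f (aff x r y)).
  by move=> y; apply: (@continuous_comp _ _ _ (aff x r) f); [exact: continuous_aff|exact: cf].
have c4a : continuous (fun y => f (aff x r y) ^+ 4) by exact: continuous_expr4.
have bB : bset (eball (0 : R * R) 1) := bset_eball 0 1.
have w3 := exprn_gt0 3 w0.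
apply: (@le_trans _ _ (intA (eball 0 1) (fun y => w + w ^- 3 * f (aff x r y) ^+ 4))).
  apply: intA_le => //; first exact: cont_norm.
    by apply: contD; [exact: cont_cst|apply: contM => //; exact: cont_cst].
  by move=> y _; rewrite mulrC; exact: norm_le_expr4.
rewrite (intAD bB (@cont_cst _ _ w) (contM (@cont_cst _ _ (w ^- 3)) c4a)) intA_cst // intAZ //.
rewrite mulrDr lerD //.
  by rewrite ler_pM2l //; have := @vol_eball_le R 0 1 ltr01; rewrite expr1n mulr1.
have Ea : r ^+ 2 * intA (eball 0 1) (fun y => f (aff x r y) ^+ 4) = intA (eball x r) (fun y => f y ^+ 4) := intA_aff x r0 c4.
rewrite mulrC ler_pdivrMr // -(ler_pM2l (exprn_gt0 2 r0)) Ea.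
have sub : eball x r `<=` eball x rho by move=> y; rewrite /eball /= => h; exact: lt_le_trans h rr.
apply: le_trans (intA_sub (bset_eball x r) (bset_eball x rho) sub c4 (fun y => @exprn_even_ge0 R 4 _ isT)) _.
apply: (le_trans hD).
have E : rho = r * w ^+ 2 by rewrite w2 mulrC divfK // gt_eqF.
by rewrite E le_eqVlt; apply/orP; left; apply/eqP; ring.
Qed.

Let alg0 (z y1 y2 p q p' q' : R) : p + q' = 0 ->
  z * (y1 * p + y2 * q) = - 1 * (z * (y2 * (p' - q))) + z * (y2 * p' - y1 * q').
Proof. by move=> h; have -> : q' = - p; [apply/eqP; rewrite -addr_eq0 addrC; apply/eqP|ring]. Qed.

Let alg1 (z y1 y2 p q p' q' : R) : p + q' = 0 ->
  z * (y1 * p' + y2 * q') = z * (y1 * (p' - q)) - z * (y2 * p - y1 * q).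
Proof. by move=> h; have -> : q' = - p; [apply/eqP; rewrite -addr_eq0 addrC; apply/eqP|ring]. Qed.

Section static.
Variables (w0 w1 : R * R -> R) (x : R * R) (rho D : R).
Hypothesis cw0 : Cn 2 w0.
Hypothesis cw1 : Cn 2 w1.
Hypothesis divw : forall y, 'D_(e o0) w0 y + 'D_(e o1) w1 y = 0.
Let om y := 'D_(e o0) w1 y - 'D_(e o1) w0 y.
Hypothesis rho0 : 0 < rho.
Hypothesis D0 : 0 <= D.
Hypothesis hD : intA (eball x rho) (fun y => om y ^+ 4) <= D * rho ^+ 2.

Let com : continuous om.
Proof. by apply: contB; [exact: (Cn_cont (Cn_derive _ cw1))|exact: (Cn_cont (Cn_derive _ cw0))]. Qed.

Variable Ce : R.
Hypothesis Ce0 : 0 < Ce.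
Hypothesis eta_le : forall y, `|@eta R y| <= Ce.

Let M := Ce * (4 + D).

Let dom (i : 'I_2) r : 0 < r <= rho ->
  `|int2 (fun y => (coor i y * eta y) * om (aff x r y))| <= M * Num.sqrt (rho / r).
Proof.
move=> rr; have /andP[r0 _] := rr.
have coma : continuous (fun y => om (aff x r y)).
  by move=> y; apply: (@continuous_comp _ _ _ (aff x r) om); [exact: continuous_aff|exact: com].
have bB : bset (eball (0 : R * R) 1) := bset_eball 0 1.
have cc : continuous (fun y : R * R => coor i y) by rewrite /coor; case: (i == ord0).
have ci : continuous (fun y => (coor i y * eta y) * om (aff x r y)).
  by apply: contM => //; apply: contM.
have ai : adm (fun y => (coor i y * eta y) * om (aff x r y)).
  by apply: (@adm_compactC R _ 1) => // y /eta_far ->; rewrite mulr0 mul0r.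
apply: le_trans (int2_norm ai) _.
have an : adm (fun y => \1_(eball 0 1) y * `|om (aff x r y)|) := adm_intA bB (cont_norm coma).
apply: (@le_trans _ _ (Ce * intA (eball 0 1) (fun y => `|om (aff x r y)|))); last first.
  by rewrite /M mulrAC -mulrA ler_pM2l // avg4_bound.
rewrite /intA -int2Z //; apply: int2_le; [exact: adm_norm|exact: admZ|].
move=> y; rewrite !normrM; have [[By ->]|[nB ->]] := indic_cases (eball 0 1) y.
  rewrite mul1r ler_wpM2r // -[leRHS]mul1r ler_pM //.
  apply: le_trans (coor_enorm i y) _; move: By; rewrite /eball /= subr0; exact: ltW.
rewrite mul0r mulr0 eta_out ?normr0 ?mulr0 ?mul0r //.
move: nB; rewrite /eball /= subr0 => /negP; rewrite -leNgt -enorm_sqr => h.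
by rewrite -[leLHS](expr1n _ 2) ler_sqr ?nnegrE // enorm_ge0.
Qed.

Let m g r := int2 (fun y => eta y * g (aff x r y)).

Let adm_eta_mul (p : R * R -> R) : continuous p -> adm (fun y => eta y * p y).
Proof.
move=> cp; apply: (@adm_compactC R _ 1); first exact: contM.
by move=> y /eta_far ->; rewrite mul0r.
Qed.

Let caff f r : continuous f -> continuous (fun y => f (aff x r y)).
Proof. by move=> cf y; apply: (@continuous_comp _ _ _ (aff x r) f); [exact: continuous_aff|exact: cf]. Qed.

Let sub0 (p q : R) : q = 0 -> p - q = p. Proof. by move=> ->; rewrite subr0. Qed.

Let add0 (p q : R) : q = 0 -> p + q = p. Proof. by move=> ->; rewrite addr0. Qed.

(** For a divergence-free field the radial derivative of [w0] is -y_2 times the vorticity plus the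
    angular derivative y_2 D_0 w1 - y_1 D_1 w1, which [int2_rotation] integrates to 0. [dm1]
    exchanges the two components. *)
Let dm0 r : 0 < r -> is_derive r (1:R) (m w0) (- int2 (fun y => (coor o1 y * eta y) * om (aff x r y))).
Proof.
move=> r0; have d := diff_radial x r (CnW cw0); apply: is_derive_eq d _.
have co := @caff om r com; have cd g i : Cn 2 g -> continuous (fun y => 'D_(e i) g (aff x r y)).
  by move=> cg; exact: (@caff ('D_(e i) g) r (Cn_cont (Cn_derive _ cg))).
have a1 : adm (fun y => - 1 * (eta y * (y.2 * om (aff x r y)))).
  by apply: admZ; exact: adm_eta_mul (contM c2 co).
have a2 : adm (fun y => eta y * (y.2 * 'D_(e o0) w1 (aff x r y) - y.1 * 'D_(e o1) w1 (aff x r y))).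
  by exact: adm_eta_mul (contB (contM c2 (cd _ o0 cw1)) (contM c1 (cd _ o1 cw1))).
transitivity (int2 (fun y => - 1 * (eta y * (y.2 * om (aff x r y))) +
   eta y * (y.2 * 'D_(e o0) w1 (aff x r y) - y.1 * 'D_(e o1) w1 (aff x r y)))).
  by apply: eq_int2 => y; exact: alg0 (divw (aff x r y)).
apply: etrans (int2D a1 a2) _; apply: etrans (add0 _ (int2_rotation x (CnW cw1) r0)) _.
apply: etrans (int2Z _ (adm_eta_mul (contM c2 co))) _; rewrite mulN1r; congr (- _).
by apply: eq_int2 => y; rewrite /coor /= mulrCA mulrA.
Qed.

Let dm1 r : 0 < r -> is_derive r (1:R) (m w1) (int2 (fun y => (coor o0 y * eta y) * om (aff x r y))).
Proof.
move=> r0; have d := diff_radial x r (CnW cw1); apply: is_derive_eq d _.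
have co := @caff om r com; have cd g i : Cn 2 g -> continuous (fun y => 'D_(e i) g (aff x r y)).
  by move=> cg; exact: (@caff ('D_(e i) g) r (Cn_cont (Cn_derive _ cg))).
have a1 := adm_eta_mul (contM c1 co).
have a2 : adm (fun y => eta y * (y.2 * 'D_(e o0) w0 (aff x r y) - y.1 * 'D_(e o1) w0 (aff x r y))).
  by exact: adm_eta_mul (contB (contM c2 (cd _ o0 cw0)) (contM c1 (cd _ o1 cw0))).
transitivity (int2 (fun y => eta y * (y.1 * om (aff x r y)) -
   eta y * (y.2 * 'D_(e o0) w0 (aff x r y) - y.1 * 'D_(e o1) w0 (aff x r y)))).
  by apply: eq_int2 => y; exact: alg1 (divw (aff x r y)).
apply: etrans (int2B a1 a2) _; apply: etrans (sub0 _ (int2_rotation x (CnW cw0) r0)) _.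
by apply: eq_int2 => y; rewrite /coor /= mulrCA mulrA.
Qed.

Let cm g : Cn 2 g -> continuous (m g).
Proof.
move=> cg s; apply: differentiable_continuous; apply/derivable1_diffP.
by have [] := diff_radial x s (CnW cg).
Qed.

(** The derivative bound blows up at r = 0, so plus or minus the average is compared with 2 M
    sqrt(rho r), a primitive of that bound which is continuous at 0. *)
Let grow g (g' : R -> R) : Cn 2 g -> (forall r, 0 < r -> is_derive r (1:R) (m g) (g' r)) ->
  (forall r, 0 < r <= rho -> `|g' r| <= M * Num.sqrt (rho / r)) -> 0 <= M ->
  `|m g 0 - m g rho| <= 2 * M * rho.
Proof.
move=> cg dg bg M0.
have key (k : R) : `|k| = 1 -> k * m g rho - 2 * M * rho <= k * m g 0.
  move=> k1; pose S r := 2 * M * Num.sqrt rho * Num.sqrt r.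
  have S0 : S 0 = 0 by rewrite /S sqrtr0 mulr0.
  have S1 : S rho = 2 * M * rho by rewrite /S -mulrA -expr2 sqr_sqrtr // ltW.
  have := @le_of_derive_le0 R (fun r => k * m g r - S r)
     (fun r => k * g' r - 2 * M * Num.sqrt rho * (2 * Num.sqrt r)^-1) 0 rho (ltW rho0).
  rewrite S0 S1 subr0; apply.
  - move=> r _; apply: cvgB; first by apply: cvgM; [exact: cvg_cst|exact: cm].
    by apply: cvgM; [exact: cvg_cst|exact: sqrt_continuous].
  - move=> r /andP[r0 _]; apply: is_deriveB.
      have d := is_deriveZ k (dg r r0); exact: d.
    have d := is_deriveZ (2 * M * Num.sqrt rho) (is_derive1_sqrt r0); exact: d.
  - move=> r /andP[r0 rr]; have r0r : 0 < r <= rho by rewrite r0 ltW.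
    rewrite subr_le0 (le_trans (ler_norm _)) // normrM k1 mul1r (le_trans (bg r r0r)) //.
    have sr : 0 < Num.sqrt r by rewrite sqrtr_gt0.
    rewrite sqrtrM ?(ltW rho0) // sqrtrV ?(ltW r0) // le_eqVlt; apply/orP; left; apply/eqP.
    by field; rewrite gt_eqF.
have k1 := key 1 (normr1 _); have k2 := key (-1) (normrN1 _).
by rewrite ler_norml; move: k1 k2; move: (m g 0) (m g rho) => p q; lra.
Qed.

(* The r-derivative of the average of u at scale r only sees the vorticity, up to a
   rotation term which vanishes; the fourth moment of the vorticity at scale rho
   bounds it by sqrt (rho / r), which is integrable. *)
Lemma radial_bound (k : 'I_2) :
  `|int2 (fun y => eta y * coor k (w0 x, w1 x)) - int2 (fun y => eta y * coor k (w0 (aff x rho y), w1 (aff x rho y)))|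
  <= 2 * (Ce * (4 + D)) * rho.
Proof.
have M0 : 0 <= M by rewrite mulr_ge0 ?(ltW Ce0) // addr_ge0.
have E g : m g 0 = int2 (fun y => eta y * g x).
  apply: eq_int2 => y; congr (_ * g _); by rewrite affE scale0r addr0.
rewrite /coor; case: (k == ord0) => /=; rewrite -E.
  apply: grow dm0 _ M0 => // r rr; rewrite normrN; exact: dom.
by apply: grow dm1 _ M0 => // r rr; exact: dom.
Qed.
End static.

End RadialAverages.

(** * Time derivative of the mollified velocity *)

Section TimeDerivative.
Variable R : realType.
Notation mT := (measurableTypeR R).
Implicit Types (x y a : R * R) (r l h c d t s : R) (A B : set (R * R)) (f g : R * R -> R) (k i : 'I_2).

Let e i := Defs.basis R i.
Let o0 : 'I_2 := ord0.
Let o1 : 'I_2 := ord_max.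

Let ceta0 : continuous (@eta R). Proof. exact: (Cn_cont (@Cn_eta R 0)). Qed.

Let eta_far y : 1 < `|y| -> @eta R y = 0.
Proof. by move=> /dot_gt1/eta_out. Qed.

Let adm_eta_mul (p : R * R -> R) : continuous p -> adm (fun y => eta y * p y).
Proof.
move=> cp; apply: (@adm_compactC R _ 1); first exact: contM.
by move=> y /eta_far ->; rewrite mul0r.
Qed.

Let cDE i : continuous ('D_(e i) (@eta R)).
Proof. exact: (Cn_cont (Cn_derive (e i) (@Cn_eta R 1))). Qed.

Let aDE i (p : R * R -> R) : continuous p -> adm (fun y => p y * 'D_(e i) (@eta R) y).
Proof.
move=> cp; apply: (@adm_compactC R _ 1); first exact: contM.
move=> y y1; rewrite (_ : 'D_(e i) _ y = 0) ?mulr0 //.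
exact: (derive_far (fun z (z1 : 1 < `|z|) => eta_far z1) y1 (Cn_is_derive y (e i) (@Cn_eta R 1))).
Qed.

Definition eta_var : R := int2 (fun y => `|'D_(e o0) (@eta R) y| + `|'D_(e o1) (@eta R) y|).

Let alg (r p0 p1 q0 q1 d0 d1 z z0 z1 g : R) : d0 + d1 = 0 ->
  r * (z * (p0 * q0 + p1 * q1)) + (p0 * g * z0 + p1 * g * z1) =
  (z * (r * (p0 * q0 + g * d0)) + p0 * g * z0) + (z * (r * (p1 * q1 + g * d1)) + p1 * g * z1).
Proof. by move=> h; have -> : d1 = - d0; [apply/eqP; rewrite -addr_eq0 addrC; apply/eqP|ring]. Qed.

Let opp_of (p q : R) : p + q = 0 -> p = - q.
Proof. by move=> /eqP; rewrite addr_eq0 => /eqP. Qed.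

Let le_eq (p q : R) : p = q -> p <= q. Proof. by move=> ->. Qed.

Let abs_le (r p q V B : R) : 0 < r -> r * p = - q -> `|q| <= B * V -> `|p| <= V * (B / r).
Proof.
move=> r0 h h2; rewrite mulrA ler_pdivlMr // -[X in _ * X](gtr0_norm r0) -normrM mulrC h normrN.
by rewrite mulrC.
Qed.

Let two (p q z z' B : R) : `|p| <= B -> `|q| <= B -> `|p * z + q * z'| <= B * (`|z| + `|z'|).
Proof.
move=> hp hq; apply: le_trans (ler_normD _ _) _.
by rewrite !normrM mulrDr lerD // ler_wpM2r.
Qed.

(** As the field is divergence free, the advection term is a divergence of products; integrating by
    parts moves the derivative to [eta] at scale r, so only the size of the products and 1 / r
    remain. *)
Lemma advection_bound (w0 w1 g : R * R -> R) x r (B : R) : 0 < r -> Cn 1 w0 -> Cn 1 w1 -> Cn 1 g ->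
  (forall y, 'D_(e o0) w0 y + 'D_(e o1) w1 y = 0) ->
  (forall y, `|w0 y * g y| <= B) -> (forall y, `|w1 y * g y| <= B) ->
  `|int2 (fun y => eta y * (w0 (aff x r y) * 'D_(e o0) g (aff x r y) + w1 (aff x r y) * 'D_(e o1) g (aff x r y)))|
  <= eta_var * (B / r).
Proof.
move=> r0 cw0 cw1 cg div B0 B1.
have ca f : continuous f -> continuous (fun y => f (aff x r y)).
  by move=> cf y; apply: (@continuous_comp _ _ _ (aff x r) f); [exact: continuous_aff|exact: cf].
have cD f i : Cn 1 f -> continuous (fun y => 'D_(e i) f (aff x r y)).
  by move=> cf; exact: (ca ('D_(e i) f) (Cn_cont (Cn_derive _ cf))).
have cA f : Cn 1 f -> continuous (fun y => f (aff x r y)) by move=> cf; exact: (ca f (Cn_cont cf)).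
have dF f i y : Cn 1 f -> is_derive y (e i) (fun y => eta y * (f (aff x r y) * g (aff x r y)))
    (eta y * (r * (f (aff x r y) * 'D_(e i) g (aff x r y) + g (aff x r y) * 'D_(e i) f (aff x r y)))
     + f (aff x r y) * g (aff x r y) * 'D_(e i) (@eta R) y).
  move=> cf; have d1 := @derive_aff R 0 x r f y (e i) cf; have d2 := @derive_aff R 0 x r g y (e i) cg.
  have d := is_deriveM (Cn_is_derive y (e i) (@Cn_eta R 1)) (is_deriveM d1 d2).
  apply: is_derive_eq d _; rewrite /GRing.scale /=.
  have -> : ((f \o aff x r) * (g \o aff x r)) y = f (aff x r y) * g (aff x r y) by [].
  by move: ('D__ _ _) ('D__ _ _) ('D__ _ _) (f _) (g _) (eta _) => p1 p2 p3 p4 p5 p6; ring.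
have cF f i : Cn 1 f -> continuous (fun y =>
    eta y * (r * (f (aff x r y) * 'D_(e i) g (aff x r y) + g (aff x r y) * 'D_(e i) f (aff x r y)))
     + f (aff x r y) * g (aff x r y) * 'D_(e i) (@eta R) y).
  move=> cf; apply: contD.
    apply: contM => //; apply: contM; first exact: cont_cst.
    by apply: contD; apply: contM; [exact: cA|exact: cD|exact: cA|exact: cD].
  by apply: contM => //; apply: contM; exact: cA.
have I f i : Cn 1 f -> int2 (fun y =>
    eta y * (r * (f (aff x r y) * 'D_(e i) g (aff x r y) + g (aff x r y) * 'D_(e i) f (aff x r y)))
     + f (aff x r y) * g (aff x r y) * 'D_(e i) (@eta R) y) = 0.
  move=> cf; apply: (@int2_derive_compact R (fun y => eta y * (f (aff x r y) * g (aff x r y))) _ 1 (e i)).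
  - by apply: contM => //; apply: contM; exact: cA.
  - exact: cF.
  - by move=> y; exact: dF.
  - by move=> y /eta_far ->; rewrite mul0r.
have aF f i : Cn 1 f -> adm (fun y =>
    eta y * (r * (f (aff x r y) * 'D_(e i) g (aff x r y) + g (aff x r y) * 'D_(e i) f (aff x r y)))
     + f (aff x r y) * g (aff x r y) * 'D_(e i) (@eta R) y).
  move=> cf; apply: admD.
    apply: adm_eta_mul; apply: contM; first exact: cont_cst.
    by apply: contD; apply: contM; [exact: cA|exact: cD|exact: cA|exact: cD].
  by apply: aDE; apply: contM; exact: cA.
have S0 := etrans (int2D (aF _ o0 cw0) (aF _ o1 cw1)) (f_equal2 +%R (I _ o0 cw0) (I _ o1 cw1)).
rewrite addr0 in S0.
have a1 : adm (fun y => eta y * (w0 (aff x r y) * 'D_(e o0) g (aff x r y) + w1 (aff x r y) * 'D_(e o1) g (aff x r y))).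
  by apply: adm_eta_mul; apply: contD; apply: contM; [exact: cA|exact: cD|exact: cA|exact: cD].
have a2 : adm (fun y => w0 (aff x r y) * g (aff x r y) * 'D_(e o0) (@eta R) y +
                 w1 (aff x r y) * g (aff x r y) * 'D_(e o1) (@eta R) y).
  by apply: admD; apply: aDE; apply: contM; exact: cA.
have E := etrans (esym (int2D (admZ r a1) a2)) (etrans (eq_int2 (fun y => alg _ _ _ _ _ _ _ _ _ (div (aff x r y)))) S0).
have E2 := etrans (esym (int2Z r a1)) (opp_of E).
have a3 : adm (fun y => `|'D_(e o0) (@eta R) y| + `|'D_(e o1) (@eta R) y|).
  have h i : adm (fun y => `|'D_(e i) (@eta R) y|).
    have := adm_norm (aDE i (@cont_cst R _ 1)); rewrite (_ : (fun y => `|1 * _|) = (fun y => `|'D_(e i) (@eta R) y|)) //.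
    by apply/funext => y; rewrite mul1r.
  exact: admD.
have E3 := int2Z B a3.
apply: (abs_le r0 E2); apply: le_trans (int2_norm a2) _; apply: le_trans (le_eq E3); apply: int2_le.
- exact: adm_norm.
- exact: admZ.
by move=> y; exact: (two _ _ (B0 (aff x r y)) (B1 (aff x r y))).
Qed.

Lemma Cn_slice n (f : R * (R * R) -> R) t : Cn n f -> Cn n (fun x => f (t, x)).
Proof.
apply: (@Cn_affine R _ _ n (fun x => (t, x)) (fun x => (0, x))).
  by move=> x; apply: continuous_pair; [exact: cvg_cst|exact: cvg_id].
by move=> h p q; congr pair; rewrite /= scaler0 add0r.
Qed.

Lemma Cn_vel_slice v n k t : smooth v -> Cn n (fun x => velocity v k (t, x)).
Proof. by move=> sv; apply: (@Cn_slice n (velocity v k) t); exact: Cn_vel. Qed.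

Lemma derive_vel_slice v k i t x : smooth v -> 'D_(e i) (fun x => velocity v k (t, x)) x = 'D_(dx (e i)) (velocity v k) (t, x).
Proof.
move=> sv; apply: derive_val; apply: derive_slice; exact: (Cn_is_derive _ _ (Cn_vel sv 1 k)).
Qed.

Definition mollified v k x r t : R := int2 (fun y => eta y * velocity v k (t, aff x r y)).
Definition dmollified v k x r t : R := int2 (fun y => eta y * 'D_(dt R) (velocity v k) (t, aff x r y)).

Lemma is_derive_mollified v k x r t : smooth v -> is_derive t (1:R) (mollified v k x r) (dmollified v k x r t).
Proof.
move=> sv; pose A (z : R * (R * R)) : R * (R * R) := (z.1, aff x r z.2).
have s2 : continuous (fun z : R * (R * R) => z.2) by move=> z; exact: cvg_snd.
have cA : continuous A.
  move=> z; apply: continuous_pair; first exact: cvg_fst.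
  by apply: (@continuous_comp _ _ _ (fun z : R * (R * R) => z.2) (aff x r)); [exact: s2|exact: continuous_aff].
have cAf (f : R * (R * R) -> R) : continuous f -> continuous (fun z => f (A z)).
  by move=> cf z; apply: (@continuous_comp _ _ _ A f); [exact: cA|exact: cf].
have ce2 : continuous (fun z : R * (R * R) => eta z.2).
  by move=> z; apply: (@continuous_comp _ _ _ (fun z : R * (R * R) => z.2) (@eta R)); [exact: s2|exact: ceta0].
apply: (@diff_int2_compact R (fun z => eta z.2 * velocity v k (A z)) (fun z => eta z.2 * 'D_(dt R) (velocity v k) (A z)) 1 t).
- by apply: contM => //; apply: cAf; exact: (Cn_cont (Cn_vel sv 0 k)).
- by apply: contM => //; apply: (cAf ('D_(dt R) (velocity v k))); exact: (Cn_cont (Cn_derive _ (Cn_vel sv 1 k))).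
- move=> z; have d1 : is_derive z (dt R) (fun z => eta z.2) 0.
    apply: is_derive_snd3; have := is_derive_homog 0 (Cn_is_derive z.2 (dt R).2 (@Cn_eta R 1)).
    by rewrite mul0r scale0r.
  have d2 : is_derive z (dt R) (fun z => velocity v k (A z)) ('D_(dt R) (velocity v k) (A z)).
    apply: (@is_derive_affine R _ _ A z (dt R) (dt R) (velocity v k)); last exact: (Cn_is_derive _ _ (Cn_vel sv 1 k)).
    by move=> h; rewrite /A /dt !affE /= !scaler0 !add0r; congr pair; rewrite /= scaler0 add0r.
  have d := is_deriveM d1 d2.
  by apply: is_derive_eq d _; rewrite scaler0 addr0.
- by move=> s y /eta_far ->; rewrite mul0r.
Qed.

Let alg3 (z p q0 d0 q1 d1 : R) :
  - 1 * (z * - (p + (q0 * d0 + q1 * d1)) + z * (q0 * d0 + q1 * d1)) = z * p.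
Proof. ring. Qed.

Lemma dmollified_bound : exists2 Cq : R, 0 <= Cq & forall v u u0 (sv : smooth v)
    (uv : forall t x, 0 <= t -> u t x = v (t, x)) (sol : euler_solution u0 u) k x r t U,
  0 < r -> 0 < t -> (forall z, enorm (u t z) <= U) -> `|dmollified v k x r t| <= Cq * (U ^+ 2 / r).
Proof.
have [Cp [Cp0 hCp]] := @pressure_bound R.
have ev0 : 0 <= eta_var by apply: int2_ge0 => y; rewrite addr_ge0.
exists (Cp + eta_var) => [|v u u0 sv uv sol k x r t U r0 t0 hU]; first by rewrite addr_ge0.
have [P hP] := momentum sv uv sol; have [sP rP mP] := hP t t0.
pose w i x := velocity v i (t, x).
have cw n i : Cn n (w i) by exact: Cn_vel_slice.
have ca f : continuous f -> continuous (fun y => f (aff x r y)).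
  by move=> cf y; apply: (@continuous_comp _ _ _ (aff x r) f); [exact: continuous_aff|exact: cf].
have cpP : continuous (pd k (P t)) := Cn_cont (Cn_derive (e k) (sP 1%N)).
have cut : continuous (u t).
  rewrite (_ : u t = fun x => v (t, x)); last by apply/funext => z; rewrite uv // ltW.
  exact: continuous_slice (Cn_cont (sv 0%N)).
have pb := hCp (u t) (P t) U r k x r0 rP cut hU.
have ap : adm (fun z => pd k (P t) z * eta_at x r z).
  apply: (@adm_compactC R _ (`|x| + r)).
    apply: contM => //; apply: contM; first exact: cont_cst.
    by move=> z; apply: (@continuous_comp _ _ _ (aff (- (r^-1 *: x)) r^-1) (@eta R)); [exact: continuous_aff|exact: ceta0].
  move=> z zx; rewrite /eta_at eta_far ?mulr0 // affE addrC -scalerBr normrZ gtr0_norm ?invr_gt0 //.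
  rewrite ltr_pdivlMl // mulr1; have := ler_normD (z - x) x; rewrite subrK; lra.
have E1 := @int2_eta_at R x r (pd k (P t)) r0 ap.
have U0 : 0 <= U by apply: le_trans (hU x); exact: enorm_ge0.
have wU i y : `|w i y| <= U.
  by apply: le_trans (coor_enorm i (v (t, y))) _; rewrite -uv ?(ltW t0) //; exact: hU.
have wwU i j y : `|w i y * w j y| <= U ^+ 2 by rewrite normrM expr2 ler_pM.
have dw i j y : 'D_(e i) (w j) y = 'D_(dx (e i)) (velocity v j) (t, y) by exact: derive_vel_slice.
have divw y : 'D_(e o0) (w o0) y + 'D_(e o1) (w o1) y = 0.
  by rewrite !dw; exact: (div_vel sv uv sol y (ltW t0)).
have ab := @advection_bound (w o0) (w o1) (w k) x r (U ^+ 2) r0 (cw 1%N o0) (cw 1%N o1) (cw 1%N k) divw (wwU o0 k) (wwU o1 k).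
have cD i j : continuous (fun y => 'D_(e i) (w j) (aff x r y)).
  by exact: (ca ('D_(e i) (w j)) (Cn_cont (Cn_derive _ (cw 1%N j)))).
have cA j : continuous (fun y => w j (aff x r y)) by exact: (ca (w j) (Cn_cont (cw 0%N j))).
have a1 : adm (fun y => eta y * pd k (P t) (aff x r y)).
  by apply: adm_eta_mul; exact: ca.
have a2 : adm (fun y => eta y * (w o0 (aff x r y) * 'D_(e o0) (w k) (aff x r y) + w o1 (aff x r y) * 'D_(e o1) (w k) (aff x r y))).
  by apply: adm_eta_mul; apply: contD; apply: contM; [exact: cA|exact: cD|exact: cA|exact: cD].
have E : dmollified v k x r t = - (int2 (fun y => eta y * pd k (P t) (aff x r y)) +
   int2 (fun y => eta y * (w o0 (aff x r y) * 'D_(e o0) (w k) (aff x r y) + w o1 (aff x r y) * 'D_(e o1) (w k) (aff x r y)))).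
  have E2 := int2Z (-1) (admD a1 a2).
  apply: etrans (esym _) (etrans E2 (etrans (mulN1r _) (congr1 -%R (int2D a1 a2)))).
  apply: eq_int2 => y; rewrite mP !dw; exact: alg3.
have E3 : int2 (fun y => eta y * pd k (P t) (aff x r y)) = int2 (fun z => pd k (P t) z * eta_at x r z).
  by apply: etrans (eq_int2 (fun y => mulrC _ _)) (esym E1).
rewrite E E3 normrN mulrDl; exact: le_trans (ler_normD _ _) (lerD pb ab).
Qed.

End TimeDerivative.

(** * The bootstrap on the velocity *)

Section VelocityBound.
Variable R : realType.
Notation mT := (measurableTypeR R).
Implicit Types (x y a : R * R) (r l h c d t s : R) (A B : set (R * R)) (f g : R * R -> R) (k i : 'I_2).

Let e i := Defs.basis R i.
Let o0 : 'I_2 := ord0.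
Let o1 : 'I_2 := ord_max.

Lemma is_derive_expR_lin (c B s : R) : is_derive s (1:R) (fun s => c * expR (B * s)) (c * (B * expR (B * s))).
Proof.
have d2 : is_derive s (1:R) (fun z => B * z) B.
  have d := is_deriveZ B (is_derive_id s (1:R)).
  by apply: is_derive_eq d _; rewrite /GRing.scale /= mulr1.
have d := is_deriveZ c (is_derive_comp d2 (is_derive_expR (B * s))).
by apply: is_derive_eq d _; rewrite /GRing.scale /= [B * expR _]mulrC.
Qed.

Lemma expR_sq (B s : R) : expR (2 * B * s) = expR (B * s) ^+ 2.
Proof. by rewrite expr2 -expRD; congr expR; ring. Qed.

Lemma continuous_expR_lin (c B : R) : continuous (fun s => c * expR (B * s)).
Proof.
move=> s; apply: differentiable_continuous; apply/derivable1_diffP.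
by have [] := is_derive_expR_lin c B s.
Qed.

Lemma enorm_le_coor x (p : R) : (forall k, `|coor k x| <= p) -> enorm x <= 2 * p.
Proof.
move=> h; have h0 := h o0; have h1 := h o1; rewrite /coor /= in h0 h1.
have p0 := le_trans (normr_ge0 _) h0.
have sq (z : R) : `|z| <= p -> z * z <= p ^+ 2.
  by move=> zp; rewrite -expr2 -(@real_normK _ z) ?num_real // ler_sqr ?nnegrE.
have d : dot x x <= (2 * p) ^+ 2.
  apply: le_trans (lerD (sq _ h0) (sq _ h1)) _; rewrite exprMn.
  by have := sqr_ge0 p; move: (p ^+ 2) => q; lra.
rewrite /enorm; apply: le_trans (ler_wsqrtr d) _.
by rewrite sqrtr_sqr ger0_norm // mulr_ge0.
Qed.

Section step.
Variables (Ce Cq D K0 U0 : R).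
Hypothesis Ce0 : 0 < Ce.
Hypothesis eta_le : forall y, `|@eta R y| <= Ce.
Hypothesis Cq0 : 0 <= Cq.
Hypothesis D0 : 0 <= D.
Hypothesis K00 : 0 <= K0.
Hypothesis K0E : K0 = 4096 * D.
Hypothesis U00 : 0 <= U0.
Hypothesis dq : forall v u u0 (sv : smooth v)
    (uv : forall t x, 0 <= t -> u t x = v (t, x)) (sol : euler_solution u0 u) k x r t U,
  0 < r -> 0 < t -> (forall z, enorm (u t z) <= U) -> `|dmollified v k x r t| <= Cq * (U ^+ 2 / r).

Let M : R := 2 * (Ce * (4 + K0)).
(* The averages are taken at scale 1 + ka W exp(rate t); ka and rate make the two
   error terms of alg_step at most W exp(rate t) / 4 each. *)
Let ka : R := ceta R / (8 * (M + 1)).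
Definition rate : R := ka^-1 + 4 * Cq / (ceta R * ka).
Definition base : R := 2 / ceta R * (M + ceta R * U0).

Let c0 := ceta_gt0 R.
Let M0 : 0 < M. Proof. by rewrite !mulr_gt0 // ltr_wpDr. Qed.
Let ka0 : 0 < ka. Proof. by rewrite divr_gt0 // mulr_gt0 // addr_gt0. Qed.
Let quot_ge0 : 0 <= 4 * Cq / (ceta R * ka).
Proof. by apply: divr_ge0; apply: mulr_ge0 => //; exact: ltW. Qed.
Lemma rate_gt0 : 0 < rate.
Proof. by rewrite /rate ltr_wpDr ?invr_gt0. Qed.
Lemma base_gt0 : 0 < base.
Proof. by rewrite mulr_gt0 ?divr_gt0 // ltr_wpDr // mulr_ge0 // ltW. Qed.

Let B := rate.

Variables (v : R * (R * R) -> R * R) (u : R -> R * R -> R * R) (u0 : R * R -> R * R).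
Hypothesis sv : smooth v.
Hypothesis uv : forall t x, 0 <= t -> u t x = v (t, x).
Hypothesis sol : euler_solution u0 u.
Hypothesis hU0 : forall x, enorm (u0 x) <= U0.
Hypothesis hD : forall y n, intA (square y (2 ^+ n)) (fun x => vor v (0, x) ^+ 4) <= D * (2 ^+ n) ^+ 2.

Let alg_step (c Mx k W E bb q U : R) : 0 < c -> 0 < k -> 0 < bb -> 0 <= Mx -> k = c / (8 * (Mx + 1)) ->
   bb = k^-1 + 4 * q / (c * k) -> 0 <= q -> 0 <= W * E ->
   2 / c * (Mx * (1 + k * (W * E)) + (c * U + q * (W * E) / (2 * bb * k))) <=
   2 / c * (Mx + c * U) + W * E / 2.
Proof.
move=> c0' k0 b0 Mx0 hk hb q0 WE; set z := W * E.
have h1 : 2 / c * (Mx * k) <= 4^-1.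
  rewrite hk ; have Mx1 : 0 < Mx + 1 by lra.
  rewrite (_ : 2 / c * _ = Mx / (4 * (Mx + 1))); last by field; rewrite !gt_eqF.
  by rewrite ler_pdivrMr ?mulr_gt0 //; lra.
have h2 : 2 / c * (q / (2 * bb * k)) <= 4^-1.
  rewrite (_ : 2 / c * _ = q / (c * k) / bb); last by field; rewrite !gt_eqF.
  have : 4 * q / (c * k) <= bb by rewrite hb lerDr invr_ge0 ltW.
  by rewrite -mulrA => h; rewrite ler_pdivrMr //; lra.
have -> : 2 / c * (Mx * (1 + k * z) + (c * U + q * z / (2 * bb * k))) =
  2 / c * (Mx + c * U) + (2 / c * (Mx * k) + 2 / c * (q / (2 * bb * k))) * z by ring.
rewrite lerD2l; have : (2 / c * (Mx * k) + 2 / c * (q / (2 * bb * k))) * z <= (4^-1 + 4^-1) * z.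
  by rewrite ler_wpM2r // lerD.
by move=> h; apply: (le_trans h); lra.
Qed.

Let abs_two (p q P Q C E : R) : 1 * p - P <= 1 * q - Q -> -1 * p - P <= -1 * q - Q -> 0 <= Q ->
  P <= E -> `|q| <= C -> `|p| <= C + E.
Proof. by rewrite !ler_norml => ? ? ? ? /andP[? ?]; apply/andP; split; lra. Qed.

(** One turn of the bootstrap. The error terms are proportional to the scale r and to the time
    integral of |u|^2 / r; exponential growth at a large [rate] and a scale proportional to the
    current size make each of them a small multiple of W exp(B t), apart from a constant. *)
Lemma velocity_step (T W : R) : 0 <= T -> 0 < W ->
  (forall s x, 0 <= s <= T -> enorm (u s x) <= W * expR (B * s)) ->
  forall t x, 0 <= t <= T -> enorm (u t x) <= base + W * expR (B * t) / 2.
Proof.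
move=> T0 W0 hW t x /andP[t0 tT]; have B0 : 0 < B := rate_gt0.
pose b s := W * expR (B * s); pose a s := W / B * expR (B * s).
have da s : is_derive s (1:R) a (b s).
  apply: is_derive_eq (is_derive_expR_lin (W / B) B s) _.
  by rewrite /b mulrA divfK // gt_eqF.
have cb : continuous b := @continuous_expR_lin W B.
have a0 s : 0 <= a s by rewrite mulr_ge0 ?expR_ge0 // divr_ge0 // ltW.
have hb s z : 0 <= s <= t -> enorm (u s z) <= b s.
  by move=> /andP[s0 st]; apply: hW; rewrite s0 (le_trans st).
set z := W * expR (B * t).
have z0 : 0 < z by rewrite mulr_gt0 ?expR_gt0.
(* The scale is frozen at the final time t. It is at least 1 and at least a(t), the bound on the
   distance travelled, because 1 / B <= [ka]: both are needed by [moment_ball]. *)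
pose r := 1 + ka * z.
have r1 : 1 <= r by rewrite lerDl mulr_ge0 // ltW.
have r0 : 0 < r by exact: lt_le_trans ltr01 r1.
have kB : ka^-1 <= B by rewrite /B /rate lerDl.
have Bk : B^-1 <= ka by rewrite -[leRHS]invrK lef_pV2 ?posrE ?invr_gt0.
have ar : a t <= r.
  rewrite /a /r mulrAC -/z (le_trans (_ : _ <= ka * z)) ?lerDr //.
  by rewrite mulrC ler_pM2r.
have mb := @moment_ball R v u u0 sv uv sol a b t t0 da cb a0 hb D r x D0 r1 ar hD; rewrite -K0E in mb.
have cw n k : Cn n (fun y => velocity v k (t, y)) by exact: Cn_vel_slice.
have dw i j y : 'D_(e i) (fun y => velocity v j (t, y)) y = 'D_(dx (e i)) (velocity v j) (t, y).
  exact: derive_vel_slice.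
have divw y : 'D_(e o0) (fun y => velocity v o0 (t, y)) y + 'D_(e o1) (fun y => velocity v o1 (t, y)) y = 0.
  by rewrite !dw; exact: (div_vel sv uv sol y t0).
have mb' : intA (eball x r) (fun y => ('D_(e o0) (fun y => velocity v o1 (t, y)) y - 'D_(e o1) (fun y => velocity v o0 (t, y)) y) ^+ 4)
     <= K0 * r ^+ 2.
  apply: le_trans mb; rewrite le_eqVlt; apply/orP; left; apply/eqP.
  by apply: eq_int2 => y; rewrite !dw.
have rb k := @radial_bound R _ _ x r K0 (cw 2%N o0) (cw 2%N o1) divw r0 K00 mb' Ce Ce0 eta_le k.
have E0 k : int2 (fun y => eta y * coor k (velocity v o0 (t, x), velocity v o1 (t, x))) = ceta R * velocity v k (t, x).
  rewrite [RHS]mulrC -(int2Z _ (adm_eta R)); apply: eq_int2 => y; by rewrite mulrC; congr (_ * _); rewrite /velocity /coor; case: (eqVneq k ord0).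
have E1 k : int2 (fun y => eta y * coor k (velocity v o0 (t, aff x r y), velocity v o1 (t, aff x r y))) = mollified v k x r t.
  by apply: eq_int2 => y; rewrite /velocity /coor; case: (eqVneq k ord0).
have m0 k : `|mollified v k x r 0| <= ceta R * U0.
  rewrite /mollified; have cv : continuous (fun y => eta y * velocity v k (0, aff x r y)).
    apply: contM; first exact: (Cn_cont (@Cn_eta R 0)).
    exact: (Cn_cont (Cn_aff x r (Cn_vel_slice 0 k 0 sv))).
  have av : adm (fun y => eta y * velocity v k (0, aff x r y)).
    by apply: (@adm_compactC R _ 1) => // y /dot_gt1/eta_out ->; rewrite mul0r.
  apply: le_trans (int2_norm av) _; rewrite mulrC -(int2Z _ (adm_eta R)).
  apply: int2_le; [exact: adm_norm|exact: admZ (adm_eta R)|] => y.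
  rewrite normrM (ger0_norm (eta_ge0 y)) mulrC ler_wpM2r ?eta_ge0 //.
  apply: le_trans (coor_enorm k _) _; rewrite -uv // (euler_init sol); exact: hU0.
have mt k : `|mollified v k x r t| <= ceta R * U0 + Cq * z / (2 * B * ka).
  (* A primitive of the bound Cq b(s)^2 / r on the time derivative. At s = t one factor W exp(B t)
     is absorbed by r >= [ka] W exp(B t), which makes a quadratic quantity linear in W. *)
  pose S s := Cq * W ^+ 2 / r / (2 * B) * expR (2 * B * s).
  have S0 s : 0 <= S s.
    apply: mulr_ge0; last exact: expR_ge0.
    apply: divr_ge0; last by apply: mulr_ge0 => //; exact: ltW.
    by apply: divr_ge0; [apply: mulr_ge0 => //; exact: sqr_ge0|exact: ltW].
  have St : S t <= Cq * z / (2 * B * ka).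
    rewrite /S (expR_sq B t) (_ : Cq * W ^+ 2 / r / (2 * B) * _ = Cq * z / (2 * B) * (z / r)); last by rewrite /z; ring.
    rewrite (_ : Cq * z / (2 * B * ka) = Cq * z / (2 * B) * ka^-1); last by rewrite invfM; ring.
    have z2 : 0 <= Cq * z / (2 * B) by apply: divr_ge0; apply: mulr_ge0 => //; exact: ltW.
    by apply: ler_wpM2l => //; rewrite ler_pdivrMr // ler_pdivlMl // /r lerDr.
  have key (q : R) : `|q| = 1 -> q * mollified v k x r t - S t <= q * mollified v k x r 0 - S 0.
    move=> q1; apply: (@le_of_derive_le0 R (fun s => q * mollified v k x r s - S s)
      (fun s => q * dmollified v k x r s - Cq * W ^+ 2 / r * expR (2 * B * s)) 0 t t0).
    - move=> s _; apply: cvgB; last exact: continuous_expR_lin.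
      apply: cvgM; first exact: cvg_cst.
      apply: differentiable_continuous; apply/derivable1_diffP.
      by have [] := is_derive_mollified k x r s sv.
    - move=> s _; apply: is_deriveB; first exact: (is_deriveZ q (is_derive_mollified k x r s sv)).
      apply: is_derive_eq (is_derive_expR_lin _ (2 * B) s) _.
      by rewrite mulrA divfK // gt_eqF // mulr_gt0.
    - move=> s /andP[s0 st]; rewrite subr_le0 (le_trans (ler_norm _)) // normrM q1 mul1r.
      have hs y : enorm (u s y) <= b s by apply: hb; rewrite !ltW.
      apply: le_trans (dq sv uv sol k x r0 s0 hs) _; rewrite le_eqVlt; apply/orP; left; apply/eqP.
      by rewrite /b exprMn (expR_sq B s); ring.
  have k1 := key 1 (normr1 _); have k2 := key (-1) (normrN1 _).
  exact: (abs_two k1 k2 (S0 0) St (m0 k)).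
have fin k : `|coor k (u t x)| <= (ceta R)^-1 * (M * r + (ceta R * U0 + Cq * z / (2 * B * ka))).
  rewrite ler_pdivlMl // -[X in X * _](gtr0_norm c0) -normrM.
  have := rb k; rewrite E0 E1 -/M => h; have h2 := mt k; rewrite uv //.
  have := ler_normD (ceta R * velocity v k (t, x) - mollified v k x r t) (mollified v k x r t); rewrite subrK => h3.
  by apply: (le_trans h3); rewrite lerD.
apply: le_trans (enorm_le_coor fin) _; rewrite mulrA.
have := @alg_step (ceta R) M ka W (expR (B * t)) B Cq U0 c0 ka0 B0 (ltW M0) erefl erefl Cq0 (ltW z0).
exact.
Qed.

(** The supremum of |u| exp(-B s) over times up to t is finite by [euler_bounded]; [velocity_step]
    bounds it by [base] plus half of itself. The local bound M1 does not enter the result. *)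
Lemma velocity_uniform t x : 0 <= t -> enorm (u t x) <= 2 * base * expR (rate * t).
Proof.
move=> t0; have b0 := base_gt0.
have [M1 hM] := euler_bounded sol t0.
pose E := [set z : R | exists2 p : R * (R * R), 0 <= p.1 <= t & z = enorm (u p.1 p.2) * expR (- (B * p.1))].
have Eub (W : R) : (forall s y, 0 <= s <= t -> enorm (u s y) <= W * expR (B * s)) -> ubound E W.
  move=> hW z [p hp ->]; have := hW p.1 p.2 hp.
  by rewrite expRN ler_pdivrMr ?expR_gt0.
have E0 : has_sup E.
  split.
    by exists (enorm (u 0 x) * expR (- (B * 0))); exists (0, x) => //=; rewrite lexx.
  exists `|M1|; apply: Eub => s y hs; apply: le_trans (hM s y hs) _.
  rewrite (le_trans (ler_norm _)) // ler_peMr // -expR0 ler_expR.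
  by have /andP[s0 _] := hs; rewrite mulr_ge0 // ltW // rate_gt0.
have Ele (W : R) : sup E <= W -> forall s y, 0 <= s <= t -> enorm (u s y) <= W * expR (B * s).
  move=> EW s y hs; rewrite -ler_pdivrMr ?expR_gt0 // -expRN; apply: le_trans EW.
  by apply: ub_le_sup => //; [exact: E0.2|exists (s, y)].
have step (W : R) : 0 < W -> sup E <= W -> sup E <= base + W / 2.
  move=> W0 EW; apply: ge_sup; first exact: E0.1.
  apply: Eub => s y hs; apply: le_trans (velocity_step t0 W0 (Ele W EW) y hs) _.
  have e1 : 1 <= expR (B * s).
    by rewrite -expR0 ler_expR; have /andP[s0 _] := hs; rewrite mulr_ge0 // ltW // rate_gt0.
  by move: e1 b0; move: (expR _) base => p q; nra.
have W2 : sup E <= 2 * base.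
  have [h|h] := leP (sup E) base; first by lra.
  by have := step (sup E) (lt_trans b0 h) (lexx _); lra.
by apply: (Ele _ W2); rewrite t0 lexx.
Qed.
End step.

(** The order of the quantifiers is the point: the two constants depend on the size of the data
    alone and serve every solution. *)
Theorem velocity_bound (D U0 : R) : 0 <= D -> 0 <= U0 -> exists2 AB : R * R, 0 < AB.1 /\ 0 < AB.2 &
  forall v u u0, smooth v -> (forall t x, 0 <= t -> u t x = v (t, x)) -> euler_solution u0 u ->
  (forall x, enorm (u0 x) <= U0) ->
  (forall y n, intA (square y (2 ^+ n)) (fun x => vor v (0, x) ^+ 4) <= D * (2 ^+ n) ^+ 2) ->
  forall t x, 0 <= t -> enorm (u t x) <= AB.1 * expR (AB.2 * t).
Proof.
move=> D0 U00; have [Ce Ce0 hCe] := @eta_bound R; have [Cq Cq0 hCq] := dmollified_bound R.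
have K00 : 0 <= 4096 * D := mulr_ge0 (ler0n _ _) D0.
exists (2 * base Ce (4096 * D) U0, rate Ce Cq (4096 * D)) => /=.
  split; first by rewrite mulr_gt0 // base_gt0.
  exact: rate_gt0.
move=> v u u0 sv uv sol hU hD t x t0.
exact: (velocity_uniform Ce0 hCe Cq0 D0 K00 erefl U00 hCq sv uv sol hU hD).
Qed.

End VelocityBound.

(** * Norms of the vorticity at time t *)

Section VorticityNorms.
Variable R : realType.
Notation mT := (measurableTypeR R).
Implicit Types (x y a : R * R) (r l h c d t s : R) (A B : set (R * R)) (f g : R * R -> R).

Let alg_a (q q' z p : R) : q + q * (p * (2^-1 * z)) <= q * q' -> p / 2 * (q * z) <= q * q' - q.
Proof. lra. Qed.

Let alg_b (b z z' c n : R) : 4 * b <= c * (z' - z) -> z <= z' -> 0 < n ->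
  (4 * n + c) * z + 4 * b <= (4 * n + c) * z'.
Proof. by move=> h m n0; have := ler_wpM2l (ltW n0) m; lra. Qed.

Let alg_c (n b z z' w : R) : b * (2^-1 * w) <= b * (z' - z) ->
  4 * n + 8 * b * z + 4 * (b * w) <= 4 * n + 8 * b * z'.
Proof. lra. Qed.

Lemma ln_succ (k : nat) : (0 < k)%N -> (2 * k%:R)^-1 <= ln k.+1%:R - ln k%:R :> R.
Proof.
move=> k0; have k1 : 1 <= k%:R :> R by rewrite ler1n.
have kp : 0 < k%:R :> R by rewrite ltr0n.
have K1 : 0 < k.+1%:R :> R by rewrite ltr0n.
have E : 1 + - (k.+1%:R)^-1 = k%:R / k.+1%:R :> R.
  by rewrite -natr1 in K1 *; field; rewrite gt_eqF.
have h0 : -1 < - (k.+1%:R)^-1 :> R by rewrite ltrN2 invf_lt1 // ltr1n ltnS.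
have h := le_ln1Dx h0; rewrite E lnM ?posrE ?invr_gt0 // lnV ?posrE // in h.
have h2 : (2 * k%:R)^-1 <= (k.+1%:R)^-1 :> R.
  by rewrite lef_pV2 ?posrE ?mulr_gt0 // -natr1; lra.
apply: le_trans h2 _; rewrite -lerN2 opprB; exact: h.
Qed.

Section sums.
Variables (alpha N : R).
Hypothesis al0 : 0 <= alpha.
Hypothesis N0 : 0 < N.
Let p := 1 - alpha.
Let am := amp alpha N.

Let ln2_gt0 : 0 < ln 2 :> R. Proof. by rewrite ln_gt0 // ltr1n. Qed.

Lemma amp_gt0 : 0 < amp alpha N.
Proof. by rewrite /amp divr_gt0 ?mulr_gt0 ?powR_gt0. Qed.

Lemma bk_le_amp k : (0 < k)%N -> bk alpha N k <= amp alpha N.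
Proof.
move=> k0; rewrite /bk ler_pdivrMr ?powR_gt0 ?ltr0n // ler_peMr ?(ltW amp_gt0) //.
have k1 : 1 <= k%:R :> R by rewrite ler1n.
by have := ler_powR k1 al0; rewrite powRr0.
Qed.

Lemma powRB1 k : (0 < k)%N -> (k%:R `^ alpha)^-1 = k%:R `^ p / k%:R :> R.
Proof.
move=> k0; have kp : 0 < k%:R :> R by rewrite ltr0n.
have k0' : k%:R != 0 :> R by rewrite gt_eqF.
by rewrite -powRN -{3}(powRr1 (ltW kp)) -powRN -powRD ?k0' ?implybT // /p; congr powR; ring.
Qed.

Lemma k_bk k : (0 < k)%N -> k%:R * bk alpha N k = amp alpha N * k%:R `^ p.
Proof.
move=> k0; have kp : 0 < k%:R :> R by rewrite ltr0n.
by rewrite /bk powRB1 // mulrCA; congr (_ * _); rewrite mulrC divfK // gt_eqF.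
Qed.

(** The sum of j^-alpha is compared with its integral: (k+1)^p - k^p >= (p / 2) k^-alpha follows
    from exp(z) >= 1 + z at z = p (ln(k+1) - ln k). The constant degenerates as p tends to 0, so
    alpha = 1 is treated apart in [Phi_ln]. *)
Lemma Phi_powR k : alpha < 1 -> (0 < k)%N -> Phi alpha N k <= (4 * N + 8 * amp alpha N / p) * k%:R `^ p.
Proof.
move=> al1; have p0 : 0 < p by rewrite subr_gt0.
have a0 := amp_gt0.
have c0 : 0 <= 8 * amp alpha N / p by apply: divr_ge0; [apply: mulr_ge0 => //|]; exact: ltW.
case: k => // k _; elim: k => [|k IH].
  by rewrite /Phi big_geq // mulr0 addr0 powR1 mulr1 lerDl.
have kp : 0 < k.+1%:R :> R by rewrite ltr0n.
rewrite /Phi big_nat_recr //= mulrDr addrA -/(Phi alpha N k.+1).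
apply: le_trans (lerD IH (lexx _)) _.
have G : p / 2 * (k.+1%:R `^ alpha)^-1 <= k.+2%:R `^ p - k.+1%:R `^ p.
  rewrite powRB1 // /powR !ifF; [|by rewrite pnatr_eq0|by rewrite pnatr_eq0].
  have h := ln_succ (ltn0Sn k).
  have e2 : expR (p * ln k.+2%:R) = expR (p * ln k.+1%:R) * expR (p * (ln k.+2%:R - ln k.+1%:R)).
    by rewrite -expRD; congr expR; ring.
  have := expR_ge1Dx (p * (ln k.+2%:R - ln k.+1%:R)).
  have h2 : p * (2 * k.+1%:R)^-1 <= p * (ln k.+2%:R - ln k.+1%:R) by rewrite ler_pM2l.
  rewrite e2 => h3; have E0 := expR_gt0 (p * ln k.+1%:R).
  have h4 : 1 + p * (2 * k.+1%:R)^-1 <= expR (p * (ln k.+2%:R - ln k.+1%:R)) := le_trans (lerD (lexx 1) h2) h3.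
  have := ler_wpM2l (ltW E0) h4; rewrite mulrDr mulr1 invfM.
  exact: alg_a.
have b1 : 4 * bk alpha N k.+1 = (8 * amp alpha N / p) * (p / 2 * (k.+1%:R `^ alpha)^-1).
  by rewrite /bk; move: (k.+1%:R `^ alpha)^-1 => z; field; rewrite gt_eqF.
have := ler_wpM2l c0 G; rewrite -b1.
have m : k.+1%:R `^ p <= k.+2%:R `^ p by apply: ge0_ler_powR; rewrite ?nnegrE ?ler0n ?ler_nat ?(ltW p0).
by move=> h; exact: alg_b h m N0.
Qed.

Lemma Phi_ln k : alpha = 1 -> (0 < k)%N -> Phi alpha N k <= 4 * N + 8 * amp alpha N * ln k%:R.
Proof.
move=> al1; have a0 := amp_gt0; case: k => // k _; elim: k => [|k IH].
  by rewrite /Phi big_geq // mulr0 addr0 ln1 mulr0 addr0.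
rewrite /Phi big_nat_recr //= mulrDr addrA -/(Phi alpha N k.+1).
apply: le_trans (lerD IH (lexx _)) _.
have h := ler_wpM2l (ltW a0) (ln_succ (ltn0Sn k)); rewrite /bk al1 powRr1 ?ler0n //.
rewrite invfM in h; rewrite al1 in h *.
exact: (alg_c N h).
Qed.
End sums.

Lemma dyadic_between r : 0 < r < 2^-1 -> exists2 k : nat, (0 < k)%N & 2 ^- k.+1 <= r <= 2 ^- k.
Proof.
move=> /andP[r0 r2]; have r1 : 1 <= r^-1 by rewrite invf_ge1 //; lra.
have [[|[|n]] /andP[n1 n2]] := pow2_between r1.
- by move: n1; rewrite expr0 invf_le1 //; lra.
- by move: n1; rewrite expr1 -[leRHS]invrK lef_pV2 ?posrE ?invr_gt0 //; lra.
exists n.+1 => //; apply/andP; split.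
  by rewrite -[leRHS]invrK lef_pV2 ?posrE ?invr_gt0 ?exprn_gt0.
rewrite -[leLHS]invrK lef_pV2 ?posrE ?invr_gt0 ?exprn_gt0 //.
by move: n2; rewrite [2 ^+ n.+2]exprS ler_pM2l.
Qed.

Lemma le_expR_div (s z w : R) : 0 < s -> z <= w + s^-1 * expR (s * (z - w)).
Proof.
move=> s0; have := expR_ge1Dx (s * (z - w)); rewrite -(ler_pM2l (_ : 0 < s^-1)) ?invr_gt0 // => h.
have E : s^-1 * (1 + s * (z - w)) = s^-1 + (z - w) by rewrite mulrDr mulr1 mulKf // gt_eqF.
have sV : 0 < s^-1 by rewrite invr_gt0.
by rewrite E in h; lra.
Qed.

Let expR_sq2 (z : R) : expR (2 * z) = expR z ^+ 2.
Proof. by rewrite expr2 -expRD; congr expR; ring. Qed.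

Let alg_d (P m b a h q V : R) : 0 <= h -> 0 <= b -> b <= a -> 0 <= q -> q <= 4 * V ->
  (P + m) * V + 16 * b * (h * q) <= (P + m + 64 * a * h) * V.
Proof.
move=> h0 b0 ba q0 qV; have : b * (h * q) <= a * (h * (4 * V)).
  by apply: ler_pM => //; [exact: mulr_ge0|exact: ler_wpM2l].
lra.
Qed.

Let alg_e (P m1 m2 c z : R) : P <= c * z -> m2 * 1 <= m2 * z ->
  2 * (P + m1 * z + m2) <= 2 * (c + (m1 + m2)) * z.
Proof. by move=> h1 h2; lra. Qed.

Let alg_f (a8 c L lk b P n m1 m2 : R) : 0 <= a8 -> 0 <= n + (m1 + m2) -> 0 < c -> c <= L -> lk <= L - b ->
  P <= n + a8 * lk -> 2 * (P + m1 + m2) <= 2 * (a8 * (1 + `|b| / c) + (n + (m1 + m2)) / c) * L.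
Proof.
move=> h1 h2 c0 cL hk hP; have L1 : 1 <= L / c by rewrite ler_pdivlMr // mul1r.
have h3 := ler_wpM2l h2 L1.
have h4 : `|b| * 1 <= `|b| * (L / c) by exact: ler_wpM2l.
have h5 : lk <= L + `|b| * (L / c) by have := ler_norm (- b); rewrite normrN; lra.
have h6 := ler_wpM2l h1 h5.
have -> : 2 * (a8 * (1 + `|b| / c) + (n + (m1 + m2)) / c) * L =
  2 * (a8 * (L + `|b| * (L / c)) + (n + (m1 + m2)) * (L / c)) by ring.
lra.
Qed.

Section norms.
Variables (alpha N H : R) (g : R * R -> R).
Hypothesis al0 : 0 <= alpha.
Hypothesis N0 : 0 < N.
Hypothesis H0 : 0 <= H.
Hypothesis cg : continuous g.
Let Ph := Phi alpha N.
Let si := sig alpha N.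
Hypothesis expg : forall k x, (0 < k)%N ->
  intA (eball x 1) (fun y => expR (si k * `|g y|)) <= H * expR (si k * Ph k).

Let ln2_gt0 : 0 < ln 2 :> R. Proof. by rewrite ln_gt0 // ltr1n. Qed.
Let p := 1 - alpha.
Let am := amp alpha N.

Let ce k c : continuous (fun y => expR (si k * (`|g y| - c))).
Proof.
apply: (@cont_comp _ _ _ (fun y => si k * (`|g y| - c)) expR); last exact: continuous_expR.
by apply: contM; [exact: cont_cst|apply: contB; [exact: cont_norm|exact: cont_cst]].
Qed.

Let si0 k : (0 < k)%N -> 0 < si k.
Proof. by move=> k0; rewrite invr_gt0 mulr_gt0 // bk_gt0. Qed.

Let siV k : (si k)^-1 = 16 * bk alpha N k. Proof. by rewrite invrK. Qed.

(** Only the exponential term is enlarged to the unit ball, where its moment is known; the smallness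
    of the ball is recovered afterwards through the choice of c. *)
Let ballE k x (c r : R) : (0 < k)%N -> 0 < r <= 1 ->
  intA (eball x r) (fun y => `|g y|) <= c * vol (eball x r) + (si k)^-1 * (expR (- (si k * c)) * (H * expR (si k * Ph k))).
Proof.
move=> k0 /andP[r0 r1]; have bB := bset_eball x r; have b1 := bset_eball x 1.
have s0 := si0 k0; have sV : 0 <= (si k)^-1 by rewrite invr_ge0 ltW.
have ccE : continuous (fun y => (si k)^-1 * expR (si k * (`|g y| - c))) by apply: contM; [exact: cont_cst|exact: ce].
apply: (@le_trans _ _ (intA (eball x r) (fun y => c + (si k)^-1 * expR (si k * (`|g y| - c))))).
  apply: intA_le => //; [exact: cont_norm|by apply: contD; [exact: cont_cst|exact: ccE]|].
  by move=> y _; exact: le_expR_div.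
rewrite (intAD bB (@cont_cst _ _ c) ccE) intA_cst // lerD2l (intAZ _ bB (@ce k c)) ler_wpM2l //.
have sub : eball x r `<=` eball x 1 by move=> y; rewrite /eball /= => h; exact: lt_le_trans h r1.
apply: le_trans (intA_sub bB b1 sub (@ce k c) (fun=> expR_ge0 _)) _.
have E : intA (eball x 1) (fun y => expR (si k * (`|g y| - c))) =
  expR (- (si k * c)) * intA (eball x 1) (fun y => expR (si k * (`|g y| - 0))).
  rewrite -intAZ //; apply: eq_int2 => y; congr (_ * _); rewrite -expRD subr0; congr expR; ring.
rewrite E ler_pM2l ?expR_gt0 //; apply: le_trans (expg x k0).
by rewrite le_eqVlt; apply/orP; left; apply/eqP; apply: eq_int2 => y; rewrite subr0.
Qed.

(* le_expR_div is used with w above the means by k ln 4 / si k, which compensates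
   the volume 4 ^- k of the ball. *)
Lemma avg_ball k x r : (0 < k)%N -> 2 ^- k.+1 <= r <= 2 ^- k ->
  intA (eball x r) (fun y => `|g y|) <= (Ph k + 32 * ln 2 * am * k%:R `^ p + 64 * am * H) * vol (eball x r).
Proof.
move=> k0 /andP[rk kr]; have s0 := si0 k0.
have r0 : 0 < r by apply: lt_le_trans rk; rewrite invr_gt0 exprn_gt0.
have r1 : r <= 1 by apply: (le_trans kr); rewrite invf_le1 ?exprn_gt0 // exprn_ege1 // ler1n.
have rr : 0 < r <= 1 by rewrite r0.
pose mu := k%:R * (2 * ln 2) / si k.
have h := @ballE k x (Ph k + mu) r k0 rr; apply: (le_trans h) => {h}.
have e4 : expR (- (si k * (Ph k + mu))) * (H * expR (si k * Ph k)) = H * (2 ^- k) ^+ 2.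
  rewrite mulrCA -expRD (_ : _ + _ = - (k%:R * (2 * ln 2))); last by rewrite /mu; field; rewrite gt_eqF.
  rewrite expRN mulrA [k%:R * 2]mulrC -mulrA expR_sq2 expRM_natl lnK ?posrE //.
  by rewrite exprVn.
rewrite e4 siV; have v1 := vol_eball_ge x r0; set V := vol _ in v1 *.
have v2 : (2 ^- k) ^+ 2 <= 4 * V.
  apply: (@le_trans _ _ (4 * r ^+ 2)); last by rewrite ler_pM2l.
  have h : 2 ^- k <= 2 * r by move: rk; rewrite exprS invfM; lra.
  rewrite (_ : 4 * r ^+ 2 = (2 * r) ^+ 2); last by ring.
  by rewrite ler_sqr ?nnegrE ?mulr_ge0 ?(ltW r0) // invr_ge0 exprn_ge0.
have V0 : 0 <= V by apply: le_trans v1; exact: sqr_ge0.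
have muE : mu = 32 * ln 2 * am * k%:R `^ p.
  rewrite /mu siV (_ : _ * _ = 32 * ln 2 * (k%:R * bk alpha N k)); last by ring.
  by rewrite k_bk // -/am mulrA.
have b1 := bk_le_amp al0 N0 k0; have b0 := ltW (bk_gt0 alpha N0 k0).
have q0 : 0 <= (2 ^- k) ^+ 2 :> R by exact: sqr_ge0.
by rewrite muE; exact: alg_d.
Qed.

Let rest : R := 32 * ln 2 * am + 64 * am * H.

Definition Labmo_const : R := 2 * ((4 * N + 8 * am / p) + rest) / ln 2 `^ p.
Definition Llog_const : R :=
  2 * (8 * am * (1 + `|ln (ln 2)| / ln (1 + ln 2)) + (4 * N + rest) / ln (1 + ln 2)).
Definition L1_const : R := (si 1)^-1 * (H * expR (si 1 * Ph 1)).

Let am0 : 0 < am. Proof. exact: amp_gt0. Qed.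

Let rest0 : 0 <= rest.
Proof.
have a := ltW am0; have l := ltW ln2_gt0.
by apply: addr_ge0; [exact: (mulr_ge0 (mulr_ge0 (ler0n _ _) l) a)|exact: (mulr_ge0 (mulr_ge0 (ler0n _ _) a) H0)].
Qed.

Lemma osc_avg k x r : (0 < k)%N -> 2 ^- k.+1 <= r <= 2 ^- k ->
  (osc x r g <= (2 * (Ph k + 32 * ln 2 * am * k%:R `^ p + 64 * am * H))%:E)%E.
Proof.
move=> k0 rk; have h := @avg_ball k x r k0 rk.
have r0 : 0 < r by have /andP[h1 _] := rk; apply: lt_le_trans h1; rewrite invr_gt0 exprn_gt0.
have v0 := lt_le_trans (exprn_gt0 2 r0) (vol_eball_ge x r0).
rewrite osc_intA // lee_fin mulrC ler_pdivrMr //.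
apply: le_trans (dev_mean 0 (bset_eball x r) cg v0) _.
rewrite -[leRHS]mulrA ler_pM2l //; apply: le_trans h; rewrite le_eqVlt; apply/orP; left; apply/eqP.
by apply: eq_int2 => y; rewrite subr0.
Qed.

Lemma L1uloc_bound : (L1uloc_norm g <= L1_const%:E)%E.
Proof.
apply: ge_ereal_sup => _ [x _ <-]; rewrite ereal_intA; [|exact: bset_eball|exact: cont_norm].
rewrite lee_fin; have r1 := introT andP (conj (@ltr01 R) (lexx (1 : R))).
by have := @ballE 1 x 0 1 isT r1; rewrite mul0r add0r mulr0 oppr0 expR0 mul1r.
Qed.

Let ln_dyadic k r : (0 < k)%N -> 0 < r -> r <= 2 ^- k -> k%:R * ln 2 <= - ln r.
Proof.
move=> k0 r0 rk; rewrite mulr_natl -lnXn // lerNr -lnV ?posrE ?exprn_gt0 //.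
by rewrite ler_ln ?posrE // invr_gt0 exprn_gt0.
Qed.

Lemma Labmo_bound : alpha < 1 -> (Labmo_norm (alpha - 1) g <= (Labmo_const + L1_const)%:E)%E.
Proof.
move=> al1; have p0 : 0 < p by rewrite subr_gt0.
rewrite EFinD; apply: leeD; last exact: L1uloc_bound.
apply: ge_ereal_sup => _ [[x r] /= r2 <-].
(* The exponent alpha - 1 is negative, so the radii in the norm are below 1/2, where
   [dyadic_between] applies. *)
rewrite ifF in r2; last by apply/negbTE; rewrite -ltNge; lra.
have /andP[r0 _] := r2.
have [k k0 rk] := dyadic_between r2; have /andP[_ kr] := rk.
have ho := osc_avg x k0 rk; have hl := ln_dyadic k0 r0 kr.
have kp : 0 < k%:R :> R by rewrite ltr0n.
have kl : 0 < k%:R * ln 2 :> R by rewrite mulr_gt0.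
have lr : 0 < - ln r := lt_le_trans kl hl.
have e : alpha - 1 = - p by rewrite /p opprB.
apply: le_trans (lee_wpmul2l _ ho) _; first by rewrite lee_fin powR_ge0.
rewrite -EFinM lee_fin e powRN mulrC ler_pdivrMr ?powR_gt0 //.
(* The weight is a negative power of -ln r, so the lower bound -ln r >= k ln 2 suffices; it turns
   k^p into the reciprocal of the weight. *)
have hp : k%:R `^ p * ln 2 `^ p <= (- ln r) `^ p.
  rewrite -powRM ?(ltW kp) ?(ltW ln2_gt0) //.
  by apply: ge0_ler_powR => //; rewrite ?nnegrE; exact: ltW.
have k1 : 1 <= k%:R `^ p.
  have k1 : 1 <= k%:R :> R by rewrite ler1n.
  by have := ler_powR k1 (ltW p0); rewrite powRr0.
have P := Phi_powR N0 al1 k0; rewrite -/p -/am -/Ph in P.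
have l2p : 0 < ln 2 `^ p :> R by rewrite powR_gt0.
apply: (@le_trans _ _ (2 * ((4 * N + 8 * am / p) + rest) * k%:R `^ p)).
  have h1 := ler_wpM2l rest0 k1; have h2 : 64 * am * H * 1 <= 64 * am * H * k%:R `^ p.
    by apply: ler_wpM2l => //; exact: (mulr_ge0 (mulr_ge0 (ler0n _ _) (ltW am0)) H0).
  by move: P h2; rewrite /rest; exact: alg_e.
rewrite /Labmo_const -[leRHS]mulrA ler_wpM2l //.
  apply: mulr_ge0 => //; apply: addr_ge0 => //; apply: addr_ge0; first by apply: mulr_ge0 => //; exact: ltW.
  by apply: divr_ge0; [apply: mulr_ge0 => //|]; exact: ltW.
by rewrite ler_pdivlMl // mulrC.
Qed.

Lemma Llogbmo_bound : alpha = 1 -> (Llogbmo_norm g <= (Llog_const + L1_const)%:E)%E.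
Proof.
move=> al1; rewrite EFinD; apply: leeD; last exact: L1uloc_bound.
apply: ge_ereal_sup => _ [[x r] /= r2 <-]; have /andP[r0 _] := r2.
have [k k0 rk] := dyadic_between r2; have /andP[_ kr] := rk.
have ho := osc_avg x k0 rk; have hl := ln_dyadic k0 r0 kr.
have kp : 0 < k%:R :> R by rewrite ltr0n.
have k1 : 1 <= k%:R :> R by rewrite ler1n.
have pe : p = 0 by rewrite /p al1 subrr.
have P := Phi_ln N0 al1 k0; rewrite -/am -/Ph in P.
rewrite pe powRr0 mulr1 in ho.
have ykl : 1 + k%:R * ln 2 <= 1 - ln r by rewrite lerD2l.
have y1 : 1 + ln 2 <= 1 - ln r.
  by apply: le_trans ykl; rewrite lerD2l ler_peMl // ltW.
have c0 : 0 < ln (1 + ln 2) :> R by rewrite ln_gt0 // ltrDl.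
have y0 : 0 < 1 - ln r by apply: lt_le_trans y1; rewrite addr_gt0.
have L1 : ln (1 + ln 2) <= ln (1 - ln r) by rewrite ler_ln ?posrE // addr_gt0.
have L0 := lt_le_trans c0 L1.
(* Taking logarithms in k ln 2 <= 1 - ln r leaves the negative number ln (ln 2); its absolute value,
   and all other constants, are absorbed by ln (1 - ln r) >= ln (1 + ln 2) > 0. *)
have Lk : ln k%:R <= ln (1 - ln r) - ln (ln 2).
  rewrite lerBrDr -lnM ?posrE // ler_ln ?posrE //; last by rewrite mulr_gt0.
  by apply: le_trans ykl; rewrite lerDr.
apply: le_trans (lee_wpmul2l _ ho) _; first by rewrite lee_fin invr_ge0 ltW.
rewrite -EFinM lee_fin mulrC ler_pdivrMr // /Llog_const.
have a8 : 0 <= 8 * am by apply: mulr_ge0 => //; exact: ltW.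
have r4 : 0 <= 4 * N + rest by apply: addr_ge0 => //; apply: mulr_ge0 => //; exact: ltW.
exact: (alg_f a8 r4 c0 L1 Lk P).
Qed.
End norms.

End VorticityNorms.

(** * Reading the norms of the data and assembling the estimates *)

Section Conclusion.
Variable R : realType.
Implicit Types (x y a : R * R) (r t s : R) (f g : R * R -> R).

Lemma osc_ge0 x r f : (0 <= osc x r f)%E.
Proof.
apply: mule_ge0; last exact: integral_ge0.
by rewrite lee_fin invr_ge0 /area fine_ge0.
Qed.

Lemma L1uloc_ge0 f : (0 <= L1uloc_norm f)%E.
Proof.
apply: le_trans (ereal_sup_ubound _) => /=; last by exists 0.
by apply: integral_ge0 => y _; rewrite lee_fin.
Qed.

Lemma osc_le_Labmo (alpha : R) f x r : 0 <= alpha -> 0 < r < 1 ->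
  (((- ln r) `^ alpha)%:E * osc x r f <= Labmo_norm alpha f)%E.
Proof.
move=> al0 r1; apply: le_trans (leeDl _ (L1uloc_ge0 f)).
by apply: ereal_sup_ubound; exists (x, r) => //=; rewrite al0.
Qed.

Lemma L1_le_Labmo (alpha : R) f x : 0 <= alpha ->
  (\int[leb2 R]_(y in eball x 1) `|f y|%:E <= Labmo_norm alpha f)%E.
Proof.
move=> al0; apply: le_trans (leeDr _ _).
  by apply: ereal_sup_ubound; exists x.
have h0 : 0 < (2^-1 : R) by rewrite invr_gt0.
have h1 : (2^-1 : R) < 1 by rewrite invf_lt1 // ltr1n.
have r1 := introT andP (conj h0 h1).
apply: le_trans (ereal_sup_ubound _) => /=; last by exists (0, 2^-1) => //=; rewrite al0.
by apply: mule_ge0; [rewrite lee_fin powR_ge0|exact: osc_ge0].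
Qed.

Lemma Labmo_ge0 (alpha : R) f : 0 <= alpha -> (0 <= Labmo_norm alpha f)%E.
Proof. by move=> al0; apply: le_trans (L1_le_Labmo f 0 al0); apply: integral_ge0 => y _; rewrite lee_fin. Qed.

Lemma Linfty_norm_le (u : R * R -> R * R) (M : R) : (forall x, enorm (u x) <= M) ->
  (Linfty_norm u <= M%:E)%E.
Proof.
move=> uM; rewrite /Linfty_norm unlock /Lnorm.
have M0 : 0 <= M := le_trans (enorm_ge0 _) (uM 0).
case: ifP => _; last by rewrite lee_fin.
apply/ess_sup_inf.ess_supP; apply: nearW => x /=; rewrite lee_fin ger0_norm ?enorm_ge0 //.
Qed.

Section assembly.
Variables (alpha N U0 : R) (f : R * R -> R).
Hypothesis al0 : 0 <= alpha.
Hypothesis N0 : 0 < N.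
Hypothesis cf : continuous f.
Hypothesis oscN : forall x r, 0 < r < 1 -> (osc x r f <= (N / (- ln r) `^ alpha)%:E)%E.
Hypothesis L1N : forall x, intA (eball x 1) (fun y => `|f y|) <= N.

(** The exponential moment at the first scale, k = 1, dominates the fourth power up to 4!, so the
    velocity estimate needs no other information on the initial vorticity. *)
Lemma moment_square : exists2 D : R, 0 <= D &
  forall y n, intA (square y (2 ^+ n)) (fun x => f x ^+ 4) <= D * (2 ^+ n) ^+ 2.
Proof.
have k1 : (0 < 1)%N by [].
have s0 : 0 < sig alpha N 1 by rewrite invr_gt0 mulr_gt0 // bk_gt0.
set s := sig alpha N 1 in s0.
have c0 : 0 <= 24 / s ^+ 4 by rewrite divr_ge0 // exprn_ge0 // ltW.
exists (24 / s ^+ 4 * (4 * expR (s * Phi alpha N 1))) => [|y n].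
  by rewrite mulr_ge0 // mulr_ge0 // expR_ge0.
have ce : continuous (fun x => expR (s * `|f x|)).
  apply: (@cont_comp _ _ _ (fun x => s * `|f x|) expR); last exact: continuous_expR.
  by apply: contM; [exact: cont_cst|exact: cont_norm].
apply: (@le_trans _ _ (intA (square y (2 ^+ n)) (fun x => 24 / s ^+ 4 * expR (s * `|f x|)))).
  apply: intA_le; [exact: bset_square|exact: continuous_expr4|by apply: contM; [exact: cont_cst|exact: ce]|].
  by move=> x _; exact: expr4_le_expR.
rewrite intAZ //; last exact: bset_square.
rewrite -[leRHS]mulrA ler_wpM2l //; apply: le_trans (exp_moment_square cf al0 N0 oscN L1N y n k1) _.
by rewrite -/s le_eqVlt; apply/orP; left; apply/eqP; ring.
Qed.

Lemma exp_moment_solution v u u0 (A B t : R) : smooth v -> (forall t x, 0 <= t -> u t x = v (t, x)) -> euler_solution u0 u ->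
  0 < A -> 0 < B -> (forall x, vor v (0, x) = f x) -> 0 <= t ->
  (forall s x, 0 <= s -> enorm (u s x) <= A * expR (B * s)) ->
  forall k x, (0 < k)%N -> intA (eball x 1) (fun y => expR (sig alpha N k * `|vor v (t, y)|)) <=
    32 * (A / B * expR (B * t) + 4) ^+ 4 * expR (sig alpha N k * Phi alpha N k).
Proof.
move=> sv uv sol A0 B0 v0 t0 hu k x k0.
have s0 : 0 < sig alpha N k by rewrite invr_gt0 mulr_gt0 // bk_gt0.
have da s : is_derive s (1:R) (fun s => A / B * expR (B * s)) (A * expR (B * s)).
  apply: is_derive_eq (is_derive_expR_lin (A / B) B s) _.
  by rewrite mulrA divfK // gt_eqF.
have a0 s : 0 <= A / B * expR (B * s) by rewrite mulr_ge0 ?expR_ge0 // divr_ge0 // ltW.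
have ub s y : 0 <= s <= t -> enorm (u s y) <= A * expR (B * s) by move=> /andP[h _]; exact: hu.
have hM y n : intA (square y (2 ^+ n)) (fun x => expR (sig alpha N k * `|vor v (0, x)|)) <=
    4 * expR (sig alpha N k * Phi alpha N k) * (2 ^+ n) ^+ 2.
  have h := exp_moment_square cf al0 N0 oscN L1N y n k0.
  rewrite mulrAC; apply: le_trans h; rewrite le_eqVlt; apply/orP; left; apply/eqP.
  by apply: eq_int2 => z; rewrite v0.
have := @exp_ball R v u u0 sv uv sol _ _ t t0 da (@continuous_expR_lin R A B) a0 ub _ _ x s0 hM.
by move/le_trans; apply; rewrite le_eqVlt; apply/orP; left; apply/eqP; ring.
Qed.
End assembly.
End Conclusion.

Theorem proposition3p6 (R : realType) (alpha : R) (u0 : R * R -> R * R) :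
  0 <= alpha <= 1 ->
  in_Linfty u0 ->
  (forall x, divergence u0 x = 0) ->
  in_Labmo alpha (vorticity u0) ->
  exists C : R -> R,
    (forall t : R, 0 <= t -> 0 < C t) /\
    forall u : R -> R * R -> R * R, euler_solution u0 u ->
    forall t : R, 0 <= t ->
      (alpha < 1 ->
        (Linfty_norm (u t) + Labmo_norm (alpha - 1) (vorticity (u t))
         <= (C t)%:E * (1 + Labmo_norm alpha (vorticity u0)))%E) /\
      (alpha = 1 ->
        (Linfty_norm (u t) + Llogbmo_norm (vorticity (u t))
         <= (C t)%:E * (1 + Labmo_norm 1 (vorticity u0)))%E).
Proof.
move=> /andP[al0 al1] _ _ [_ finN].
(* One solution [w] is used only to learn facts about the data: the initial vorticity is continuous
   and [u0] is bounded at every point. These facts hold for all solutions from [u0], so the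
   constants do not refer to [w]. *)
have [[w solw]|no] := pselect (exists u, euler_solution u0 u); last first.
  by exists (fun=> 1); split=> // u su; case: no; exists u.
have [vw svw uvw] := euler_smooth solw.
set f := vorticity u0 in finN *.
have fE (v : R * (R * R) -> R * R) (u : R -> R * R -> R * R) : (forall t x, 0 <= t -> u t x = v (t, x)) -> smooth v -> euler_solution u0 u ->
    forall x, vor v (0, x) = f x.
  move=> uv sv sol x; rewrite /f -(@vorticity_vor R v u) //.
  by congr (vorticity _ x); apply/funext => y; exact: (euler_init sol).
have cf : continuous f.
  have -> : f = fun x => vor vw (0, x) by apply/funext => x; rewrite (fE vw w).
  exact: continuous_slice (Cn_cont (Cn_vor svw 0)).
have NN := Labmo_ge0 f al0.
have fN : Labmo_norm alpha f \is a fin_num by rewrite ge0_fin_numE.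
(* The added 1 keeps [N] positive even when the initial vorticity vanishes, as the division by [bk]
   in the exponent [sig] requires. *)
pose N := fine (Labmo_norm alpha f) + 1.
have N0 : 0 < N by rewrite ltr_wpDl // fine_ge0.
have LN : (Labmo_norm alpha f <= N%:E)%E by rewrite -(fineK fN) lee_fin lerDl.
have oscN x r : 0 < r < 1 -> (osc x r f <= (N / (- ln r) `^ alpha)%:E)%E.
  move=> r1; have := le_trans (osc_le_Labmo f x al0 r1) LN; rewrite osc_intA // -EFinM !lee_fin.
  have lr : 0 < - ln r by have /andP[r0 r1'] := r1; rewrite oppr_gt0 ln_lt0.
  by rewrite mulrC ler_pdivlMr // powR_gt0.
have L1N x : intA (eball x 1) (fun y => `|f y|) <= N.
  have := le_trans (L1_le_Labmo f x al0) LN; rewrite ereal_intA ?lee_fin //; first exact: bset_eball.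
  exact: cont_norm.
have [D D0 hD] := moment_square al0 N0 cf oscN L1N.
have [M hM] := euler_bounded solw (lexx 0).
have hU0 x : enorm (u0 x) <= `|M|.
  by rewrite -(euler_init solw) (le_trans (hM 0 x _)) ?lexx // ler_norm.
have [[A B] /= [A0 B0] hV] := velocity_bound D0 (normr_ge0 M).
pose H t := 32 * (A / B * expR (B * t) + 4) ^+ 4.
(* Both cases share one function: the absolute values keep it positive whatever the value of the
   constant that does not concern the given alpha. *)
pose C t := A * expR (B * t) + (`|Labmo_const alpha N (H t) + L1_const alpha N (H t)| +
   `|Llog_const alpha N (H t) + L1_const alpha N (H t)|).
have C0 t : 0 < C t by rewrite ltr_wpDr ?mulr_gt0 ?expR_gt0 // addr_ge0.
(* The size of the data is already inside [C], so the factor in the conclusion is simply bounded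
   below by 1. *)
have C1 t z : (0 <= z)%E -> ((C t)%:E <= (C t)%:E * (1 + z))%E.
  by move=> z0; rewrite -[leLHS]mule1 lee_wpmul2l ?lee_fin ?(ltW (C0 t)) // leeDl.
exists C; split=> [t _|u sol t t0]; first exact: C0.
have [v sv uv] := euler_smooth sol.
have fv := fE v u uv sv sol.
have hD' y n : intA (square y (2 ^+ n)) (fun x => vor v (0, x) ^+ 4) <= D * (2 ^+ n) ^+ 2.
  have -> : (fun x => vor v (0, x) ^+ 4) = (fun x => f x ^+ 4) by apply/funext => z; rewrite fv.
  exact: hD.
have hu s x : 0 <= s -> enorm (u s x) <= A * expR (B * s) := hV v u u0 sv uv sol hU0 hD' s x.
have hI : (Linfty_norm (u t) <= (A * expR (B * t))%:E)%E by apply: Linfty_norm_le => x; exact: hu.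
have cg : continuous (fun x => vor v (t, x)) by exact: continuous_slice (Cn_cont (Cn_vor sv 0)).
have gE : vorticity (u t) = fun x => vor v (t, x) by apply/funext => x; exact: vorticity_vor.
have eg := exp_moment_solution al0 N0 cf oscN L1N sv uv sol A0 B0 fv t0 hu.
have H0 : 0 <= H t.
  by apply: mulr_ge0 => //; apply: exprn_ge0; rewrite addr_ge0 // mulr_ge0 ?expR_ge0 // divr_ge0 // ltW.
rewrite gE; split=> ha.
  apply: le_trans (C1 t _ NN); apply: le_trans (leeD hI (Labmo_bound al0 N0 H0 cg eg ha)) _.
  by rewrite -EFinD lee_fin /C lerD2l (le_trans (ler_norm _)) // lerDl.
apply: le_trans (C1 t _ _); last by apply: Labmo_ge0.
apply: le_trans (leeD hI (Llogbmo_bound al0 N0 H0 cg eg ha)) _.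
by rewrite -EFinD lee_fin /C lerD2l (le_trans (ler_norm _)) // lerDr.
Qed.
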